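(* Let $0\le\varepsilon<1$ and let $F_\varepsilon$ be the Katok--Ziller metric on $\mathbb{S}^2$ given, in polar coordinates $(\phi,\theta)$, $\phi\in(0,\pi)$, $\theta\in[0,2\pi]$, with associated fiber coordinates $(\xi_\phi,\xi_\theta)$, by $$F_\varepsilon(\phi,\theta;\xi_\phi,\xi_\theta)=\frac{1}{1-\varepsilon^2\sin^2\phi}\left(\sqrt{(1-\varepsilon^2\sin^2\phi)\,\xi_\phi^2+\sin^2\phi\;\xi_\theta^2}-\varepsilon\sin^2\phi\;\xi_\theta\right)$$ (extended to the poles). Let $\lambda_1(\varepsilon)$ be the smallest non-zero eigenvalue of $-\Delta^{F_\varepsilon}$, where $\Delta^{F_\varepsilon}$ is the Finsler--Laplace operator of $F_\varepsilon$. Then $$\lambda_1(\varepsilon)=2-2\varepsilon^2=\frac{8\pi}{\mathrm{vol}_{\Omega^{F_\varepsilon}}(\mathbb{S}^2)},$$ where $\mathrm{vol}_{\Omega^{F_\varepsilon}}(\mathbb{S}^2)=\int_{\mathbb{S}^2}\Omega^{F_\varepsilon}$.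
   Context: A Finsler metric on an $n$-manifold $M$ is a continuous function $F\colon TM\to[0,\infty)$ that is $C^\infty$ off the zero section, satisfies $F(x,\lambda v)=\lambda F(x,v)$ for $\lambda>0$, satisfies $F(x,v)\ge 0$ with equality iff $v=0$, and is strongly convex: $\left(\frac{\partial^2F^2}{\partial v_i\partial v_j}\right)_{i,j}$ is positive definite (off the zero section). Let $HM=(TM\smallsetminus\{0\})/\mathbb{R}^+_*$, $r\colon TM\smallsetminus\{0\}\to HM$ and $\pi\colon HM\to M$ the projections, $H_xM=\pi^{-1}(x)$, $VHM=\ker d\pi$. The Hilbert form $A$ of $F$ is the $1$-form on $HM$ given by $A_{(x,\xi)}(Z)=\lim_{\epsilon\to0}\frac{1}{\epsilon}\left(F(x,v+\epsilon\, d\pi(Z))-F(x,v)\right)$ for any $v$ with $r(x,v)=(x,\xi)$. It is a contact form; its Reeb field $X$ ($A(X)=1$, $i_XdA=0$) generates the geodesic flow. There is a unique volume form $\Omega^F$ on $M$, and an $(n-1)$-form $\alpha^F$ on $HM$, nowhere zero on $VHM$ and uniquely determined on $VHM$, such that $\alpha^F\wedge\pi^*\Omega^F=A\wedge dA^{n-1}$ and $\int_{H_xM}\alpha^F=\mathrm{vol}_{\mathrm{Eucl}}(\mathbb{S}^{n-1})$ for all $x$ (orientations chosen compatibly). The Finsler--Laplace operator is $$\Delta^Ff(x)=\frac{n}{\mathrm{vol}_{\mathrm{Eucl}}(\mathbb{S}^{n-1})}\int_{H_xM}L_X^2(\pi^*f)\,\alpha^F .$$ On a closed manifold $-\Delta^F$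 has discrete non-negative spectrum. The metrics $F_\varepsilon$ are the Katok--Ziller metrics associated with the standard Riemannian metric of $\mathbb{S}^2$ and its rotational Killing field. *)

(* Defs.v *)
From mathcomp Require Import all_boot all_order all_algebra.
From mathcomp Require Import all_classical all_reals all_analysis ring lra.

Set Implicit Arguments.
Unset Strict Implicit.
Unset Printing Implicit Defensive.

Import Order.TTheory GRing.Theory Num.Theory.
Import numFieldNormedType.Exports.

Local Open Scope classical_set_scope.
Local Open Scope ring_scope.

(* Conventions.  S^2 is the Euclidean unit sphere of R^3; a pair (x, v) is a
   base point and a vector at that point.  HS^2 = (TS^2 \ 0) / R_+^* is
   represented by the unit tangent bundle [HS2]: every ray of T_x S^2 contains
   exactly one Euclidean unit vector.  The projection HS^2 -> S^2 is [fst], its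
   differential is [fst] too, and a vertical vector is one whose first
   component is 0.

   Objects living on S^2 or HS^2 are functions on the ambient space of which
   only the values on S^2, HS^2 and their tangent vectors matter.  They are
   differentiated after composition with a retraction of a neighbourhood onto
   the submanifold ([unitv], resp. [hretr]), which makes the result independent
   of the values elsewhere. *)

Section Sphere.
Variable R : realType.
Local Notation V := 'rV[R]_3.

Definition vec3 (a b c : R) : V := \row_(i < 3) [:: a; b; c]`_i.

Definition dot (u v : V) : R := \sum_(i < 3) u 0 i * v 0 i.

(* Not the library norm of 'rV_3, which is the sup norm. *)
Definition enorm (v : V) : R := Num.sqrt (dot v v).

Definition unitv (v : V) : V := (enorm v)^-1 *: v.

Definition cross (u v : V) : V :=
  vec3 (u 0 1 * v 0 2 - u 0 2 * v 0 1)
       (u 0 2 * v 0 0 - u 0 0 * v 0 2)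
       (u 0 0 * v 0 1 - u 0 1 * v 0 0).

Definition S2 : set V := [set x | dot x x = 1].

Definition TS2 : set (V * V) := [set p | S2 p.1 /\ dot p.1 p.2 = 0].

Definition HS2 : set (V * V) := [set p | TS2 p /\ dot p.2 p.2 = 1].

(* The kernel of the differential of the equations of HS2. *)
Definition tangentHS2 (p : V * V) : set (V * V) :=
  [set Z | [/\ dot p.1 Z.1 = 0, dot p.2 Z.1 + dot p.1 Z.2 = 0
             & dot p.2 Z.2 = 0]].

Definition hretr (p : V * V) : V * V :=
  let x := unitv p.1 in (x, unitv (p.2 - dot x p.2 *: x)).

Fixpoint Ck_on (k : nat) (U : set V) (f : V -> R) : Prop :=
  if k is k'.+1 then
    (forall x, U x -> differentiable f x) /\ (forall v, Ck_on k' U ('D_v f))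
  else forall x, U x -> {for x, continuous f}.

Definition smooth_S2 (f : V -> R) : Prop :=
  forall k, Ck_on k [set x | x != 0] (f \o unitv).

Definition polar (phi theta : R) : V :=
  vec3 (sin phi * cos theta) (sin phi * sin theta) (cos phi).

Definition polar_phi (phi theta : R) : V := derive1 (polar ^~ theta) phi.

Definition polar_theta (phi theta : R) : V := derive1 (polar phi) theta.

(* d beta for a 1-form beta on HS2: the exterior derivative, on constant vector
   fields, of the pull-back of beta by the retraction. *)
Definition extd (beta : V * V -> V * V -> R) (p Z W : V * V) : R :=
  let ext q Y := beta (hretr q) ('D_Y hretr q) in
  'D_Z (ext ^~ W) p - 'D_W (ext ^~ Z) p.

Definition wedge12 (a : V * V -> R) (b : V * V -> V * V -> R)
    (Z1 Z2 Z3 : V * V) : R :=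
  a Z1 * b Z2 Z3 - a Z2 * b Z1 Z3 + a Z3 * b Z1 Z2.

(* Lie derivative of a function on HS2 along a vector field of HS2. *)
Definition lie (X : V * V -> V * V) (g : V * V -> R) (p : V * V) : R :=
  'D_(X p) (g \o hretr) p.

(* S^2 carries the outward orientation, for which (e, cross x e) is direct.
   The circles H_x S^2 are traversed clockwise: A /\ dA is minus the product
   (counterclockwise angle form) /\ (area form), so this is the orientation of
   the fibres for which A /\ dA = alpha /\ pi^* Omega with alpha and Omega both
   positive.  The starting vector of the circle is immaterial. *)
Definition fibre (x : V) (t : R) : V * V :=
  let e := xget 0 [set e | HS2 (x, e)] in
  (x, cos t *: e - sin t *: cross x e).

Definition fibre_integral (beta : V * V -> V * V -> R) (x : V) : R :=
  \int[@lebesgue_measure R]_(t in `[0, 2 * pi])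
    beta (fibre x t) (derive1 (fibre x) t).

Definition S2_integral (Omega : V -> V -> V -> R) : R :=
  \int[@lebesgue_measure R]_(phi in `[0, pi])
    \int[@lebesgue_measure R]_(theta in `[0, 2 * pi])
      Omega (polar phi theta) (polar_phi phi theta) (polar_theta phi theta).

Definition vol_S1 : R := 2 * pi.

Section FinslerLaplace.
Variable F : V * V -> R.

(* By homogeneity of F the derivative is the same at every point of the ray of
   p.2, so it may be taken at the unit representative. *)
Definition hilbert (p Z : V * V) : R := 'D_(Z.1) (fun v => F (p.1, v)) p.2.

Definition reeb (p : V * V) : V * V :=
  xget 0 [set Z | [/\ tangentHS2 p Z, hilbert p Z = 1
                    & forall W, tangentHS2 p W -> extd hilbert p Z W = 0]].

Definition is_volume_form (Omega : V -> V -> V -> R) : Prop :=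
  forall x, S2 x ->
  [/\ forall (k : R) u v w, TS2 (x, u) -> TS2 (x, v) -> TS2 (x, w) ->
        Omega x (k *: u + v) w = k * Omega x u w + Omega x v w,
      forall u, TS2 (x, u) -> Omega x u u = 0,
      forall u v, TS2 (x, u) -> TS2 (x, v) -> Omega x u v = - Omega x v u
    & exists u v, [/\ TS2 (x, u), TS2 (x, v) & Omega x u v != 0]].

Definition is_angle_form (alpha : V * V -> V * V -> R) : Prop :=
  forall p, HS2 p ->
  (forall (k : R) Z W, tangentHS2 p Z -> tangentHS2 p W ->
     alpha p (k *: Z + W) = k * alpha p Z + alpha p W) /\
  (forall Z, tangentHS2 p Z -> Z.1 = 0 -> Z != 0 -> alpha p Z != 0).

(* For a given F these conditions determine, pointwise, Omega on the tangent
   planes of S^2 and alpha on the vertical vectors; smoothness of these values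
   is then automatic. *)
Definition is_volume_angle (Omega : V -> V -> V -> R)
    (alpha : V * V -> V * V -> R) : Prop :=
  [/\ is_volume_form Omega, is_angle_form alpha,
      forall p Z1 Z2 Z3, HS2 p ->
        tangentHS2 p Z1 -> tangentHS2 p Z2 -> tangentHS2 p Z3 ->
        wedge12 (alpha p) (fun Z W => Omega p.1 Z.1 W.1) Z1 Z2 Z3 =
        wedge12 (hilbert p) (extd hilbert p) Z1 Z2 Z3
    & forall x, S2 x -> fibre_integral alpha x = vol_S1].

Definition volume_angle :
    (V -> V -> V -> R) * (V * V -> V * V -> R) :=
  xget ((fun _ _ _ => 0), (fun _ _ => 0))
    [set b | is_volume_angle b.1 b.2].

Definition finsler_volume_form : V -> V -> V -> R := volume_angle.1.

Definition finsler_angle_form : V * V -> V * V -> R := volume_angle.2.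

Definition finsler_volume : R := S2_integral finsler_volume_form.

Definition finsler_laplace (f : V -> R) (x : V) : R :=
  2 / vol_S1 *
  fibre_integral (fun p Z =>
    lie reeb (lie reeb (f \o fst)) p * finsler_angle_form p Z) x.

(* Eigenvalue of - Delta^F. *)
Definition laplace_eigenvalue (l : R) : Prop :=
  exists f : V -> R,
    [/\ smooth_S2 f, exists2 x, S2 x & f x != 0
      & forall x, S2 x -> - finsler_laplace f x = l * f x].

Definition smallest_nonzero_eigenvalue (l : R) : Prop :=
  [/\ laplace_eigenvalue l, l != 0
    & forall m, laplace_eigenvalue m -> m != 0 -> l <= m].

End FinslerLaplace.

(* Continuity on TS2 determines F over the poles. *)
Definition katok_ziller (eps : R) (F : V * V -> R) : Prop :=
  {within TS2, continuous F} /\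
  forall phi theta xi_phi xi_theta : R,
    0 < phi < pi -> 0 <= theta <= 2 * pi ->
    F (polar phi theta,
       xi_phi *: polar_phi phi theta + xi_theta *: polar_theta phi theta) =
    (1 - eps ^+ 2 * sin phi ^+ 2)^-1 *
    (Num.sqrt ((1 - eps ^+ 2 * sin phi ^+ 2) * xi_phi ^+ 2
               + sin phi ^+ 2 * xi_theta ^+ 2)
     - eps * sin phi ^+ 2 * xi_theta).

Lemma derive1_vec3 (f g h : R -> R) (t a b c : R) :
  is_derive t 1 f a -> is_derive t 1 g b -> is_derive t 1 h c ->
  derive1 (fun s => vec3 (f s) (g s) (h s)) t = vec3 a b c.
Proof.
move=> df dg dh.
have co i : (fun s => vec3 (f s) (g s) (h s) 0 i) = [:: f; g; h]`_i.
  by apply/funext => s; rewrite mxE; case: i => -[|[|[|?]]].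
rewrite derive1E derive_mx.
  apply/rowP => i; rewrite !mxE co.
  by case: i => -[|[|[|?]]]//= _; rewrite derive_val.
apply/derivable_mxP => i j; rewrite ord1 co.
by case: j => -[|[|[|?]]]//= _; exact: ex_derive.
Qed.

Lemma polar_phiE phi theta :
  polar_phi phi theta =
  vec3 (cos phi * cos theta) (cos phi * sin theta) (- sin phi) :> V.
Proof.
by apply: derive1_vec3; apply: is_derive_eq;
  rewrite ?scaler0 ?add0r ?addr0 /GRing.scale/=; ring.
Qed.

Lemma polar_thetaE phi theta :
  polar_theta phi theta =
  vec3 (- (sin phi * sin theta)) (sin phi * cos theta) 0 :> V.
Proof.
by apply: derive1_vec3; apply: is_derive_eq;
  rewrite ?scaler0 ?add0r ?addr0 /GRing.scale/=; ring.
Qed.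

Lemma dotE (u v : V) : dot u v = u 0 0 * v 0 0 + u 0 1 * v 0 1 + u 0 2 * v 0 2.
Proof.
rewrite /dot !big_ord_recr big_ord0/= add0r.
by congr (_ * _ + _ * _ + _ * _); congr (_ _ _); apply/val_inj.
Qed.

(* With K the rotational Killing field, |K|^2 = x_0^2 + x_1^2 = sin^2 phi. *)
Lemma katok_ziller_exists (eps : R) : 0 <= eps < 1 ->
  exists F : V * V -> R, katok_ziller eps F.
Proof.
move=> /andP[e0 e1].
pose k (p : V * V) := 1 - eps ^+ 2 * (p.1 0 0 ^+ 2 + p.1 0 1 ^+ 2).
pose m (p : V * V) := p.1 0 0 * p.2 0 1 - p.1 0 1 * p.2 0 0.
pose n (p : V * V) := p.2 0 0 ^+ 2 + p.2 0 1 ^+ 2 + p.2 0 2 ^+ 2.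
pose F p := (k p)^-1 * (Num.sqrt (k p * n p + eps ^+ 2 * m p ^+ 2) - eps * m p).
exists F; split.
  have c1 i : continuous (fun p : V * V => p.1 0 i).
    move=> p; apply: (@continuous_comp _ _ _ fst (fun v : V => v 0 i)).
      exact: cvg_fst.
    exact: coord_continuous.
  have c2 i : continuous (fun p : V * V => p.2 0 i).
    move=> p; apply: (@continuous_comp _ _ _ snd (fun v : V => v 0 i)).
      exact: cvg_snd.
    exact: coord_continuous.
  have cc (c : R) : continuous (fun _ : V * V => c) by move=> p; exact: cvg_cst.
  have ck : continuous k.
    move=> p; apply: (cvgB (cc _ p)); apply: (cvgM (cc _ p)).
    by apply: (cvgD (cvgM (c1 _ p) (c1 _ p)) (cvgM (c1 _ p) (c1 _ p))).
  have cm : continuous m.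
    by move=> p; apply: (cvgB (cvgM (c1 _ p) (c2 _ p)) (cvgM (c1 _ p) (c2 _ p))).
  have cn : continuous n.
    by move=> p; apply: (cvgD (cvgD (cvgM (c2 _ p) (c2 _ p))
      (cvgM (c2 _ p) (c2 _ p))) (cvgM (c2 _ p) (c2 _ p))).
  apply: continuous_in_subspaceT => p; rewrite inE => -[].
  rewrite /S2/= dotE => px _.
  have k0 : k p != 0.
    rewrite gt_eqF// /k subr_gt0.
    have : eps ^+ 2 < 1 by nra.
    by nra.
  apply: (cvgM (cvgV k0 (ck p))).
  apply: cvgB; last exact: (cvgM (cc _ p) (cm p)).
  apply: (@continuous_comp _ _ _ (fun p => k p * n p + eps ^+ 2 * m p ^+ 2)
    Num.sqrt); last exact: sqrt_continuous.
  exact: (cvgD (cvgM (ck p) (cn p)) (cvgM (cc _ p) (cvgM (cm p) (cm p)))).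
move=> phi theta a b _ _; rewrite polar_phiE polar_thetaE /F /k /m /n !mxE/=.
have sp := cos2Dsin2 phi; have st := cos2Dsin2 theta.
have -> : (sin phi * cos theta) ^+ 2 + (sin phi * sin theta) ^+ 2 = sin phi ^+ 2.
  by rewrite -[RHS]mulr1 -st; ring.
set M := (X in eps * X); rewrite -/M.
have -> : M = sin phi ^+ 2 * b.
  by rewrite /M -[RHS]mulr1 -st; ring.
congr (_ * (Num.sqrt _ - _)); last by ring.
set N := (X in _ * X + _).
have -> : N = a ^+ 2 + sin phi ^+ 2 * b ^+ 2.
  transitivity (a ^+ 2 * (cos phi ^+ 2 * (cos theta ^+ 2 + sin theta ^+ 2) + sin phi ^+ 2)
    + sin phi ^+ 2 * b ^+ 2 * (cos theta ^+ 2 + sin theta ^+ 2)).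
    by rewrite /N; ring.
  by rewrite st !mulr1 sp mulr1.
by ring.
Qed.

End Sphere.

(* Main.v *)
(* F_eps is the Zermelo metric of the round sphere with wind eps K, K the
   rotational Killing field: F(x, v) = 1 iff |v - eps K| = 1.  With
   w = sqrt(1 - eps^2 |K|^2), computing A /\ dA in a frame adapted to (x, v)
   gives Omega^F = w^-3 times the round area, hence the volume, and an explicit
   Reeb field.  In the fibre average of L_X^2 the terms odd under v |-> -v
   cancel, and the remaining circle integrals are elementary, so Delta^F is an
   explicit elliptic operator on S^2: a second-order part diagonal in
   (K, x /\ K) plus a first-order part along x /\ K.

   The horizontal coordinates are eigenfunctions for 2 - 2 eps^2.  Let f be an
   eigenfunction for la < 2 - 2 eps^2 and refl the reflection fixing a meridian
   plane orthogonal to n.  The function f - f \o refl vanishes on the boundary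
   of the hemisphere <n, x> >= 0, while <n, x> is a positive supersolution
   there; a small perturbation of <n, x>, positive up to the boundary and still
   a strict supersolution, is a barrier, and the maximum principle gives
   f <= f \o refl on the hemisphere.  With the roles of n and - n exchanged,
   f is invariant under every such reflection, hence depends on the latitude
   only, and then solves an ordinary differential equation with a monotone
   quantity that vanishes at both poles; this forces la = 0 or f = 0. *)

Require Import Defs.
From mathcomp Require Import all_boot all_order all_algebra.
From mathcomp Require Import all_classical all_reals all_analysis ring lra.
Import Order.TTheory GRing.Theory Num.Theory.
Import numFieldNormedType.Exports.

Set Implicit Arguments.
Unset Strict Implicit.
Unset Printing Implicit Defensive.

Local Open Scope classical_set_scope.
Local Open Scope ring_scope.

(** The lower bound is proved pointwise, with no L^2 theory: an eigenvalue is just a real number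
    admitting a smooth real eigenfunction, and the comparison treats negative candidates like
    positive ones. Three facts carry it. The reflections reverse K, so they are isometries from
    F_eps to F_{- eps} and not of F_eps itself; yet the fibre average depends on eps only through
    eps^2, so the Laplacian commutes with them. The formula in the frame (K, x /\ K) degenerates at
    the poles, but both poles lie on the boundary of every hemisphere used, and contact with the
    barrier can only occur inside. Finally, the quotient of f - f \o refl by <n, x> has no evident
    continuous extension to that boundary; the quotient by the barrier is continuous on a compact
    set and so attains its maximum. As Omega and alpha come from a choice operator, one needs first
    that some pair exists, then that the defining conditions fix the values that enter the volume
    and the Laplacian. *)

Section Vectors.
Variable R : realType.
Local Notation V := 'rV[R]_3.
Implicit Types (u v x y e : V) (a b c k : R).

Lemma row3P u v :
  u 0 0 = v 0 0 -> u 0 1 = v 0 1 -> u 0 2 = v 0 2 -> u = v.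
Proof.
move=> h0 h1 h2; apply/rowP => i.
case: i => -[|[|[|?]]]// p.
- by rewrite (_ : Ordinal p = 0)//; exact/val_inj.
- by rewrite (_ : Ordinal p = 1)//; exact/val_inj.
- by rewrite (_ : Ordinal p = 2)//; exact/val_inj.
Qed.

Lemma vec3_0 a b c : vec3 a b c 0 0 = a. Proof. by rewrite mxE. Qed.
Lemma vec3_1 a b c : vec3 a b c 0 1 = b. Proof. by rewrite mxE. Qed.
Lemma vec3_2 a b c : vec3 a b c 0 2 = c. Proof. by rewrite mxE. Qed.
Definition vec3E := (vec3_0, vec3_1, vec3_2).

Lemma dotC u v : dot u v = dot v u.
Proof. by rewrite !dotE; ring. Qed.
Lemma dotDl u v y : dot (u + v) y = dot u y + dot v y.
Proof. by rewrite !dotE !mxE; ring. Qed.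
Lemma dotDr u v y : dot y (u + v) = dot y u + dot y v.
Proof. by rewrite !dotE !mxE; ring. Qed.
Lemma dotNl u y : dot (- u) y = - dot u y.
Proof. by rewrite !dotE !mxE; ring. Qed.
Lemma dotNr u y : dot y (- u) = - dot y u.
Proof. by rewrite !dotE !mxE; ring. Qed.
Lemma dotZl a u y : dot (a *: u) y = a * dot u y.
Proof. by rewrite !dotE !mxE; ring. Qed.
Lemma dotZr a u y : dot y (a *: u) = a * dot y u.
Proof. by rewrite !dotE !mxE; ring. Qed.
Lemma dot0l y : dot 0 y = 0.
Proof. by rewrite dotE !mxE; ring. Qed.
Lemma dot0r y : dot y 0 = 0.
Proof. by rewrite dotC dot0l. Qed.
Definition dotlin := (dotDl, dotDr, dotNl, dotNr, dotZl, dotZr, dot0l, dot0r).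

Lemma dot_ge0 u : 0 <= dot u u.
Proof. by rewrite dotE; nra. Qed.

Lemma dot_eq0 u : (dot u u == 0) = (u == 0).
Proof.
apply/eqP/eqP => [|->]; last by rewrite dot0l.
rewrite dotE -!expr2 => h.
have := sqr_ge0 (u 0 0); have := sqr_ge0 (u 0 1); have := sqr_ge0 (u 0 2).
move=> h2 h1 h0.
by apply: row3P; rewrite [RHS]mxE; apply/eqP; rewrite -sqrf_eq0 eq_le; apply/andP; split; lra.
Qed.

Lemma dot_gt0 u : (0 < dot u u) = (u != 0).
Proof. by rewrite lt_def dot_ge0 andbT dot_eq0. Qed.

Lemma dot_cross_l u v : dot u (cross u v) = 0.
Proof. by rewrite dotE !vec3E; ring. Qed.
Lemma dot_cross_r u v : dot v (cross u v) = 0.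
Proof. by rewrite dotE !vec3E; ring. Qed.
Lemma dot_cross_sqr u v :
  dot (cross u v) (cross u v) = dot u u * dot v v - dot u v ^+ 2.
Proof. by rewrite !dotE !vec3E; ring. Qed.

Lemma dot_cross_swap u v y : dot u (cross v y) = dot (cross u v) y.
Proof. by rewrite !dotE !vec3E; ring. Qed.

(* The rotational Killing field, i.e. the cross product with the north pole. *)
Definition killing x : V := vec3 (- x 0 1) (x 0 0) 0.

Lemma killingD u v : killing (u + v) = killing u + killing v.
Proof. by apply: row3P; rewrite !(vec3E, mxE)//=; ring. Qed.
Lemma killingZ a u : killing (a *: u) = a *: killing u.
Proof. by apply: row3P; rewrite !(vec3E, mxE)//=; ring. Qed.
Lemma dot_killing x : dot x (killing x) = 0.
Proof. by rewrite dotE !vec3E; ring. Qed.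
Lemma dot_killingC x y : dot (killing x) y = - dot x (killing y).
Proof. by rewrite !dotE !vec3E; ring. Qed.

Section Frame.
Variables (x v : V).
Hypotheses (xx : dot x x = 1) (xv : dot x v = 0) (vv : dot v v = 1).
Let t := cross x v.

Lemma frame_vt : dot v t = 0. Proof. exact: dot_cross_r. Qed.
Lemma frame_tt : dot t t = 1.
Proof. by rewrite dot_cross_sqr xx vv xv; ring. Qed.

Lemma frame_decomp y : y = dot y x *: x + dot y v *: v + dot y t *: t.
Proof.
(* With the Gram determinant of (x, v) left in, this is a polynomial identity valid for all vectors;
   orthonormality is substituted afterwards. *)
have -> : dot y t *: t = (dot x x * dot v v - dot x v ^+ 2) *: y
    - (dot v v * dot x y - dot x v * dot v y) *: x
    - (dot x x * dot v y - dot x v * dot x y) *: v.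
  by apply: row3P; rewrite !(vec3E, mxE) !dotE !vec3E; ring.
rewrite xx xv vv (dotC y x) (dotC y v).
by apply: row3P; rewrite !mxE; ring.
Qed.

(** With e3 the north pole, [killing v] is e3 /\ v, so this is Lagrange's identity for <e3 /\ v, x
    /\ v>. *)
Lemma frame_killingv_t : dot (killing v) t = x 0 2.
Proof.
transitivity (x 0 2 * dot v v - v 0 2 * dot x v).
  by rewrite !dotE !vec3E; ring.
by rewrite vv xv; ring.
Qed.

(** Together with [frame_killingv] and [frame_killingt] this is the skew matrix of [killing] in the
    frame (x, v, t); its three entries <K x, v>, <K x, t> and x_2 are all that later frame
    computations involve. *)
Lemma frame_killingx : killing x = dot (killing x) v *: v + dot (killing x) t *: t.
Proof. by rewrite {1}(frame_decomp (killing x)) (dotC _ x) dot_killing scale0r add0r. Qed.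

Lemma frame_killingv : killing v = - dot (killing x) v *: x + x 0 2 *: t.
Proof.
rewrite {1}(frame_decomp (killing v)) frame_killingv_t (dotC _ v) dot_killing scale0r addr0.
by rewrite dot_killingC dotC.
Qed.

Lemma frame_killingt : killing t = - dot (killing x) t *: x - x 0 2 *: v.
Proof.
rewrite {1}(frame_decomp (killing t)) (dotC _ t) dot_killing scale0r addr0.
have -> : dot (killing t) v = - x 0 2 by rewrite dot_killingC dotC frame_killingv_t.
by rewrite dot_killingC dotC !scaleNr.
Qed.

Lemma frame_killing_sqr : dot (killing x) (killing x) = dot (killing x) v ^+ 2 + dot (killing x) t ^+ 2.
Proof.
rewrite {1 2}frame_killingx !dotlin vv frame_vt frame_tt (dotC t v) frame_vt; ring.
Qed.

Lemma frame_cross_killing :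
  cross x (killing x) = dot (killing x) v *: t - dot (killing x) t *: v.
Proof.
have crossDr y z1 z2 : cross y (z1 + z2) = cross y z1 + cross y z2.
  by apply: row3P; rewrite !(vec3E, mxE); ring.
have crossZr y a z1 : cross y (a *: z1) = a *: cross y z1.
  by apply: row3P; rewrite !(vec3E, mxE); ring.
rewrite {1}frame_killingx crossDr !crossZr -/t.
have -> : cross x t = dot x v *: x - dot x x *: v.
  by rewrite /t; apply: row3P; rewrite !(vec3E, mxE) !dotE; ring.
by rewrite xx xv scale0r add0r scale1r scalerN.
Qed.

End Frame.

Lemma dot_killing_sqr x : dot x x = 1 -> dot (killing x) (killing x) = 1 - x 0 2 ^+ 2.
Proof. by rewrite !dotE !vec3E => <-; ring. Qed.

Lemma dot_killing_coord x : dot (killing x) (killing x) = x 0 0 ^+ 2 + x 0 1 ^+ 2.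
Proof. by rewrite dotE !vec3E; ring. Qed.

End Vectors.

(** * Derivatives along curves, gradients and normalisation *)

Section Curves.
Variable R : realType.
Local Notation V := 'rV[R]_3.

(** The two difference quotients are the same function; directional derivatives thus reduce to the
    one-variable rules below. *)
Lemma is_derive_line (U W : normedModType R) (f : U -> W) (a v : U) (df : W) :
  is_derive a v f df <-> is_derive (0 : R) 1 (fun h => f (h *: v + a)) df.
Proof.
have E : (fun h => h^-1 *: ((f \o shift a) (h *: v) - f a)) =
    (fun h => h^-1 *: (((fun h : R => f (h *: v + a)) \o shift (0:R)) (h *: (1:R)) -
             f ((0:R) *: v + a))).
  by apply/funext => h /=; rewrite addr0 [_ *: (1:R)]mulr1 scale0r add0r.
by split=> -[h1 h2]; split; rewrite /derivable /derive ?E // -?E.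
Qed.

(* The library states the rules of calculus for the pointwise operations on
   functions; the restatements below are for lambda-abstractions, which
   unification does not reliably match with them. *)
Lemma is_derive_ext (U W : normedModType R) (f g : U -> W) a v df :
  f =1 g -> is_derive a v f df -> is_derive a v g df.
Proof. by move=> /funext->. Qed.

Lemma is_derive_cste (U W : normedModType R) (k : W) (a v : U) :
  is_derive a v (fun=> k) 0.
Proof. exact: is_derive_cst. Qed.

Lemma is_derive_cast (U W : normedModType R) (f g : U -> W) a v df dg :
  is_derive a v f df -> f =1 g -> df = dg -> is_derive a v g dg.
Proof. by move=> + /funext <- <-. Qed.

Lemma is_deriveDe (U W : normedModType R) (f g : U -> W) a v df dg :
  is_derive a v f df -> is_derive a v g dg ->
  is_derive a v (fun h => f h + g h) (df + dg).
Proof. exact: is_deriveD. Qed.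

Lemma is_deriveBe (U W : normedModType R) (f g : U -> W) a v df dg :
  is_derive a v f df -> is_derive a v g dg ->
  is_derive a v (fun h => f h - g h) (df - dg).
Proof. exact: is_deriveB. Qed.

Lemma is_deriveNe (U W : normedModType R) (f : U -> W) a v df :
  is_derive a v f df -> is_derive a v (fun h => - f h) (- df).
Proof. exact: is_deriveN. Qed.

Lemma is_deriveMe (U : normedModType R) (f g : U -> R) a v df dg :
  is_derive a v f df -> is_derive a v g dg ->
  is_derive a v (fun h => f h * g h) (df * g a + f a * dg).
Proof.
move=> hf hg; apply: (is_derive_eq (is_deriveM hf hg)).
by rewrite /GRing.scale /=; ring.
Qed.

Lemma is_derive_sqr (U : normedModType R) (f : U -> R) a v df :
  is_derive a v f df -> is_derive a v (fun h => f h ^+ 2) (2 * f a * df).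
Proof.
by move=> hf; apply: (is_derive_eq (is_deriveMe hf hf)); ring.
Qed.

Lemma is_deriveVe (f : R -> R) (a v df : R) :
  is_derive a v f df -> f a != 0 -> is_derive a v (fun h => (f h)^-1) (- df / f a ^+ 2).
Proof.
move=> hf fa; apply: (is_derive_eq (is_deriveV fa hf)).
by rewrite /GRing.scale /= !mulNr mulrC.
Qed.

Lemma is_derive_sqrte (f : R -> R) (a df : R) :
  is_derive a 1 f df -> 0 < f a ->
  is_derive a 1 (fun h => Num.sqrt (f h)) (df / (2 * Num.sqrt (f a))).
Proof.
move=> hf fa; have := is_derive1_comp (is_derive1_sqrt fa) hf.
by move=> h; apply: (is_derive_eq h); rewrite mulrC.
Qed.

Lemma is_derive_curveP (x : R -> V) (t : R) (x' : V) :
  is_derive t 1 x x' <->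
  forall i, is_derive t 1 (fun h => x h 0 i) (x' 0 i).
Proof.
split=> [[dx xE] i|h].
  have /derivable_mxP dx' := dx.
  by split; [exact: dx'|rewrite -xE derive_mx// mxE].
have dx : derivable x t 1.
  by apply/derivable_mxP => i j; rewrite ord1; have [] := h j.
by split => //; rewrite derive_mx//; apply/rowP => i; rewrite mxE; have [] := h i.
Qed.

Lemma is_derive_scalee (k : R -> R) (x : R -> V) (t k' : R) (x' : V) :
  is_derive t 1 k k' -> is_derive t 1 x x' ->
  is_derive t 1 (fun h => k h *: x h) (k' *: x t + k t *: x').
Proof.
move=> hk /is_derive_curveP hx; apply/is_derive_curveP => i.
apply: (@is_derive_ext _ _ (fun h => k h * x h 0 i)) => [h|]; first by rewrite mxE.
by apply: (is_derive_eq (is_deriveMe hk (hx i))); rewrite !mxE.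
Qed.

Lemma is_derive_dot (x y : R -> V) (t : R) (x' y' : V) :
  is_derive t 1 x x' -> is_derive t 1 y y' ->
  is_derive t 1 (fun h => dot (x h) (y h)) (dot x' (y t) + dot (x t) y').
Proof.
move=> /is_derive_curveP hx /is_derive_curveP hy.
apply: (@is_derive_ext _ _
  (fun h => x h 0 0 * y h 0 0 + x h 0 1 * y h 0 1 + x h 0 2 * y h 0 2)).
  by move=> h; rewrite dotE.
have H i := is_deriveMe (hx i) (hy i).
apply: (is_derive_eq (is_deriveDe (is_deriveDe (H 0) (H 1)) (H 2))).
by rewrite !dotE; ring.
Qed.

Lemma is_derive_vec3 (f g k : R -> R) (t a b c : R) :
  is_derive t 1 f a -> is_derive t 1 g b -> is_derive t 1 k c ->
  is_derive t 1 (fun s => vec3 (f s) (g s) (k s)) (vec3 a b c).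
Proof.
move=> hf hg hk; apply/is_derive_curveP => -[[|[|[|?]]]// p];
  rewrite mxE/=; under eq_fun do rewrite mxE/=; assumption.
Qed.

Lemma is_derive_killing (x : R -> V) (t : R) (x' : V) :
  is_derive t 1 x x' -> is_derive t 1 (fun h => killing (x h)) (killing x').
Proof.
move=> /is_derive_curveP hx.
exact: (is_derive_vec3 (is_deriveNe (hx 1)) (hx 0) (is_derive_cst 0 t 1)).
Qed.

Lemma is_derive_pair (U W W' : normedModType R) (f : U -> W) (g : U -> W')
    a v df dg :
  is_derive a v f df -> is_derive a v g dg ->
  is_derive a v (fun h => (f h, g h)) (df, dg).
Proof.
move=> [cf <-] [cg <-].
have H : h^-1 *: (((fun h => (f h, g h)) \o shift a) (h *: v) - (f a, g a))
    @[h --> 0^'] --> ('D_v f a, 'D_v g a).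
  exact: (cvg_pair cf cg).
by split; [apply/cvg_ex; eexists; exact: H|apply/cvg_lim => //; exact: H].
Qed.

Lemma is_derive_fst (U W W' : normedModType R) (f : U -> W * W') a v d :
  is_derive a v f d -> is_derive a v (fun h => (f h).1) d.1.
Proof.
move=> [df <-]; have H : h^-1 *: (((fun h => (f h).1) \o shift a) (h *: v) - (f a).1)
    @[h --> 0^'] --> ('D_v f a).1.
  exact: (cvg_comp _ _ df (@cvg_fst _ _ _ _ _)).
by split; [apply/cvg_ex; eexists; exact: H|apply/cvg_lim => //; exact: H].
Qed.

Lemma is_derive_snd (U W W' : normedModType R) (f : U -> W * W') a v d :
  is_derive a v f d -> is_derive a v (fun h => (f h).2) d.2.
Proof.
move=> [df <-]; have H : h^-1 *: (((fun h => (f h).2) \o shift a) (h *: v) - (f a).2)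
    @[h --> 0^'] --> ('D_v f a).2.
  exact: (cvg_comp _ _ df (@cvg_snd _ _ _ _ _)).
by split; [apply/cvg_ex; eexists; exact: H|apply/cvg_lim => //; exact: H].
Qed.

Lemma is_derive_affine (U : normedModType R) (a v : U) (t : R) :
  is_derive t 1 (fun h : R => h *: v + a) v.
Proof.
apply/is_derive_line/(@is_derive_ext _ _ (fun h : R => h *: v + (t *: v + a))).
  by move=> h; rewrite [h *: (1:R)]mulr1 scalerDl addrA.
by have /is_derive_line := is_derive_id (t *: v + a) v.
Qed.

Lemma is_derive_continuous (U : normedModType R) (f : R -> U) (s : R) (f' : U) :
  is_derive s 1 f f' -> {for s, continuous f}.
Proof.
by move=> [df _]; apply/differentiable_continuous/derivable1_diffP.
Qed.

Definition grad (f : V -> R) (x : V) : V := \row_i 'D_(delta_mx 0 i) f x.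

Lemma derive_grad (f : V -> R) (x v : V) :
  differentiable f x -> 'D_v f x = dot (grad f x) v.
Proof.
move=> df; rewrite deriveE// {1}(row_sum_delta v) linear_sum/= /dot.
by apply: eq_bigr => i _; rewrite linearZ/= !mxE deriveE// mulrC.
Qed.

Lemma is_derive_grad (f : V -> R) (x : R -> V) (t : R) (x' : V) :
  differentiable f (x t) -> is_derive t 1 x x' ->
  is_derive t 1 (fun h => f (x h)) (dot (grad f (x t)) x').
Proof.
move=> df [dx xE]; have /derivable1_diffP dx' := dx.
have dfx : differentiable (f \o x) t by exact: differentiable_comp.
apply: DeriveDef; first exact/derivable1_diffP.
have Ed : 'd x t 1 = x' by rewrite -deriveE.
by rewrite deriveE// (@diff_comp _ _ _ _ x f)//= Ed -derive_grad// deriveE.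
Qed.

Lemma enorm_gt0 (x : V) : (0 < enorm x) = (x != 0).
Proof. by rewrite sqrtr_gt0 dot_gt0. Qed.

Lemma enorm_sqr (x : V) : enorm x ^+ 2 = dot x x.
Proof. by rewrite sqr_sqrtr// dot_ge0. Qed.

Lemma enorm1 (x : V) : dot x x = 1 -> enorm x = 1.
Proof. by rewrite /enorm => ->; rewrite sqrtr1. Qed.

Lemma unitv1 (x : V) : dot x x = 1 -> unitv x = x.
Proof. by move=> /enorm1; rewrite /unitv => ->; rewrite invr1 scale1r. Qed.

Lemma dot_unitv (x : V) : x != 0 -> dot (unitv x) (unitv x) = 1.
Proof.
rewrite -enorm_gt0 => x0; rewrite !dotlin -enorm_sqr.
by field; rewrite gt_eqF.
Qed.

Lemma unitv_neq0 (x : V) : dot x x = 1 -> x != 0.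
Proof. by move=> xx; rewrite -dot_gt0 xx. Qed.

Lemma is_derive_enormV (x : R -> V) (t : R) (x' : V) : x t != 0 ->
  is_derive t 1 x x' ->
  is_derive t 1 (fun h => (enorm (x h))^-1) (- dot (x t) x' / enorm (x t) ^+ 3).
Proof.
move=> x0 hx; have e0 : 0 < enorm (x t) by rewrite enorm_gt0.
have d0 : 0 < dot (x t) (x t) by rewrite dot_gt0.
have H := is_deriveVe (is_derive_sqrte (is_derive_dot hx hx) d0) (lt0r_neq0 e0).
apply: (is_derive_eq H); rewrite -/(enorm _) (dotC x').
by field; rewrite gt_eqF.
Qed.

Lemma is_derive_unitv (x : R -> V) (t : R) (x' : V) : x t != 0 ->
  is_derive t 1 x x' ->
  is_derive t 1 (fun h => unitv (x h))
    ((enorm (x t))^-1 *: x' - (dot (x t) x' / enorm (x t) ^+ 3) *: x t).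
Proof.
move=> x0 hx; apply: (is_derive_eq (is_derive_scalee (is_derive_enormV x0 hx) hx)).
by rewrite addrC mulNr scaleNr.
Qed.

End Curves.

(** * The metric in ambient coordinates *)

Section Metric.
Variable R : realType.
Local Notation V := 'rV[R]_3.

Lemma circle_param (a b : R) : a ^+ 2 + b ^+ 2 = 1 ->
  exists2 s : R, 0 <= s <= 2 * pi & cos s = a /\ sin s = b.
Proof.
move=> ab; have a1 : -1 <= a <= 1 by apply/andP; split; nra.
have ca : cos (acos a) = a by rewrite acosK// in_itv.
have sa : sin (acos a) = `|b|.
  by rewrite sin_acos// -ab addrC addKr sqrtr_sqr.
have h0 := acos_ge0 a1; have hp := acos_lepi a1.
have [b0|b0] := leP 0 b.
  by exists (acos a); [rewrite h0; lra|rewrite ca sa ger0_norm].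
exists (pi + (pi - acos a)); first by apply/andP; split; lra.
rewrite ![pi + _]addrC !sinDpi !cosDpi cosN sinN ca sa.
by rewrite ltr0_norm// !opprK; split.
Qed.

Lemma polar_surj (x : V) : S2 x ->
  exists phi theta, [/\ 0 <= phi <= pi, 0 <= theta <= 2 * pi & x = polar phi theta].
Proof.
rewrite /S2/= dotE => xx.
have z1 : -1 <= x 0 2 <= 1 by apply/andP; split; nra.
set s := sin (acos (x 0 2)).
have cz : cos (acos (x 0 2)) = x 0 2 by rewrite acosK// in_itv.
have s2 : s ^+ 2 = x 0 0 ^+ 2 + x 0 1 ^+ 2.
  by rewrite /s sin2cos2 cz -xx; ring.
have h0 := acos_ge0 z1; have hp := acos_lepi z1.
have [s0|s0] := eqVneq s 0.
  exists (acos (x 0 2)), 0; rewrite h0 hp lexx mulr_ge0 ?pi_ge0//; split => //.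
  rewrite s0 expr0n/= in s2.
  have := sqr_ge0 (x 0 0); have := sqr_ge0 (x 0 1) => q1 q0.
  apply: row3P; rewrite !vec3E ?cz// -/s s0 mul0r; apply/eqP;
    rewrite -sqrf_eq0; apply/eqP; lra.
have [|th thb [cth sth]] := @circle_param (x 0 0 / s) (x 0 1 / s).
  by rewrite !expr_div_n -mulrDl -s2 divff// sqrf_eq0.
exists (acos (x 0 2)), th; rewrite h0 hp; split => //.
by apply: row3P; rewrite !vec3E ?cz// -/s ?cth ?sth mulrC divfK.
Qed.

Lemma polar_S2 (phi theta : R) : S2 (polar phi theta : V).
Proof.
rewrite /S2/= dotE !vec3E.
transitivity (sin phi ^+ 2 * (cos theta ^+ 2 + sin theta ^+ 2) + cos phi ^+ 2).
  by ring.
by rewrite cos2Dsin2 mulr1 addrC cos2Dsin2.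
Qed.

Lemma polar_tangent (phi theta : R) :
  dot (polar phi theta : V) (polar_phi phi theta) = 0 /\
  dot (polar_phi phi theta) (polar_phi phi theta) = 1.
Proof.
have sp := cos2Dsin2 phi; have st := cos2Dsin2 theta.
rewrite polar_phiE !dotE !vec3E; split.
  transitivity (sin phi * cos phi * (cos theta ^+ 2 + sin theta ^+ 2) - sin phi * cos phi).
    by ring.
  by rewrite st; ring.
transitivity (cos phi ^+ 2 * (cos theta ^+ 2 + sin theta ^+ 2) + sin phi ^+ 2).
  by ring.
by rewrite st mulr1.
Qed.

Lemma polar_theta_cross (phi theta : R) : polar_theta phi theta =
  sin phi *: cross (polar phi theta) (polar_phi phi theta).
Proof.
have sp := cos2Dsin2 phi.
rewrite polar_phiE polar_thetaE; apply: row3P; rewrite !(mxE, vec3E) /=.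
- rewrite -[LHS]mulr1 -sp; ring.
- rewrite -[LHS]mulr1 -sp; ring.
- by ring.
Qed.

Lemma killing_polar (phi theta : R) : killing (polar phi theta) = polar_theta phi theta.
Proof. by rewrite polar_thetaE; apply: row3P; rewrite !vec3E. Qed.

Lemma cross_killing_polar (phi theta : R) :
  cross (polar phi theta) (killing (polar phi theta)) =
  - sin phi *: polar_phi phi theta.
Proof.
have st := cos2Dsin2 theta.
rewrite polar_phiE; apply: row3P; rewrite !(mxE, vec3E) /=; try by ring.
by rewrite -[RHS]mulr1 -st; ring.
Qed.

Variables (eps : R) (F : V * V -> R).
Hypotheses (heps : 0 <= eps < 1) (hF : katok_ziller eps F).

(* The formula of katok_ziller in terms of ambient vectors: at (phi, theta) the
   norm of K is sin phi, so k = 1 - eps^2 sin^2 phi, m = <K, v> =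
   sin^2 phi xi_theta and S is the square root. *)
Definition kz_k (x : V) := 1 - eps ^+ 2 * dot (killing x) (killing x).
Definition kz_m (p : V * V) := dot (killing p.1) p.2.
Definition kz_S (p : V * V) :=
  Num.sqrt (kz_k p.1 * dot p.2 p.2 + eps ^+ 2 * kz_m p ^+ 2).
Definition kz (p : V * V) := (kz_k p.1)^-1 * (kz_S p - eps * kz_m p).

Lemma eps_sqr_lt1 : eps ^+ 2 < 1.
Proof. by case/andP: heps => e0 e1; nra. Qed.

Lemma kz_k_gt0 x : S2 x -> 0 < kz_k x.
Proof.
move=> xx; rewrite /kz_k dot_killing_sqr//.
by have := eps_sqr_lt1; have := sqr_ge0 (x 0 2); have := sqr_ge0 eps; nra.
Qed.

Lemma kz_offpole (phi theta : R) (v : V) : 0 < phi < pi -> 0 <= theta <= 2 * pi ->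
  dot (polar phi theta) v = 0 -> F (polar phi theta, v) = kz (polar phi theta, v).
Proof.
move=> hphi htheta xv; set x := polar phi theta.
have [xp pp] := polar_tangent phi theta.
have sp : sin phi != 0 by rewrite gt_eqF// sin_gt0_pi.
set p := polar_phi phi theta in xp pp; set t := cross x p.
have tt : dot t t = 1 := frame_tt (polar_S2 phi theta) xp pp.
have pt : dot p t = 0 := dot_cross_r _ _.
(* The fibre coordinates of v are xi_phi = <v, p> and xi_theta = <v, t> / sin phi, since
   [polar_theta] is sin phi times the unit vector t. *)
have E : v = dot v p *: p + (dot v t / sin phi) *: polar_theta phi theta.
  rewrite polar_theta_cross scalerA divfK// -/x -/p -/t.
  rewrite {1}(frame_decomp (polar_S2 phi theta) xp pp v) -/x -/t.
  by rewrite (dotC v) xv scale0r add0r.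
rewrite {1}E hF.2// /kz /kz_S /kz_m /kz_k/= killing_polar polar_theta_cross -/x -/p -/t.
have -> : dot v v = dot v p ^+ 2 + dot v t ^+ 2.
  rewrite {1 2}E polar_theta_cross scalerA divfK// -/x -/p -/t.
  by rewrite !dotlin pp tt (dotC t p) pt; ring.
rewrite !dotlin tt (dotC t v) mulr1 -!expr2.
congr (_ * (Num.sqrt _ - _)); by field.
Qed.

(* The formula for F is not assumed at the poles: there it is the limit along
   rotations about a horizontal axis. *)
Definition tilt (h : R) (x : V) : V :=
  vec3 (x 0 0) (cos h * x 0 1 - sin h * x 0 2) (sin h * x 0 1 + cos h * x 0 2).

Lemma dot_tilt h x y : dot (tilt h x) (tilt h y) = dot x y.
Proof.
rewrite !dotE !vec3E.
transitivity (x 0 0 * y 0 0 + (cos h ^+ 2 + sin h ^+ 2) * (x 0 1 * y 0 1 + x 0 2 * y 0 2)).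
  by ring.
by rewrite cos2Dsin2; ring.
Qed.

Lemma derivable_tilt x h : derivable (tilt ^~ x) h 1.
Proof.
have c := is_derive_cos h; have s := is_derive_sin h.
have k a := is_derive_cst (a : R) h 1.
by have [] := is_derive_vec3 (k (x 0 0))
  (is_deriveBe (is_deriveMe c (k (x 0 1))) (is_deriveMe s (k (x 0 2))))
  (is_deriveDe (is_deriveMe s (k (x 0 1))) (is_deriveMe c (k (x 0 2)))).
Qed.

Lemma continuous_tilt x : continuous (tilt ^~ x).
Proof.
by move=> h; exact/differentiable_continuous/derivable1_diffP/derivable_tilt.
Qed.

Lemma tilt0 x : tilt 0 x = x.
Proof. by rewrite /tilt sin0 cos0; apply: row3P; rewrite !vec3E; ring. Qed.

Lemma continuous_dot (x y : R -> V) : continuous x -> continuous y ->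
  continuous (fun h => dot (x h) (y h)).
Proof.
move=> cx cy h; under eq_fun do rewrite dotE.
have cc (z : R -> V) i : continuous z -> continuous (fun h => z h 0 i).
  move=> cz r; apply: (@continuous_comp _ _ _ z (fun v : V => v 0 i)); first exact: cz.
  exact: coord_continuous.
by apply: cvgD; [apply: cvgD|]; apply: cvgM; exact: cc.
Qed.

Lemma kz_pole x v : S2 x -> killing x = 0 -> dot x v = 0 -> F (x, v) = kz (x, v).
Proof.
move=> xx kx xv.
pose g h := (tilt h x, tilt h v).
have gT h : TS2 (g h) by split; rewrite /S2/= dot_tilt.
have cg : continuous g.
  move=> h; exact: (cvg_pair (@continuous_tilt x h) (@continuous_tilt v h)).
have g0 : g 0 = (x, v) by rewrite /g !tilt0.
have x0 : x 0 0 = 0 by have := congr1 (fun u : V => u 0 1) kx; rewrite vec3E mxE.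
have x1 : x 0 1 = 0.
  by have /eqP := congr1 (fun u : V => u 0 0) kx; rewrite vec3E mxE oppr_eq0 => /eqP.
have x2 : x 0 2 != 0.
  apply/eqP => x2; move: xx; rewrite /S2/= dotE x0 x1 x2 => /eqP.
  by rewrite !mulr0 !addr0 eq_sym oner_eq0.
(* For 0 < |h| < pi the tilted point has second coordinate - sin h * x_2, which is nonzero, so it is
   not a pole. *)
have E : \forall h \near 0^', F (g h) = kz (g h).
  near=> h.
  have sh : sin h != 0.
    have h0 : h != 0 by near: h; exact: nbhs_dnbhs_neq.
    have hp : `|h| < pi by near: h; apply: dnbhs0_lt; exact: pi_gt0.
    rewrite lter_norml in hp; have /andP[hp1 hp2] := hp.
    have [hn|hn|hn] := ltgtP h 0; last by rewrite hn eqxx in h0.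
      rewrite -oppr_eq0 -sinN gt_eqF// sin_gt0_pi// oppr_gt0 hn/=; lra.
    by rewrite gt_eqF// sin_gt0_pi// hn.
  have [gx gv] := gT h; have [phi [theta [hphi htheta gE]]] := polar_surj gx.
  rewrite /g/= in gx gv gE *; rewrite gE; apply: kz_offpole => //; last by rewrite -gE.
  have yE := congr1 (fun u : V => u 0 1) gE; rewrite !vec3E x1 mulr0 sub0r in yE.
  have /andP[p0 pp] := hphi; rewrite !lt_neqAle p0 pp !andbT.
  have y0 : - (sin h * x 0 2) != 0 by rewrite oppr_eq0 mulf_neq0.
  apply/andP; split; apply: contra_neq y0 => pE.
    by rewrite yE -pE sin0 mul0r.
  by rewrite yE pE sinpi mul0r.
have c1 : F (g h) @[h --> 0^'] --> F (x, v).
  have /subspace_continuousP/(_ (x, v)) := hF.1.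
  move=> /(_ (conj xx xv)) H.
  (* F is continuous only within [TS2], but g takes all its values there. *)
  suff G : g @ 0^' --> within (@TS2 R) (nbhs (x, v)) by exact: (cvg_comp _ _ G H).
  move=> A /= wA.
  have : nbhs (0:R) (fun h => TS2 (g h) -> A (g h)).
    by have := cg 0; rewrite /continuous_at g0 => /(_ _ wA).
  by move=> {}H; apply: (@nbhs_dnbhs _ (0:R)); apply: filterS H => h; exact.
have c2 : kz (g h) @[h --> 0^'] --> kz (x, v).
  have ck : continuous (fun h => killing (tilt h x)).
    move=> h; apply/differentiable_continuous/derivable1_diffP.
    by have [] := is_derive_killing (derivableP (@derivable_tilt x h)).
  have ckk : continuous (fun h => kz_k (tilt h x)).
    have kk := continuous_dot ck ck.
    by move=> h; exact: (cvgB (@cvg_cst _ _ _ _ _) (cvgM (@cvg_cst _ _ _ _ _) (kk h))).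
  have ct y := @continuous_tilt y.
  have cm : continuous (fun h => kz_m (g h)) := continuous_dot ck (ct v).
  have cv : continuous (fun h => dot (tilt h v) (tilt h v)) :=
    continuous_dot (ct v) (ct v).
  have cS : continuous (fun h => kz_S (g h)).
    move=> h; apply: (@continuous_comp _ _ _ (fun h =>
      kz_k (tilt h x) * dot (tilt h v) (tilt h v) + eps ^+ 2 * kz_m (g h) ^+ 2)
      Num.sqrt); last exact: sqrt_continuous.
    exact: (cvgD (cvgM (ckk h) (cv h))
      (cvgM (@cvg_cst _ _ _ _ _) (cvgM (cm h) (cm h)))).
  have k0 : kz_k (tilt 0 x) != 0 by rewrite gt_eqF// kz_k_gt0//; exact: (gT 0).1.
  have : {for 0, continuous (fun h => kz (g h))}.
    exact: (cvgM (cvgV k0 (ckk 0)) (cvgB (cS 0) (cvgM (@cvg_cst _ _ _ _ _) (cm 0)))).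
  by move=> /continuous_withinNx; rewrite g0; exact.
have c3 : kz (g h) @[h --> 0^'] --> F (x, v) := cvg_trans (near_eq_cvg E) c1.
by rewrite -(cvg_lim (@Rhausdorff R) (c3 _)) (cvg_lim (@Rhausdorff R) c2).
Unshelve. all: by end_near. Qed.

Lemma katok_zillerE p : TS2 p -> F p = kz p.
Proof.
case: p => x v [/= xx xv].
have [kx|kx] := eqVneq (killing x) 0; first exact: kz_pole.
have [phi [theta [hphi htheta xE]]] := polar_surj xx.
rewrite xE in xv kx *; apply: kz_offpole => //.
have /andP[p0 pp] := hphi; rewrite !lt_neqAle p0 pp !andbT.
have k0 : sin phi != 0.
  by apply: contra_neq kx => s0; rewrite killing_polar polar_theta_cross s0 scale0r.
apply/andP; split; apply: contra_neq k0 => pE; first by rewrite -pE sin0.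
by rewrite pE sinpi.
Qed.

End Metric.

(** * The retraction onto the unit tangent bundle and its differential *)

Section Retraction.
Variable R : realType.
Local Notation V := 'rV[R]_3.

Definition dunitv (x a : V) : V :=
  (enorm x)^-1 *: a - (dot x a / enorm x ^+ 3) *: x.

Definition tproj (q : V * V) : V := q.2 - dot (unitv q.1) q.2 *: unitv q.1.

Lemma hretr_HS2 (q : V * V) : q.1 != 0 -> tproj q != 0 -> HS2 (hretr q).
Proof.
move=> q1 q2; have xx := dot_unitv q1; split; last exact: dot_unitv.
split; first exact: xx.
have h : dot (unitv q.1) (tproj q) = 0 by rewrite dotDr dotNr dotZr xx; ring.
by rewrite /hretr -/(tproj q) /= [unitv (tproj q)]/unitv dotZr h mulr0.
Qed.

Lemma tproj_HS2 (p : V * V) : HS2 p -> tproj p = p.2.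
Proof. by move=> [[xx xv] _]; rewrite /tproj unitv1// xv scale0r subr0. Qed.

Lemma hretr_id (p : V * V) : HS2 p -> hretr p = p.
Proof.
move=> hp; have [[xx xv] vv] := hp.
by rewrite /hretr -/(tproj p) tproj_HS2// !unitv1//; case: p {hp xx xv vv}.
Qed.

Lemma is_derive_tproj (x v : R -> V) (s : R) (x' v' : V) : x s != 0 ->
  is_derive s 1 x x' -> is_derive s 1 v v' ->
  is_derive s 1 (fun h => tproj (x h, v h))
    (v' - ((dot (dunitv (x s) x') (v s) + dot (unitv (x s)) v') *: unitv (x s)
           + dot (unitv (x s)) (v s) *: dunitv (x s) x')).
Proof.
move=> x0 hx hv; have hu := is_derive_unitv x0 hx.
exact: (is_deriveBe hv (is_derive_scalee (is_derive_dot hu hv) hu)).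
Qed.

Lemma is_derive_hretr (x v : R -> V) (s : R) (x' v' : V) :
  x s != 0 -> tproj (x s, v s) != 0 ->
  is_derive s 1 x x' -> is_derive s 1 v v' ->
  is_derive s 1 (fun h => hretr (x h, v h))
    (dunitv (x s) x',
     dunitv (tproj (x s, v s))
       (v' - ((dot (dunitv (x s) x') (v s) + dot (unitv (x s)) v') *: unitv (x s)
           + dot (unitv (x s)) (v s) *: dunitv (x s) x'))).
Proof.
move=> x0 w0 hx hv; apply: is_derive_pair; first exact: (is_derive_unitv x0 hx).
exact: (is_derive_unitv w0 (is_derive_tproj x0 hx hv)).
Qed.

(** The differential of a retraction is the identity on tangent vectors; hence straight lines of the
    ambient space, once retracted, serve as curves in [HS2] with prescribed velocity. *)
Lemma is_derive_hretr_HS2 (x v : R -> V) (s : R) (Z : V * V) :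
  HS2 (x s, v s) -> tangentHS2 (x s, v s) Z ->
  is_derive s 1 x Z.1 -> is_derive s 1 v Z.2 ->
  is_derive s 1 (fun h => hretr (x h, v h)) Z.
Proof.
case: Z => a b hp [/= xa xb vb] hx hv; have [[/= xx xv] vv] := hp.
have w0 : tproj (x s, v s) != 0 by rewrite tproj_HS2// unitv_neq0.
apply: (is_derive_eq (is_derive_hretr (unitv_neq0 xx) w0 hx hv)).
have da : dunitv (x s) a = a.
  by rewrite /dunitv xa mul0r scale0r subr0 enorm1// invr1 scale1r.
rewrite da (tproj_HS2 hp)/= unitv1// xv scale0r addr0.
rewrite (dotC a) xb scale0r subr0; congr (_, _).
by rewrite /dunitv vb mul0r scale0r subr0 enorm1// invr1 scale1r.
Qed.

Lemma near_neq0 (x : R -> V) (s : R) (x' : V) :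
  is_derive s 1 x x' -> x s != 0 -> \forall h \near s, x h != 0.
Proof.
move=> hx x0; have c := is_derive_continuous (is_derive_dot hx hx).
have d0 : 0 < dot (x s) (x s) by rewrite dot_gt0.
near=> h; rewrite -dot_gt0; near: h; exact: (cvgr_gt _ c _ d0).
Unshelve. all: by end_near. Qed.

Lemma is_derive_hretr_line (p Z : V * V) : HS2 p -> tangentHS2 p Z ->
  is_derive (0:R) 1 (fun h => hretr (h *: Z + p)) Z.
Proof.
move=> hp hZ; have E0 (y u : V) : 0 *: y + u = u by rewrite scale0r add0r.
have pE : (0 *: Z.1 + p.1, 0 *: Z.2 + p.2) = p by rewrite !E0; case: (p).
have hp0 : HS2 (0 *: Z.1 + p.1, 0 *: Z.2 + p.2) by rewrite pE.
have hZ0 : tangentHS2 (0 *: Z.1 + p.1, 0 *: Z.2 + p.2) Z by rewrite pE.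
exact: (is_derive_hretr_HS2 (x := fun h => h *: Z.1 + p.1)
  (v := fun h => h *: Z.2 + p.2) hp0 hZ0 (is_derive_affine _ _ _) (is_derive_affine _ _ _)).
Qed.

Lemma near_hretr_domain (p Z : V * V) : HS2 p ->
  \forall h \near (0:R), (h *: Z + p).1 != 0 /\ tproj (h *: Z + p) != 0.
Proof.
move=> hp; have [[xx _] vv] := hp.
have E0 (y u : V) : 0 *: y + u = u by rewrite scale0r add0r.
have pE : (0 *: Z.1 + p.1, 0 *: Z.2 + p.2) = p by rewrite !E0; case: (p).
have hx := is_derive_affine p.1 Z.1 0; have hv := is_derive_affine p.2 Z.2 0.
have nX : 0 *: Z.1 + p.1 != 0 by rewrite E0 unitv_neq0.
have nT : tproj (0 *: Z.1 + p.1, 0 *: Z.2 + p.2) != 0.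
  by rewrite pE (tproj_HS2 hp) unitv_neq0.
have N1 := near_neq0 hx nX.
have N2 := near_neq0 (is_derive_tproj nX hx hv) nT.
by near=> h; split; near: h; [exact: N1|exact: N2].
Unshelve. all: by end_near. Qed.

(* With t = x /\ v, the frame of HS2 at (x, v) is (v, - x), (t, 0), (0, t):
   the geodesic field of the round metric, its normal, and the vertical field. *)
Definition tvec (p : V * V) (a1 a2 b : R) : V * V :=
  (a1 *: p.2 + a2 *: cross p.1 p.2, - a1 *: p.1 + b *: cross p.1 p.2).

Lemma tangent_tvec (p : V * V) a1 a2 b : HS2 p -> tangentHS2 p (tvec p a1 a2 b).
Proof.
case: p => x v [[/= xx xv] vv]; rewrite /S2/= in xx.
have xt : dot x (cross x v) = 0 := dot_cross_l x v.
have vt : dot v (cross x v) = 0 := dot_cross_r x v.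
by split; rewrite /= !dotlin ?xx ?vv ?(dotC v x) ?xv ?xt ?vt; ring.
Qed.

Lemma tangent_tvecP (p : V * V) Z : HS2 p -> tangentHS2 p Z ->
  Z = tvec p (dot Z.1 p.2) (dot Z.1 (cross p.1 p.2)) (dot Z.2 (cross p.1 p.2)).
Proof.
case: p Z => x v [a b] [[/= xx xv] vv] [/= xa xb vb].
rewrite /tvec/=; congr (_, _).
  by rewrite {1}(frame_decomp xx xv vv a) (dotC a) xa scale0r add0r.
rewrite {1}(frame_decomp xx xv vv b) (dotC b v) vb scale0r addr0.
by congr (_ *: _ + _); rewrite (dotC b) (dotC a); apply/eqP; rewrite -addr_eq0 addrC xb.
Qed.

End Retraction.

(** * Hilbert form and Reeb field *)

Section Hilbert.
Variable R : realType.
Local Notation V := 'rV[R]_3.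
Variables (eps : R) (F : V * V -> R).
Hypotheses (heps : 0 <= eps < 1) (hF : katok_ziller eps F).

Local Notation S := (kz_S eps).
Local Notation k := (kz_k eps).
Local Notation m := (@kz_m R).
(** Together with [kz_m], the coordinates of K in the orthonormal frame (v, t) of the tangent
    plane. *)
Definition kz_n (p : V * V) := dot (killing p.1) (cross p.1 p.2).
Local Notation n := kz_n.
(* c = 1 / F on unit vectors: c v is the vector of F-norm 1 on the ray of v. *)
Definition kz_c (p : V * V) := S p + eps * m p.
Local Notation c := kz_c.

Lemma kz_S_sqr p : HS2 p -> S p ^+ 2 = k p.1 + eps ^+ 2 * m p ^+ 2.
Proof.
move=> [[xx _] vv]; rewrite /kz_S vv mulr1 sqr_sqrtr//.
by have := kz_k_gt0 heps xx; have := sqr_ge0 (eps * m p); nra.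
Qed.

Lemma kz_S_gt0 p : HS2 p -> 0 < S p.
Proof.
move=> hp; have [[xx _] vv] := hp; rewrite sqrtr_gt0 vv mulr1.
by have := kz_k_gt0 heps xx; have := sqr_ge0 (eps * m p); nra.
Qed.

(** The product is S^2 - eps^2 m^2 = k; as [kz] is (S - eps m) / k, this says c F = 1 on unit
    vectors. *)
Lemma kz_c_mul p : HS2 p -> c p * (S p - eps * m p) = k p.1.
Proof. by move=> /kz_S_sqr h; rewrite /c mulrC -subr_sqr h; ring. Qed.

Lemma kz_c_gt0 p : HS2 p -> 0 < c p.
Proof.
move=> hp; have := kz_c_mul hp; have [[xx _] _] := hp.
by have := kz_k_gt0 heps xx; have := kz_S_gt0 hp; rewrite /kz_c; nra.
Qed.

Lemma kz_k_frame p : HS2 p -> k p.1 = 1 - eps ^+ 2 * (m p ^+ 2 + n p ^+ 2).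
Proof. by move=> [[xx xv] vv]; rewrite /kz_k (frame_killing_sqr xx xv vv). Qed.

(** The m-terms cancel: on unit vectors S sees only the component of the wind normal to v. This is
    what makes the circle integrals elementary. *)
Lemma kz_S_sqrn p : HS2 p -> S p ^+ 2 = 1 - eps ^+ 2 * n p ^+ 2.
Proof. by move=> hp; rewrite kz_S_sqr// kz_k_frame//; ring. Qed.

(** The Legendre transform of v. It equals (c v - eps K) / (S c): the indicatrix is the unit circle
    shifted by eps K, so its normal at c v is c v - eps K, here scaled so that pairing with v gives
    F = 1 / c. *)
Definition kz_xi (p : V * V) : V :=
  (S p)^-1 *: p.2 - (eps / (S p * c p)) *: killing p.1.

Lemma hilbertE p Z : HS2 p -> dot p.1 Z.1 = 0 ->
  hilbert F p Z = dot (kz_xi p) Z.1.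
Proof.
case: p Z => x v [a b] hp /= xa; have [[/= xx xv] vv] := hp.
have S0 := kz_S_gt0 hp; have c0 := kz_c_gt0 hp; have k0 := kz_k_gt0 heps xx.
apply: derive_val; apply/is_derive_line.
(* F agrees with [kz] only on [TS2]; the line v + h a stays there because a is tangent at x. *)
have FE : (fun h : R => kz eps (x, h *: a + v)) =1 (fun h : R => F (x, h *: a + v)).
  move=> h.
  by rewrite (katok_zillerE heps hF)//; split => //=; rewrite !dotlin xa xv; ring.
apply: (is_derive_ext FE).
have E0 : 0 *: a + v = v by rewrite scale0r add0r.
have hl := is_derive_affine v a 0.
have cs (W : normedModType R) (r : W) := is_derive_cste r (0:R) (1:R).
have hm := is_derive_dot (cs _ (killing x)) hl.
have hv := is_derive_dot hl hl.
have hN := is_deriveDe (is_deriveMe (cs _ (k x)) hv)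
  (is_deriveMe (cs _ (eps ^+ 2)) (is_derive_sqr hm)).
have N0 : 0 < k x * dot (0 *: a + v) (0 *: a + v)
    + eps ^+ 2 * dot (killing x) (0 *: a + v) ^+ 2.
  by rewrite E0 /=; move: S0; rewrite sqrtr_gt0.
apply: (is_derive_cast (is_deriveMe (cs _ (k x)^-1)
  (is_deriveBe (is_derive_sqrte hN N0) (is_deriveMe (cs _ eps) hm)))) => [h//|].
rewrite /= E0 -/(kz_m (x, v)) -/(kz_S eps (x, v)).
set M := m (x, v); set Ja := dot (killing x) a.
rewrite !dotlin /kz_xi/= -/Ja (dotC a v); set va := dot v a.
have kE : k x = (S (x, v) + eps * M) * (S (x, v) - eps * M) := esym (kz_c_mul hp).
have cE : c (x, v) = S (x, v) + eps * M by [].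
have sE : S (x, v) = c (x, v) - eps * M by rewrite cE addrK.
rewrite -/(kz_S eps (x, v)) -cE in kE *.
have d0 : S (x, v) - eps * M != 0.
  by move: k0; rewrite kE; apply: contraTneq => ->; rewrite mulr0 ltxx.
move: sE kE d0 S0 c0; set s := S _; set cc := c _ => sE kE d0 S0 c0.
rewrite kE.
by field; rewrite d0 !gt_eqF.
Qed.

End Hilbert.

Section HilbertDerivative.
Variable R : realType.
Local Notation V := 'rV[R]_3.
Variables (eps : R) (F : V * V -> R).
Hypotheses (heps : 0 <= eps < 1) (hF : katok_ziller eps F).

Local Notation S := (kz_S eps).
Local Notation k := (kz_k eps).
Local Notation m := (@kz_m R).
Local Notation n := (@kz_n R).
Local Notation c := (kz_c eps).

Definition kz_dm (p Z : V * V) := dot (killing Z.1) p.2 + dot (killing p.1) Z.2.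

Definition kz_dS (p Z : V * V) :=
  eps ^+ 2 * (m p * kz_dm p Z - dot (killing p.1) (killing Z.1)) / S p.

Definition kz_dc (p Z : V * V) := kz_dS p Z + eps * kz_dm p Z.

Section DeriveAlongCurve.
Variables (x v : R -> V) (s : R) (Z : V * V).
Hypotheses (hp : HS2 (x s, v s)) (hZ : tangentHS2 (x s, v s) Z).
Hypotheses (hx : is_derive s 1 x Z.1) (hv : is_derive s 1 v Z.2).
Local Notation p := (x s, v s).

Lemma is_derive_kz_m : is_derive s 1 (fun h => m (x h, v h)) (kz_dm p Z).
Proof. exact: (is_derive_dot (is_derive_killing hx) hv). Qed.

Lemma is_derive_kz_S : is_derive s 1 (fun h => S (x h, v h)) (kz_dS p Z).
Proof.
have [[/= xx xv] vv] := hp; have [/= _ _ vb] := hZ.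
have S0 := kz_S_gt0 heps hp.
have cs r := is_derive_cste (r : R) s (1 : R).
have hk := is_derive_killing hx.
have hN := is_deriveDe
  (is_deriveMe (is_deriveBe (cs 1) (is_deriveMe (cs (eps ^+ 2)) (is_derive_dot hk hk)))
    (is_derive_dot hv hv))
  (is_deriveMe (cs (eps ^+ 2)) (is_derive_sqr is_derive_kz_m)).
apply: (is_derive_cast (is_derive_sqrte hN _)) => [|h//|].
  by move: S0; rewrite sqrtr_gt0.
rewrite -/(kz_k eps (x s)) /=.
rewrite [Num.sqrt _](_ : _ = S p)// vv (dotC Z.2) vb (dotC (killing Z.1)).
rewrite /kz_dS/=; set M := m p; set D := kz_dm _ _; set KK := dot _ (killing Z.1).
by field; rewrite gt_eqF.
Qed.

Lemma is_derive_kz_c : is_derive s 1 (fun h => c (x h, v h)) (kz_dc p Z).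
Proof.
apply: (is_derive_cast (is_deriveDe is_derive_kz_S
  (is_deriveMe (is_derive_cste eps s 1) is_derive_kz_m))) => [h//|].
by rewrite /kz_dc mul0r add0r.
Qed.

Lemma is_derive_kz_xi : is_derive s 1 (fun h => kz_xi eps (x h, v h))
  (- (kz_dS p Z / S p ^+ 2) *: v s + (S p)^-1 *: Z.2
   + (eps * (kz_dS p Z * c p + S p * kz_dc p Z) / (S p * c p) ^+ 2) *: killing (x s)
   - (eps / (S p * c p)) *: killing Z.1).
Proof.
have S0 := kz_S_gt0 heps hp; have c0 := kz_c_gt0 heps hp.
have S1 : S p != 0 by rewrite gt_eqF.
have Sc : S p * c p != 0 by rewrite mulf_neq0// gt_eqF.
have D := is_deriveBe (is_derive_scalee (is_deriveVe is_derive_kz_S S1) hv)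
  (is_derive_scalee (is_deriveMe (is_derive_cste eps s 1)
    (is_deriveVe (is_deriveMe is_derive_kz_S is_derive_kz_c) Sc)) (is_derive_killing hx)).
apply: (is_derive_cast D) => [h//|].
by apply: row3P; rewrite !mxE; field; rewrite !gt_eqF.
Qed.

End DeriveAlongCurve.

Section FrameValues.
Variables (p : V * V) (a1 a2 b : R).
Hypothesis hp : HS2 p.
Let xx : dot p.1 p.1 = 1 := hp.1.1.
Let xv : dot p.1 p.2 = 0 := hp.1.2.
Let vv : dot p.2 p.2 = 1 := hp.2.
Local Notation z := (p.1 0 2).
Local Notation Z := (tvec p a1 a2 b).

Lemma kz_dm_frame : kz_dm p Z = n p * b - z * a2.
Proof.
rewrite /kz_dm /= killingD !killingZ !dotlin (dotC (killing p.2)) dot_killing.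
rewrite (dotC (killing p.1) p.1) dot_killing (frame_killingt xx xv vv).
by rewrite !dotlin vv xv -/(n p); ring.
Qed.

(** Agrees with differentiating S^2 = 1 - eps^2 n^2, n having derivative z a1 - m b; hence no a2. *)
Lemma kz_dS_frame : kz_dS p Z = eps ^+ 2 * n p * (m p * b - z * a1) / S p.
Proof.
rewrite /kz_dS kz_dm_frame; congr (_ / _).
have -> : dot (killing p.1) (killing Z.1) = a1 * (n p * z) - a2 * (m p * z).
  rewrite /= killingD !killingZ !dotlin.
  rewrite (frame_killingv xx xv vv) (frame_killingt xx xv vv) !dotlin.
  by rewrite (dotC _ p.1) dot_killing -/(m p) -/(n p); ring.
by ring.
Qed.

End FrameValues.

Lemma dunitv_orth (x a : V) : x != 0 -> dot (unitv x) (dunitv x a) = 0.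
Proof.
move=> x0; have e0 : enorm x != 0 by rewrite gt_eqF// enorm_gt0.
rewrite /unitv /dunitv !dotlin -enorm_sqr.
by field.
Qed.

(** The Hilbert form sees only the base component, so of the differential of [hretr] only that of
    [unitv] survives. *)
Lemma hilbert_hretr (q W : V * V) : q.1 != 0 -> tproj q != 0 ->
  hilbert F (hretr q) ('D_W (@hretr R) q) = dot (kz_xi eps (hretr q)) (dunitv q.1 W.1).
Proof.
move=> q1 q2; have -> : 'D_W (@hretr R) q = (dunitv q.1 W.1,
    ('D_W (@hretr R) q).2).
  have D : ('D_W (@hretr R) q).1 = dunitv q.1 W.1.
    have E0 (y z : V) : 0 *: y + z = z by rewrite scale0r add0r.
    have H := @is_derive_hretr R (fun h => h *: W.1 + q.1) (fun h => h *: W.2 + q.2) 0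
      W.1 W.2.
    rewrite !E0 in H.
    have {H} := H q1 _ (is_derive_affine _ _ _) (is_derive_affine _ _ _).
    have -> : (q.1, q.2) = q by case: q {q1 q2}.
    move=> /(_ q2) H.
    by have [_ ->] := (is_derive_line (@hretr R) q W _).2 H.
  by rewrite -D; case: ('D_W _ q).
rewrite (hilbertE heps hF)//=; first exact: hretr_HS2.
exact: dunitv_orth.
Qed.

(** At p the derivative of [dunitv] is normal to the sphere while [kz_xi] is tangent, so only the
    derivative of [kz_xi] contributes. *)
Lemma derive_hilbert_ext (p Z W : V * V) :
  HS2 p -> tangentHS2 p Z -> dot p.1 W.1 = 0 ->
  is_derive p Z (fun q => hilbert F (hretr q) ('D_W (@hretr R) q))
   (dot (- (kz_dS p Z / S p ^+ 2) *: p.2 + (S p)^-1 *: Z.2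
   + (eps * (kz_dS p Z * c p + S p * kz_dc p Z) / (S p * c p) ^+ 2) *: killing p.1
   - (eps / (S p * c p)) *: killing Z.1) W.1).
Proof.
move=> hp hZ xW; have [[xx xv] vv] := hp; have [xa _ _] := hZ; apply/is_derive_line.
pose P (h : R) := hretr (h *: Z + p); pose X (h : R) := h *: Z.1 + p.1.
have P0 : P 0 = p by rewrite /P scale0r add0r hretr_id.
have X0 : X 0 = p.1 by rewrite /X scale0r add0r.
have nX : X 0 != 0 by rewrite X0 unitv_neq0.
have hX : is_derive (0:R) 1 X Z.1 := is_derive_affine _ _ _.
have N : \forall h \near (0:R), dot (kz_xi eps ((P h).1, (P h).2)) (dunitv (X h) W.1) =
    hilbert F (hretr (h *: Z + p)) ('D_W (@hretr R) (h *: Z + p)).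
  near=> h; have [q1 q2] : (h *: Z + p).1 != 0 /\ tproj (h *: Z + p) != 0.
    by near: h; exact: near_hretr_domain.
  by rewrite hilbert_hretr// /P; case: hretr.
apply: (near_eq_is_derive N).
have hR := is_derive_hretr_line hp hZ.
have pE : ((P 0).1, (P 0).2) = p by rewrite P0; case: (p).
have hp0 : HS2 ((P 0).1, (P 0).2) by rewrite pE.
have hZ0 : tangentHS2 ((P 0).1, (P 0).2) Z by rewrite pE.
have hxi := is_derive_kz_xi hp0 hZ0 (is_derive_fst hR) (is_derive_snd hR).
have hd : is_derive (0:R) 1 (fun h => dunitv (X h) W.1) (- dot Z.1 W.1 *: p.1).
  have cs (U : normedModType R) (r : U) := is_derive_cste r (0:R) (1:R).
  have he := is_derive_enormV nX hX.
  have hd := is_derive_dot hX (cs _ W.1).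
  apply: (is_derive_cast (is_deriveBe (is_derive_scalee he (cs _ W.1))
    (is_derive_scalee (is_deriveMe hd (is_deriveMe he (is_deriveMe he he))) hX))) => [h|].
    rewrite /dunitv; congr (_ - (_ * _) *: _); rewrite -exprVn.
    by rewrite !exprS expr0 mulr1.
  by rewrite X0 /= enorm1// xa xW; apply: row3P; rewrite !mxE dot0r; field.
apply: (is_derive_eq (is_derive_dot hxi hd)).
have -> : dunitv (X 0) W.1 = W.1.
  by rewrite /dunitv X0 xW mul0r scale0r subr0 enorm1// invr1 scale1r.
rewrite pE -/(P 0) P0 [kz_xi eps p]/kz_xi.
by rewrite !dotlin (dotC p.2 p.1) xv (dotC _ p.1) dot_killing; ring.
Unshelve. all: by end_near. Qed.

End HilbertDerivative.

Section Reeb.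
Variable R : realType.
Local Notation V := 'rV[R]_3.
Variables (eps : R) (F : V * V -> R).
Hypotheses (heps : 0 <= eps < 1) (hF : katok_ziller eps F).

Local Notation S := (kz_S eps).
Local Notation k := (kz_k eps).
Local Notation m := (@kz_m R).
Local Notation n := (@kz_n R).
Local Notation c := (kz_c eps).

Section FrameForms.
Variable (p : V * V).
Hypothesis hp : HS2 p.
Let xx : dot p.1 p.1 = 1 := hp.1.1.
Let xv : dot p.1 p.2 = 0 := hp.1.2.
Let vv : dot p.2 p.2 = 1 := hp.2.
Let t := cross p.1 p.2.
Let xt : dot p.1 t = 0 := dot_cross_l _ _.
Let vt : dot p.2 t = 0 := dot_cross_r _ _.
Let tt : dot t t = 1 := frame_tt xx xv vv.
Local Notation z := (p.1 0 2).

Lemma hilbert_frame a1 a2 b :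
  hilbert F p (tvec p a1 a2 b) = a1 / c p - eps * n p * a2 / (S p * c p).
Proof.
have S0 := kz_S_gt0 heps hp; have c0 := kz_c_gt0 heps hp.
rewrite (hilbertE heps hF)//=; last by rewrite !dotlin xv xt; ring.
rewrite /kz_xi !dotlin -/t vv vt -/(m p) -/(n p).
have cE : S p = c p - eps * m p by rewrite addrK.
transitivity (a1 * (c p - eps * m p) / (S p * c p) - eps * n p * a2 / (S p * c p)).
  by field; rewrite !gt_eqF.
by rewrite -cE; field; rewrite !gt_eqF.
Qed.

Lemma extd_frame a1 a2 b w1 w2 g :
  extd (hilbert F) p (tvec p a1 a2 b) (tvec p w1 w2 g) =
  (b * w2 - g * a2) / S p ^+ 3
  - eps * z * (c p + S p) / (c p ^+ 2 * S p ^+ 3) * (a1 * w2 - a2 * w1).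
Proof.
have S0 := kz_S_gt0 heps hp; have c0 := kz_c_gt0 heps hp.
have T b1 b2 b3 := tangent_tvec b1 b2 b3 hp.
have O b1 b2 b3 : dot p.1 (tvec p b1 b2 b3).1 = 0 by have [] := T b1 b2 b3.
have [_ E1] := derive_hilbert_ext heps hF hp (T a1 a2 b) (O w1 w2 g).
have [_ E2] := derive_hilbert_ext heps hF hp (T w1 w2 g) (O a1 a2 b).
apply: (etrans (congr2 (fun r s : R => r - s) E1 E2)).
rewrite /kz_dc !(kz_dS_frame _ _ _ _ hp) !(kz_dm_frame _ _ _ hp) /=.
rewrite !killingD !killingZ !dotlin -/t -/(m p) -/(n p).
rewrite (frame_killingv xx xv vv) (frame_killingt xx xv vv) -/t -/(n p) -/(m p).
rewrite !dotlin vv vt tt xt xv (dotC t p.2) vt.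
have cE : c p = S p + eps * m p by [].
(* The identity holds only modulo S^2 + eps^2 n^2 = 1; multiplying the right-hand side by this sum
   turns it into a formal identity in S, m, n and z. *)
have rel : S p ^+ 2 + eps ^+ 2 * n p ^+ 2 = 1 by rewrite (kz_S_sqrn heps hp) subrK.
rewrite -[RHS]mulr1 -[X in _ = _ * X]rel; rewrite cE in c0 *.
by field; rewrite !gt_eqF.
Qed.

(** dA(Z, .) = 0 on the vertical field forces a2 = 0, on (t, 0) it determines b, and A(Z) = 1 gives
    a1 = c: the base velocity is the vector c v of F-norm 1. *)
Lemma reebE : reeb F p = tvec p (c p) 0 (eps * z * (c p + S p) / c p).
Proof.
have S0 := kz_S_gt0 heps hp; have c0 := kz_c_gt0 heps hp.
rewrite /reeb; set A := [set _ | _].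
case: xgetP => [Z -> [hZ ZA Zd]|/(_ (tvec p (c p) 0 (eps * z * (c p + S p) / c p)))].
  have d1 := Zd _ (tangent_tvec 0 0 1 hp).
  have d2 := Zd _ (tangent_tvec 0 1 0 hp).
  rewrite (tangent_tvecP hp hZ) in ZA d1 d2 *.
  rewrite hilbert_frame in ZA; rewrite !extd_frame in d1 d2.
  move: ZA d1 d2; set a1 := dot _ _; set a2 := dot _ _; set b := dot _ _ => ZA d1 d2.
  have a20 : a2 = 0.
    have -> : a2 = - S p ^+ 3 * ((b * 0 - 1 * a2) / S p ^+ 3
       - eps * z * (c p + S p) / (c p ^+ 2 * S p ^+ 3) * (a1 * 0 - a2 * 0)).
      by field; rewrite !gt_eqF.
    by rewrite d1 mulr0.
  have a1c : a1 = c p.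
    have -> : a1 = c p * (a1 / c p - eps * n p * 0 / (S p * c p)) by field; rewrite !gt_eqF.
    by rewrite -a20 ZA mulr1.
  rewrite a20 a1c; congr (tvec p _ _ _).
  have -> : b = S p ^+ 3 * ((b * 1 - 0 * a2) / S p ^+ 3
       - eps * z * (c p + S p) / (c p ^+ 2 * S p ^+ 3) * (a1 * 1 - a2 * 0))
      + eps * z * (c p + S p) / c p.
    by rewrite a1c; field; rewrite !gt_eqF.
  by rewrite d2 mulr0 add0r.
case; split; first exact: tangent_tvec.
  by rewrite hilbert_frame; field; rewrite !gt_eqF.
move=> W hW; rewrite (tangent_tvecP hp hW) extd_frame.
by field; rewrite !gt_eqF.
Qed.

End FrameForms.

End Reeb.

(** * Second derivatives on the sphere *)

Section SecondDerivative.
Variable R : realType.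
Local Notation V := 'rV[R]_3.

Definition twice_differentiable (g : V -> R) :=
  (forall x, x != 0 -> differentiable g x) /\
  (forall v x, x != 0 -> differentiable ('D_v g) x).

Lemma smooth_S2_twice (f : V -> R) : smooth_S2 f -> twice_differentiable (f \o @unitv R).
Proof. by move=> /(_ 2%N)[h1 h2]; split => // v; have [] := h2 v. Qed.

Definition hess (g : V -> R) (x v : V) : V :=
  \row_i dot (grad ('D_(delta_mx 0 i) g) x) v.

Lemma hessD g x u v : hess g x (u + v) = hess g x u + hess g x v.
Proof. by apply/rowP => i; rewrite !mxE dotDr. Qed.

Lemma hessZ g x a v : hess g x (a *: v) = a *: hess g x v.
Proof. by apply/rowP => i; rewrite !mxE dotZr. Qed.

Section Fixed.
Variable g : V -> R.
Hypothesis g2 : twice_differentiable g.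

Lemma is_derive_gradient (x : R -> V) (s : R) (x' : V) : x s != 0 ->
  is_derive s 1 x x' ->
  is_derive s 1 (fun h => grad g (x h)) (hess g (x s) x').
Proof.
move=> x0 hx; apply/is_derive_curveP => i.
apply: (is_derive_cast (is_derive_grad (g2.2 (delta_mx 0 i) _ x0) hx)) => [h|].
  by rewrite mxE.
by rewrite mxE.
Qed.

Lemma is_derive_directional (x w : R -> V) (s : R) (x' w' : V) : x s != 0 ->
  is_derive s 1 x x' -> is_derive s 1 w w' ->
  is_derive s 1 (fun h => 'D_(w h) g (x h))
    (dot (hess g (x s) x') (w s) + dot (grad g (x s)) w').
Proof.
move=> x0 hx hw; have N := near_neq0 hx x0.
apply: (near_eq_is_derive _ (is_derive_dot (is_derive_gradient x0 hx) hw)).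
by near=> h; rewrite (derive_grad (w h) (g2.1 _ _))//; near: h.
Unshelve. all: by end_near. Qed.

Lemma derive2E x u v : x != 0 -> 'D_u ('D_v g) x = dot (hess g x u) v.
Proof.
move=> x0; apply: derive_val; apply/is_derive_line.
have E0 : 0 *: u + x = x by rewrite scale0r add0r.
have hl := is_derive_affine x u 0.
rewrite -{1}E0 in x0.
apply: (is_derive_cast (is_derive_directional x0 hl (is_derive_cste v _ _))) => [h//|].
by rewrite E0 dot0r addr0.
Qed.

End Fixed.

Lemma unitvZ (a : R) (x : V) : 0 < a -> unitv (a *: x) = unitv x.
Proof.
move=> a0; have E : enorm (a *: x) = a * enorm x.
  by rewrite /enorm !dotlin mulrA -expr2 sqrtrM ?sqr_ge0// sqrtr_sqr gtr0_norm.
have [->|x0] := eqVneq x 0; first by rewrite scaler0.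
have e0 : enorm x != 0 by rewrite gt_eqF// enorm_gt0.
by rewrite /unitv E scalerA; congr (_ *: _); field; rewrite e0 gt_eqF.
Qed.

(** The extension f \o unitv is constant on rays, so its gradient is tangent to the sphere and
    normal accelerations never contribute. *)
Lemma derive_radial (f : V -> R) (x : V) : 'D_x (f \o @unitv R) x = 0.
Proof.
apply: derive_val; apply/is_derive_line.
apply: (near_eq_is_derive _ (is_derive_cste (f (unitv x)) _ _)).
near=> h => /=; rewrite -{3}[x]scale1r -scalerDl unitvZ//.
have h1 : `|h| < 1.
  near: h; exact: (@nbhs0_lt _ R _ ltr01).
by move: h1; rewrite ltr_norml => /andP[h1 _]; rewrite -ltrBlDr sub0r.
Unshelve. all: by end_near. Qed.

End SecondDerivative.

(** * The second derivative along the Reeb field *)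

Section SecondLie.
Variable R : realType.
Local Notation V := 'rV[R]_3.
Variables (eps : R) (F : V * V -> R).
Hypotheses (heps : 0 <= eps < 1) (hF : katok_ziller eps F).
Local Notation S := (kz_S eps).
Local Notation m := (@kz_m R).
Local Notation n := (@kz_n R).
Local Notation c := (kz_c eps).

Variable f : V -> R.
Let g := f \o @unitv R.
Hypothesis g2 : twice_differentiable g.

Lemma lie_reeb q : HS2 q -> lie (reeb F) (f \o fst) q = 'D_(c q *: q.2) g q.1.
Proof.
move=> hq; have [[xx _] _] := hq.
have -> : c q *: q.2 = (reeb F q).1 by rewrite (reebE heps hF hq)/= scale0r addr0.
have dg : is_derive q.1 (reeb F q).1 g ('D_((reeb F q).1) g q.1).
  exact/derivableP/diff_derivable/g2.1/unitv_neq0.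
rewrite /lie; move: (reeb F q) dg => Z dg; apply: derive_val.
exact: ((is_derive_line (fun p => g p.1) q Z _).2 ((is_derive_line _ _ _ _).1 dg)).
Qed.

(** The base velocity c v has derivative dc v + c (b t - c x), with b the vertical coefficient of
    the Reeb field. The x-part is invisible to g; the rest regroups through x /\ K = m t - n v,
    leaving a last term that no longer depends on v. *)
Lemma lie2_reeb p : HS2 p ->
  lie (reeb F) (lie (reeb F) (f \o fst)) p =
  c p ^+ 2 * dot (hess g p.1 p.2) p.2
  + 2 * eps * c p * p.1 0 2 * dot (grad g p.1) (cross p.1 p.2)
  - eps ^+ 2 * p.1 0 2 * dot (grad g p.1) (cross p.1 (killing p.1)).
Proof.
move=> hp; have [[xx xv] vv] := hp.
have S0 := kz_S_gt0 heps hp; have c0 := kz_c_gt0 heps hp.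
have XE := reebE heps hF hp.
have hX : tangentHS2 p (reeb F p) by rewrite XE; exact: tangent_tvec.
have hR := is_derive_hretr_line hp hX.
have hx := is_derive_fst hR; have hv := is_derive_snd hR.
have R0 : hretr (0 *: reeb F p + p) = p by rewrite scale0r add0r hretr_id.
pose P (h : R) := hretr (h *: reeb F p + p).
have hp0 : HS2 ((P 0).1, (P 0).2) by rewrite /P R0; case: (p) hp.
have hX0 : tangentHS2 ((P 0).1, (P 0).2) (reeb F p) by rewrite /P R0; case: (p) hX.
have hc := is_derive_kz_c heps hp0 hX0 hx hv.
have hw := is_derive_scalee hc hv.
have nX : (P 0).1 != 0 by rewrite /P R0 unitv_neq0.
have D := is_derive_directional g2 nX hx hw.
rewrite {1}/lie; apply: derive_val; apply/is_derive_line.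
apply: (near_eq_is_derive _ (is_derive_eq D _)).
  near=> h; have hq : HS2 (P h); last first.
  rewrite -[RHS]/(lie (reeb F) (f \o fst) (P h)) (lie_reeb hq).
    by rewrite /P; case: hretr.
  have [N1 N2] : (h *: reeb F p + p).1 != 0 /\ tproj (h *: reeb F p + p) != 0.
    by near: h; exact: near_hretr_domain.
  exact: hretr_HS2.
rewrite /P R0 (_ : (p.1, p.2) = p); last by case: (p).
rewrite /kz_dc XE (kz_dS_frame _ _ _ _ hp) (kz_dm_frame _ _ _ hp) /=.
rewrite scale0r addr0 hessZ (frame_cross_killing xx xv vv) !dotlin.
rewrite -/(m p) -/(n p).
have r0 : dot (grad g p.1) p.1 = 0.
  by rewrite -derive_grad; [exact: derive_radial|exact: g2.1 (unitv_neq0 xx)].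
rewrite r0; have -> : c p = S p + eps * m p by [].
rewrite /kz_c in c0.
by field; rewrite !gt_eqF.
Unshelve. all: by end_near. Qed.

End SecondLie.

(** * Circle integrals *)

Section Integration.
Variable R : realType.
Local Notation mu := (@lebesgue_measure R).
Local Notation circle_int g := (\int[mu]_(t in `[0, 2 * pi]) g t)%R.
Implicit Types (g G : R -> R) (a b : R).

Lemma continuousMe g1 g2 : continuous g1 -> continuous g2 ->
  continuous (fun t => g1 t * g2 t).
Proof. by move=> c1 c2 t; exact: (cvgM (c1 t) (c2 t)). Qed.

Lemma continuousDe g1 g2 : continuous g1 -> continuous g2 ->
  continuous (fun t => g1 t + g2 t).
Proof. by move=> c1 c2 t; exact: (cvgD (c1 t) (c2 t)). Qed.

Lemma continuous_cste a : continuous (fun _ : R => a).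
Proof. by move=> t; exact: cvg_cst. Qed.

Lemma continuousZe a g : continuous g -> continuous (fun t => a * g t).
Proof. exact/continuousMe/continuous_cste. Qed.

Lemma continuous_integrable g a b : continuous g ->
  mu.-integrable `[a, b] (EFin \o g).
Proof.
move=> cg; apply: continuous_compact_integrable; first exact: segment_compact.
exact: continuous_subspaceT.
Qed.

Lemma Rintegral_FTC g G a b : a < b -> continuous g ->
  (forall t : R, a <= t <= b -> is_derive t 1 G (g t)) ->
  (\int[mu]_(t in `[a, b]) g t)%R = G b - G a.
Proof.
move=> ab cg dG; rewrite /Rintegral (@continuous_FTC2 _ g G a b ab)//.
- exact: continuous_subspaceT.
- split.
  + move=> x; rewrite in_itv/= => /andP[ax xb].
    by have [] := dG x _; rewrite ?(ltW ax) ?(ltW xb).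
  + apply: cvg_at_right_filter; apply: is_derive_continuous (dG a _).
    by rewrite lexx ltW.
  + apply: cvg_at_left_filter; apply: is_derive_continuous (dG b _).
    by rewrite lexx ltW.
- move=> x; rewrite in_itv/= => /andP[ax xb].
  by rewrite derive1E; have [] := dG x _; rewrite ?(ltW ax) ?(ltW xb).
Qed.

Lemma circle_FTC g G : continuous g -> (forall t : R, is_derive t 1 G (g t)) ->
  circle_int g = G (2 * pi) - G 0.
Proof.
by move=> cg dG; apply: Rintegral_FTC => //; rewrite mulr_gt0// pi_gt0.
Qed.

Lemma continuous_antiderivative g a b : continuous g -> a < b ->
  exists G, forall t : R, a <= t <= b -> is_derive t 1 G (g t).
Proof.
(* Starting the integral at a - 1 makes every point of [a, b] interior, so the primitive is
   derivable at both endpoints. *)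
move=> cg ab; exists (fun x => \int[mu]_(t in `[a - 1, x]) g t)%R => t /andP[ta tb].
have tb1 : t < b + 1 by lra.
have ta1 : a - 1 < t by lra.
have [dG GE] := continuous_FTC1_closed tb1 (continuous_integrable _ _ cg) ta1 (cg t).
by split; rewrite -?derive1E.
Qed.

(** For a primitive G, the function G (t + pi) + G t has zero derivative on [0, pi]; equality of its
    end values is G (2 pi) = G 0. *)
Lemma circle_odd g : continuous g -> (forall t, g (t + pi) = - g t) ->
  circle_int g = 0.
Proof.
move=> cg go; have p0 := pi_gt0 R.
have pp : 0 < 2 * pi :> R by rewrite mulr_gt0.
have [G dG] := continuous_antiderivative cg pp.
rewrite (Rintegral_FTC pp cg dG).
pose H t := G (t + pi) + G t.
have dH (t : R) : 0 <= t <= pi -> is_derive t 1 H 0.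
  move=> /andP[t0 tp]; have h1 : is_derive t 1 (fun t => t + pi) (1:R).
    by apply: (is_derive_eq (is_deriveDe (is_derive_id _ _) (is_derive_cste pi _ _))); rewrite addr0.
  have h2 : is_derive (t + pi) 1 G (g (t + pi)) by apply: dG; apply/andP; split; lra.
  have h3 : is_derive t 1 G (g t) by apply: dG; apply/andP; split; lra.
  have h4 := @is_derive1_comp _ G (fun t => t + pi) _ _ _ h2 h1.
  apply: (is_derive_cast (is_deriveDe h4 h3)) => [//|].
  by rewrite go; ring.
have dHo t : t \in `]0, pi[%R -> is_derive t 1 H 0.
  by rewrite in_itv/= => /andP[t0 tp]; apply: dH; rewrite !ltW.
have cH : {within `[0, pi], continuous H}.
  apply: derivable_within_continuous => t; rewrite in_itv/= => ht.
  by have [] := dH t ht.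
have [c _] := MVT_segment (ltW p0) dHo cH.
rewrite mul0r /H add0r (_ : pi + pi = 2 * pi); last by ring.
by move=> h; lra.
Qed.

Lemma circle_intD g1 g2 : continuous g1 -> continuous g2 ->
  circle_int (fun t => g1 t + g2 t) = circle_int g1 + circle_int g2.
Proof. by move=> c1 c2; rewrite RintegralD//; exact: continuous_integrable. Qed.

Lemma circle_intZ a g : continuous g ->
  circle_int (fun t => a * g t) = a * circle_int g.
Proof. by move=> c1; rewrite RintegralZl//; exact: continuous_integrable. Qed.

Lemma circle_cst a : circle_int (fun=> a) = 2 * pi * a.
Proof.
have dG (t : R) : is_derive t 1 (fun t => t * a) a.
  apply: (is_derive_eq (is_deriveMe (is_derive_id t (1:R)) (is_derive_cste a t 1))).
  by ring.
by rewrite (circle_FTC (@continuous_cste a) dG); ring.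
Qed.

Section Trigonometric.
Variables (e A B w : R).
Hypotheses (w0 : 0 < w) (wE : w ^+ 2 = 1 - e ^+ 2 * (A ^+ 2 + B ^+ 2)).

(** With [circ_n], the values of m and n along the clockwise fibre circle when K has coordinates (A,
    B) in the frame at t = 0. *)
Definition circ_m t := A * cos t - B * sin t.
Definition circ_n t := B * cos t + A * sin t.
Local Notation M := circ_m.
Local Notation N := circ_n.
Let D t := 1 - e ^+ 2 * N t ^+ 2.

Lemma circ_sqr t : M t ^+ 2 + N t ^+ 2 = A ^+ 2 + B ^+ 2.
Proof.
rewrite -[RHS]mulr1 -(cos2Dsin2 t) /M /N; ring.
Qed.

Lemma is_derive_circ_m (t : R) : is_derive t 1 M (- N t).
Proof.
apply: (is_derive_cast (is_deriveBe (is_deriveMe (is_derive_cste A t 1) (is_derive_cos t))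
   (is_deriveMe (is_derive_cste B t 1) (is_derive_sin t)))) => //.
by rewrite /N; ring.
Qed.

Lemma is_derive_circ_n (t : R) : is_derive t 1 N (M t).
Proof.
apply: (is_derive_cast (is_deriveDe (is_deriveMe (is_derive_cste B t 1) (is_derive_cos t))
   (is_deriveMe (is_derive_cste A t 1) (is_derive_sin t)))) => //.
by rewrite /M; ring.
Qed.

Lemma circ_period : (M (2 * pi) = M 0) * (N (2 * pi) = N 0).
Proof.
rewrite /M /N (_ : 2 * pi = 0 + pi + pi); last by ring.
by rewrite !sinDpi !cosDpi !opprK.
Qed.

Lemma circ_D_gt0 t : 0 < D t.
Proof.
have h := circ_sqr t; have : 0 < w ^+ 2 by rewrite exprn_gt0.
rewrite wE /D -h; have := sqr_ge0 (e * M t); nra.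
Qed.

Lemma is_derive_circ_D (t : R) : is_derive t 1 D (- (2 * e ^+ 2 * N t * M t)).
Proof.
apply: (is_derive_cast (is_deriveBe (is_derive_cste (1:R) t 1)
  (is_deriveMe (is_derive_cste (e ^+ 2) t 1) (is_derive_sqr (is_derive_circ_n t))))) => //.
by ring.
Qed.

Lemma is_derive_circ_Dinv (t : R) : is_derive t 1 (fun t => (D t)^-1)
  (2 * e ^+ 2 * N t * M t / D t ^+ 2).
Proof.
apply: (is_derive_eq (is_deriveVe (is_derive_circ_D t) _)); last by rewrite opprK.
by rewrite gt_eqF// circ_D_gt0.
Qed.

Lemma continuous_circ_Dinv : continuous (fun t => (D t)^-1).
Proof. by move=> t; exact: is_derive_continuous (is_derive_circ_Dinv t). Qed.

Lemma circle_int_Dinv : circle_int (fun t => (D t)^-1) = 2 * pi / w.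
Proof.
pose Q t := 1 + w - e ^+ 2 * N t ^+ 2.
have Q0 t : 0 < Q t by rewrite /Q addrAC; exact: addr_gt0 (circ_D_gt0 t) w0.
pose P t := e ^+ 2 * (M t * N t).
have dQ (t : R) : is_derive t 1 Q (- (2 * P t)).
  apply: (is_derive_cast (is_deriveBe (is_derive_cste (1 + w) t 1)
    (is_deriveMe (is_derive_cste (e ^+ 2) t 1) (is_derive_sqr (is_derive_circ_n t))))) => //.
  by rewrite /P; ring.
have dP (t : R) : is_derive t 1 P (e ^+ 2 * (M t ^+ 2 - N t ^+ 2)).
  apply: (is_derive_cast (is_deriveMe (is_derive_cste (e ^+ 2) t 1)
    (is_deriveMe (is_derive_circ_m t) (is_derive_circ_n t)))) => //.
  by ring.
(* If (M, N) has argument s then D = cos^2 s + w^2 sin^2 s, whose inverse has the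
   primitive atan (w tan s) / w; subtracting s makes it continuous at the poles
   of tan, and tan (s - atan (w tan s)) = P / Q. *)
suff dG (t : R) : is_derive t 1 (fun t => w^-1 * (t - atan (P t / Q t))) (D t)^-1.
  by rewrite (circle_FTC continuous_circ_Dinv dG) /P /Q !circ_period; ring.
have Qt : Q t != 0 by rewrite gt_eqF.
have dPQ := is_deriveMe (dP t) (is_deriveVe (dQ t) Qt).
apply: (is_derive_cast (is_deriveMe (is_derive_cste w^-1 t 1) (is_deriveBe (is_derive_id t (1:R))
  (@is_derive1_comp _ (@atan R) (fun t => P t / Q t) _ _ _ (is_derive1_atan _) dPQ)))) => //.
have D0 : D t != 0 by rewrite gt_eqF// circ_D_gt0.
(* The relation e^2 M^2 + e^2 N^2 = 1 - w^2 eliminates M, and Q^2 + P^2 factors through D. *)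
have E : Q t ^+ 2 + P t ^+ 2 = (1 + w) ^+ 2 * D t.
  have h : e ^+ 2 * M t ^+ 2 = 1 - w ^+ 2 - e ^+ 2 * N t ^+ 2.
    by rewrite wE -(circ_sqr t); ring.
  have -> : P t ^+ 2 = (e ^+ 2 * M t ^+ 2) * (e ^+ 2 * N t ^+ 2) by rewrite /P; ring.
  by rewrite h /Q /D; ring.
have E0 : Q t ^+ 2 + P t ^+ 2 != 0.
  by rewrite E mulf_neq0// expf_neq0// gt_eqF// addr_gt0.
have -> : (1 + (P t / Q t) ^+ 2)^-1 *
  (e ^+ 2 * (M t ^+ 2 - N t ^+ 2) / Q t + P t * (- - (2 * P t) / Q t ^+ 2)) =
  (e ^+ 2 * (M t ^+ 2 - N t ^+ 2) * Q t + 2 * P t ^+ 2) / (Q t ^+ 2 + P t ^+ 2).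
  by field; rewrite ?E0 ?Qt.
have -> : e ^+ 2 * (M t ^+ 2 - N t ^+ 2) * Q t + 2 * P t ^+ 2 =
   (1 + w) ^+ 2 * (1 - w - e ^+ 2 * N t ^+ 2).
  have h : e ^+ 2 * M t ^+ 2 = 1 - w ^+ 2 - e ^+ 2 * N t ^+ 2.
    by rewrite wE -(circ_sqr t); ring.
  have -> : P t ^+ 2 = (e ^+ 2 * M t ^+ 2) * (e ^+ 2 * N t ^+ 2) by rewrite /P; ring.
  by rewrite [e ^+ 2 * (_ - _)]mulrBr h /Q; ring.
rewrite E /D in D0 *; rewrite /cst /=.
have w1 : 1 + w != 0 by rewrite gt_eqF// addr_gt0.
by field; rewrite exprMn D0 w1 gt_eqF.
Qed.

Lemma continuous_circ_m : continuous M.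
Proof. by move=> t; exact: is_derive_continuous (is_derive_circ_m t). Qed.

Lemma continuous_circ_n : continuous N.
Proof. by move=> t; exact: is_derive_continuous (is_derive_circ_n t). Qed.

Lemma continuous_circ_quot (g : R -> R) : continuous g ->
  continuous (fun t => g t / D t).
Proof. by move=> cg; exact: continuousMe cg continuous_circ_Dinv. Qed.

(** D has derivative - 2 e^2 N M, so - ln D / (2 e^2) is a periodic primitive; at e = 0 it is
    replaced by N^2 / 2. *)
Lemma circle_int_mn : circle_int (fun t => M t * N t / D t) = 0.
Proof.
have cmn : continuous (fun t => M t * N t / D t).
  exact: (continuous_circ_quot (continuousMe continuous_circ_m continuous_circ_n)).
have [e0|e0] := eqVneq e 0.
  suff dG (t : R) : is_derive t 1 (fun t => 2^-1 * N t ^+ 2) (M t * N t / D t).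
    by rewrite (circle_FTC cmn dG) !circ_period subrr.
  apply: (is_derive_cast (is_deriveMe (is_derive_cste (2^-1 : R) t 1)
    (is_derive_sqr (is_derive_circ_n t)))) => //.
  by rewrite /D e0; field.
suff dG (t : R) : is_derive t 1 (fun t => - (2 * e ^+ 2)^-1 * ln (D t)) (M t * N t / D t).
  by rewrite (circle_FTC cmn dG) /D !circ_period subrr.
have D0 := circ_D_gt0 t.
apply: (is_derive_cast (is_deriveMe (is_derive_cste (- (2 * e ^+ 2)^-1) t 1)
  (@is_derive1_comp _ (@ln R) D _ _ _ (is_derive1_ln D0) (is_derive_circ_D t)))) => //.
by field; rewrite e0 gt_eqF.
Qed.

(** For e nonzero, N^2 / D = (1 / D - 1) / e^2 reduces to [circle_int_Dinv]. At e = 0 one has D = w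
    = 1, and an explicit primitive is used. *)
Lemma circle_int_nn : circle_int (fun t => N t ^+ 2 / D t) =
  2 * pi * (A ^+ 2 + B ^+ 2) / (w * (1 + w)).
Proof.
have w1 : 1 + w != 0 by rewrite gt_eqF// addr_gt0.
have w0' : w != 0 by rewrite gt_eqF.
have cnn : continuous (fun t => N t ^+ 2 / D t).
  exact: (continuous_circ_quot (continuousMe continuous_circ_n continuous_circ_n)).
have [e0|e0] := eqVneq e 0.
  have -> : w = 1 by apply/eqP; rewrite -[_ == _](@eqrXn2 _ 2) ?ltW// wE e0 expr1n; apply/eqP; ring.
  suff dG (t : R) : is_derive t 1
      (fun t => 2^-1 * ((A ^+ 2 + B ^+ 2) * t - M t * N t)) (N t ^+ 2 / D t).
    by rewrite (circle_FTC cnn dG) !circ_period; field.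
  apply: (is_derive_cast (is_deriveMe (is_derive_cste (2^-1 : R) t 1)
    (is_deriveBe (is_deriveMe (is_derive_cste (A ^+ 2 + B ^+ 2) t 1) (is_derive_id t (1:R)))
      (is_deriveMe (is_derive_circ_m t) (is_derive_circ_n t))))) => //.
  by rewrite -(circ_sqr t) /D e0 /=; field.
have -> : (fun t => N t ^+ 2 / D t) = (fun t => (e ^+ 2)^-1 * (D t)^-1 + - (e ^+ 2)^-1).
  apply/funext => t; have D0 := circ_D_gt0 t; rewrite /D in D0 *.
  by field; rewrite exprMn e0 gt_eqF.
have cD := continuous_circ_Dinv.
apply: (etrans (circle_intD (continuousZe cD) (@continuous_cste _))).
rewrite circle_intZ// circle_int_Dinv circle_cst.
have -> : A ^+ 2 + B ^+ 2 = (e ^+ 2)^-1 * (1 - w ^+ 2) by rewrite wE; field.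
by field; rewrite e0 w1 w0'.
Qed.

Lemma circle_int_mm : circle_int (fun t => M t ^+ 2 / D t) =
  2 * pi * (A ^+ 2 + B ^+ 2) / (1 + w).
Proof.
have w1 : 1 + w != 0 by rewrite gt_eqF// addr_gt0.
have w0' : w != 0 by rewrite gt_eqF.
have -> : (fun t => M t ^+ 2 / D t) =
    (fun t => (A ^+ 2 + B ^+ 2) * (D t)^-1 + -1 * (N t ^+ 2 / D t)).
  by apply/funext => t; rewrite -(circ_sqr t); ring.
have cnn : continuous (fun t => N t ^+ 2 / D t).
  exact: (continuous_circ_quot (continuousMe continuous_circ_n continuous_circ_n)).
have cD := continuous_circ_Dinv.
apply: (etrans (circle_intD (continuousZe cD) (continuousZe cnn))).
rewrite !circle_intZ// circle_int_Dinv circle_int_nn.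
by field; rewrite w0' w1.
Qed.

End Trigonometric.
End Integration.

(** * The circle of directions over a point *)

Section Fibre.
Variable R : realType.
Local Notation V := 'rV[R]_3.

Definition fibre0 (x : V) : V := xget 0 [set e | HS2 (x, e)].

Lemma fibre0_HS2 (x : V) : S2 x -> HS2 (x, fibre0 x).
Proof.
move=> xx; rewrite /fibre0.
suff [e he] : exists e, HS2 (x, e) by case: xgetP => [y _ //|/(_ e)].
(* Off the poles K gives a tangent direction; at the poles the first basis vector is tangent. *)
have [kx|kx] := eqVneq (killing x) 0.
  have x1 : x 0 0 = 0 by have := congr1 (fun u : V => u 0 1) kx; rewrite vec3E mxE.
  exists (vec3 1 0 0); split; [split => //|]; rewrite /= dotE !vec3E ?x1; ring.
have u1 := dot_unitv kx.
exists (unitv (killing x)); split => //; split => //=.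
by rewrite /unitv dotZr dot_killing mulr0.
Qed.

Variable x : V.
Hypothesis xx : S2 x.
Let e := fibre0 x.
Let e' := cross x e.
Let he : HS2 (x, e) := fibre0_HS2 xx.
Let xe : dot x e = 0 := he.1.2.
Let ee : dot e e = 1 := he.2.

Lemma fibreE t : fibre x t = (x, cos t *: e - sin t *: e').
Proof. by []. Qed.

Lemma fibre_HS2 t : HS2 (fibre x t).
Proof.
have xe' : dot x e' = 0 := dot_cross_l _ _.
have ee' : dot e e' = 0 := dot_cross_r _ _.
have e'e' : dot e' e' = 1 := frame_tt xx xe ee.
rewrite fibreE; split; first by split => //=; rewrite !dotlin xe xe'; ring.
rewrite /= !dotlin ee e'e' (dotC e' e) ee' -[RHS](cos2Dsin2 t); ring.
Qed.

Lemma cross_fibre t : cross x (fibre x t).2 = cos t *: e' + sin t *: e.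
Proof.
have H : cross x e' = - e.
  have -> : cross x e' = dot x e *: x - dot x x *: e.
    by rewrite /e'; apply: row3P; rewrite !(vec3E, mxE) !dotE; ring.
  by rewrite xe xx scale0r sub0r scale1r.
rewrite fibreE /= -[e in RHS]opprK -H.
by apply: row3P; rewrite !(vec3E, mxE); ring.
Qed.

Lemma derive1_fibre t : derive1 (fibre x) t = tvec (fibre x t) 0 0 (- 1).
Proof.
rewrite derive1E; apply: derive_val.
have cs (W : normedModType R) (r : W) := is_derive_cste r t (1:R).
have hv := is_deriveBe (is_derive_scalee (is_derive_cos t) (cs _ e))
   (is_derive_scalee (is_derive_sin t) (cs _ e')).
apply: (is_derive_cast (is_derive_pair (cs _ x) hv)) => [//|].
rewrite /tvec cross_fibre; congr (_, _).
  by rewrite !scale0r addr0.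
by rewrite !scaler0 oppr0 scale0r; apply: row3P; rewrite !mxE; ring.
Qed.

Lemma fibre_antipode t : (fibre x (t + pi)).2 = - (fibre x t).2.
Proof. by rewrite !fibreE /= sinDpi cosDpi !scaleNr opprB addrC opprK. Qed.

Let A := dot (killing x) e.
Let B := dot (killing x) e'.

Lemma kz_m_fibre t : kz_m (fibre x t) = circ_m A B t.
Proof. by rewrite /kz_m fibreE /= !dotlin /circ_m -/A -/B; ring. Qed.

Lemma kz_n_fibre t : kz_n (fibre x t) = circ_n A B t.
Proof. by rewrite /kz_n cross_fibre !dotlin /circ_n -/A -/B; ring. Qed.

Lemma fibre_killing_sqr : A ^+ 2 + B ^+ 2 = dot (killing x) (killing x).
Proof. by rewrite (frame_killing_sqr xx xe ee). Qed.

Variable eps : R.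
Hypothesis heps : 0 <= eps < 1.

Definition kz_w (y : V) := Num.sqrt (kz_k eps y).

Lemma kz_w_gt0 (y : V) : S2 y -> 0 < kz_w y.
Proof. by move=> yy; rewrite sqrtr_gt0; exact: kz_k_gt0. Qed.

Lemma kz_w_sqr (y : V) : S2 y -> kz_w y ^+ 2 = kz_k eps y.
Proof. by move=> yy; rewrite sqr_sqrtr// ltW// kz_k_gt0. Qed.

Lemma kz_w_circ : kz_w x ^+ 2 = 1 - eps ^+ 2 * (A ^+ 2 + B ^+ 2).
Proof. by rewrite kz_w_sqr// fibre_killing_sqr. Qed.

Local Notation D t := (1 - eps ^+ 2 * circ_n A B t ^+ 2).

Lemma kz_S_fibre t : kz_S eps (fibre x t) ^+ 2 = D t.
Proof. by rewrite (kz_S_sqrn heps (fibre_HS2 t)) kz_n_fibre. Qed.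

Lemma kz_S_fibre_pi t : kz_S eps (fibre x (t + pi)) = kz_S eps (fibre x t).
Proof. by rewrite /kz_S /kz_m fibre_antipode !dotlin !opprK !sqrrN. Qed.

Lemma kz_m_fibre_pi t : kz_m (fibre x (t + pi)) = - kz_m (fibre x t).
Proof. by rewrite /kz_m fibre_antipode !dotlin. Qed.

Lemma is_derive_fibre_SV (t : R) : exists d,
  is_derive t 1 (fun t => (kz_S eps (fibre x t))^-1) d.
Proof.
have w0 := kz_w_gt0 xx; have wE := kz_w_circ.
have D0 := circ_D_gt0 w0 wE t.
have dS := is_derive_sqrte (is_derive_circ_D eps A B t) D0.
have S0 : Num.sqrt (D t) != 0 by rewrite gt_eqF// sqrtr_gt0.
eexists; apply: (is_derive_cast (is_deriveVe dS S0)) => [s|//].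
by rewrite -kz_S_fibre sqrtr_sqr gtr0_norm// kz_S_gt0//; exact: fibre_HS2.
Qed.

Lemma continuous_fibre_SV : continuous (fun t => (kz_S eps (fibre x t))^-1).
Proof. by move=> t; have [d hd] := is_derive_fibre_SV t; exact: is_derive_continuous hd. Qed.

Lemma continuous_fibre_dot (u : V) : continuous (fun t => dot u (fibre x t).2).
Proof.
have -> : (fun t => dot u (fibre x t).2) = (fun t => cos t * dot u e - sin t * dot u e').
  by apply/funext => t; rewrite fibreE /= !dotlin.
move=> t; exact: is_derive_continuous
  (is_deriveBe (is_deriveMe (is_derive_cos t) (is_derive_cste (dot u e) t 1))
    (is_deriveMe (is_derive_sin t) (is_derive_cste (dot u e') t 1))).
Qed.

End Fibre.

(** * Volume form, angle form and Laplacian *)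

Section VolumeAngle.
Variable R : realType.
Local Notation V := 'rV[R]_3.
Local Notation mu := (@lebesgue_measure R).
Local Notation circle_int g := (\int[mu]_(t in `[0, 2 * pi]) g t)%R.
Variables (eps : R) (F : V * V -> R).
Hypotheses (heps : 0 <= eps < 1) (hF : katok_ziller eps F).
Local Notation S := (kz_S eps).
Local Notation k := (kz_k eps).
Local Notation w := (kz_w eps).
Local Notation m := (@kz_m R).
Local Notation n := (@kz_n R).
Local Notation c := (kz_c eps).

(** The density of A /\ dA on the frame: the coefficient 1 / c of A times the coefficient 1 / S^3 of
    dA. *)
Definition kz_weight (p : V * V) := (S p ^+ 3 * c p)^-1.

Lemma kz_weight_gt0 p : HS2 p -> 0 < kz_weight p.
Proof.
by move=> hp; rewrite invr_gt0 mulr_gt0 ?exprn_gt0// ?kz_S_gt0 ?kz_c_gt0.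
Qed.

(** Writing 1 / c = (S - eps m) / k splits the weight into its even and odd parts under v |-> -
    v. *)
Lemma kz_weightE p : HS2 p ->
  kz_weight p = (k p.1)^-1 * ((S p)^-1 ^+ 2 + - (eps * (m p * (S p)^-1 ^+ 3))).
Proof.
move=> hp; have S0 := kz_S_gt0 heps hp; have c0 := kz_c_gt0 heps hp.
have k0 := kz_k_gt0 heps hp.1.1.
rewrite /kz_weight -(kz_c_mul heps hp) in k0 *.
have d0 : S p - eps * m p != 0.
  by move: k0; apply: contraTneq => ->; rewrite mulr0 ltxx.
by field; rewrite d0 !gt_eqF.
Qed.

Section OnFibre.
Variable x : V.
Hypothesis xx : S2 x.
Let w0 : 0 < w x := kz_w_gt0 heps xx.

Let SV t := (S (fibre x t))^-1.

Let SV_pi t : SV (t + pi) = SV t.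
Proof. by rewrite /SV kz_S_fibre_pi. Qed.

Let cSV : continuous SV := continuous_fibre_SV xx heps.

Let cm : continuous (fun t => m (fibre x t)) := @continuous_fibre_dot _ x (killing x).

Lemma fibre_SVE t : SV t ^+ 2 =
  (1 - eps ^+ 2 * circ_n (dot (killing x) (fibre0 x))
    (dot (killing x) (cross x (fibre0 x))) t ^+ 2)^-1.
Proof. by rewrite /SV exprVn (kz_S_fibre xx heps). Qed.

Lemma fibre_int_SV : circle_int (fun t => SV t ^+ 2) = 2 * pi / w x.
Proof.
rewrite -(circle_int_Dinv w0 (kz_w_circ xx heps)).
by apply: eq_Rintegral => t _; rewrite fibre_SVE.
Qed.

Let cSV2 : continuous (fun t => SV t ^+ 2) := continuousMe cSV cSV.
Let cSV3 : continuous (fun t => SV t ^+ 3) := continuousMe cSV cSV2.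

(** Only the even part survives, giving 2 pi / w divided by k = w^2. This value normalises alpha and
    so fixes the factor w^-3 in Omega. *)
Lemma fibre_int_weight : circle_int (fun t => kz_weight (fibre x t)) = 2 * pi / w x ^+ 3.
Proof.
have ck := continuousMe cm cSV3.
transitivity (circle_int (fun t => (k x)^-1 * SV t ^+ 2
    + (- (eps / k x)) * (m (fibre x t) * SV t ^+ 3))).
  by apply: eq_Rintegral => t _; rewrite (kz_weightE (fibre_HS2 xx t)) -/(SV t) /=; ring.
apply: (etrans (circle_intD (continuousZe cSV2) (continuousZe ck))).
rewrite !circle_intZ// (circle_odd ck).
  rewrite mulr0 addr0 fibre_int_SV -(kz_w_sqr heps xx).
  by field; rewrite gt_eqF.
by move=> t; rewrite kz_m_fibre_pi// SV_pi mulNr.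
Qed.

Lemma continuous_fibre_weight : continuous (fun t => kz_weight (fibre x t)).
Proof.
have -> : (fun t => kz_weight (fibre x t)) = (fun t => (k x)^-1 *
    (SV t ^+ 2 + (- eps) * (m (fibre x t) * SV t ^+ 3))).
  by apply/funext => t; rewrite (kz_weightE (fibre_HS2 xx t)) -/(SV t) /=; ring.
exact: (continuousZe (continuousDe cSV2 (continuousZe (continuousMe cm cSV3)))).
Qed.

End OnFibre.

Definition kz_vol (x a b : V) := (w x ^+ 3)^-1 * dot x (cross a b).

(** The minus sign makes the form positive on the clockwise fibre velocity (0, - t). *)
Definition kz_ang (p Z : V * V) :=
  - (w p.1 ^+ 3 * kz_weight p) * dot (cross p.1 p.2) Z.2.

Lemma dot_cross_frame (p : V * V) a1 a2 b1 b2 : HS2 p ->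
  dot p.1 (cross (a1 *: p.2 + a2 *: cross p.1 p.2) (b1 *: p.2 + b2 *: cross p.1 p.2)) =
  a1 * b2 - a2 * b1.
Proof.
move=> [[xx xv] vv]; rewrite /S2/= in xx.
transitivity ((a1 * b2 - a2 * b1) * (dot p.1 p.1 * dot p.2 p.2 - dot p.1 p.2 ^+ 2)).
  by rewrite !dotE !(vec3E, mxE) /=; ring.
by rewrite xx xv vv; ring.
Qed.

Lemma kz_ang_frame p a1 a2 b : HS2 p ->
  kz_ang p (tvec p a1 a2 b) = - (w p.1 ^+ 3 * kz_weight p) * b.
Proof.
move=> hp; have [[xx xv] vv] := hp.
rewrite /kz_ang /= !dotlin (frame_tt xx xv vv) (dotC _ p.1) dot_cross_l; ring.
Qed.

(** Shows that [volume_angle] chooses from a nonempty set; the values of the chosen forms are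
    computed from the defining conditions afterwards. *)
Lemma kz_volume_angle : is_volume_angle F kz_vol kz_ang.
Proof.
split.
- move=> x xx; split.
  + by move=> a u v u' _ _ _; rewrite /kz_vol !dotE !vec3E !mxE; ring.
  + by move=> u _; rewrite /kz_vol !dotE !vec3E; ring.
  + by move=> u v _ _; rewrite /kz_vol !dotE !vec3E; ring.
  + have he := fibre0_HS2 xx; exists (fibre0 x), (cross x (fibre0 x)); split.
    * exact: he.1.
    * by split => //=; rewrite dot_cross_l.
    * have := dot_cross_frame 1 0 0 1 he; rewrite /= !scale1r !scale0r addr0 add0r.
      rewrite /kz_vol => ->; rewrite !(mulr1, mulr0, subr0).
      by rewrite gt_eqF// invr_gt0 exprn_gt0// kz_w_gt0.
- move=> p hp; split.
    by move=> a Z W _ _; rewrite /kz_ang /= !dotlin; ring.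
  move=> Z hZ Z1; apply: contra_neq => h.
  have w0 := kz_w_gt0 heps hp.1.1; have k0 := kz_weight_gt0 hp.
  have b0 : dot Z.2 (cross p.1 p.2) = 0.
    apply/eqP; move/eqP: h; rewrite /kz_ang (dotC _ Z.2) mulf_eq0 oppr_eq0 mulf_eq0.
    by rewrite gt_eqF ?exprn_gt0// gt_eqF.
  by rewrite (tangent_tvecP hp hZ) Z1 b0 !dotlin /tvec oppr0 !scale0r addr0.
- move=> p Z1 Z2 Z3 hp h1 h2 h3.
  rewrite (tangent_tvecP hp h1) (tangent_tvecP hp h2) (tangent_tvecP hp h3).
  move: (dot Z1.1 _) (dot Z1.1 _) (dot Z1.2 _) (dot Z2.1 _) (dot Z2.1 _) (dot Z2.2 _)
    (dot Z3.1 _) (dot Z3.1 _) (dot Z3.2 _) => a1 a2 a3 b1 b2 b3 c1 c2 c3.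
  rewrite /wedge12 !kz_ang_frame// /kz_vol !dot_cross_frame//.
  rewrite !(hilbert_frame heps hF hp) !(extd_frame heps hF hp) /kz_weight.
  have S0 := kz_S_gt0 heps hp; have c0 := kz_c_gt0 heps hp.
  have w0 := kz_w_gt0 heps hp.1.1.
  by field; rewrite !gt_eqF.
- move=> x xx; have w0 := kz_w_gt0 heps xx.
  transitivity (circle_int (fun t => w x ^+ 3 * kz_weight (fibre x t))).
    apply: eq_Rintegral => t _; rewrite derive1_fibre// kz_ang_frame; last exact: fibre_HS2.
    by rewrite mulrN1 opprK.
  have cw := continuous_fibre_weight xx.
  rewrite circle_intZ// fibre_int_weight// /vol_S1.
  by field; rewrite gt_eqF.
Qed.

End VolumeAngle.

Section Laplacian.
Variable R : realType.
Local Notation V := 'rV[R]_3.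
Local Notation mu := (@lebesgue_measure R).
Local Notation circle_int g := (\int[mu]_(t in `[0, 2 * pi]) g t)%R.
Variables (eps : R) (F : V * V -> R).
Hypotheses (heps : 0 <= eps < 1) (hF : katok_ziller eps F).
Local Notation S := (kz_S eps).
Local Notation k := (kz_k eps).
Local Notation w := (kz_w eps).
Local Notation m := (@kz_m R).
Local Notation n := (@kz_n R).
Local Notation c := (kz_c eps).
Local Notation Om := (finsler_volume_form F).
Local Notation al := (finsler_angle_form F).

Lemma volume_angleP : is_volume_angle F Om al.
Proof.
have H := kz_volume_angle heps hF.
rewrite /finsler_volume_form /finsler_angle_form /volume_angle.
by case: xgetP => [b -> //|/(_ (kz_vol eps, kz_ang eps))].
Qed.

Lemma volume_form_bilinear (x u v : V) (a b a' b' : R) :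
  TS2 (x, u) -> TS2 (x, v) ->
  Om x (a *: u + b *: v) (a' *: u + b' *: v) = (a * b' - b * a') * Om x u v.
Proof.
move=> hu hv; have [h _ _ _] := volume_angleP.
have [lin alt anti _] := h _ hu.1.
have T r s : TS2 (x, r *: u + s *: v).
  by split; [exact: hu.1|rewrite /= !dotlin hu.2 hv.2; ring].
have linl r s y : TS2 (x, y) -> Om x (r *: u + s *: v) y = r * Om x u y + s * Om x v y.
  move=> hy; have T0 : TS2 (x, 0) by split; [exact: hu.1|rewrite /= dot0r].
  have Tv : TS2 (x, s *: v).
    by split; [exact: hu.1|rewrite /= !dotlin hv.2; ring].
  have z : Om x 0 y = 0.
    by have := lin 1 0 0 y T0 T0 hy; rewrite scale1r addr0 mul1r => /eqP;
      rewrite addrC -subr_eq subrr => /eqP <-.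
  rewrite lin//; congr (_ + _).
  by have := lin s v 0 y hv T0 hy; rewrite !addr0 z addr0.
rewrite linl// (anti u)// (anti v)// !linl// !alt// (anti v u)//.
by ring.
Qed.

(** Two direct orthonormal frames differ by a rotation, of determinant a^2 + b^2 = 1. So one number
    per base point describes Omega. *)
Lemma volume_form_frame (p : V * V) : HS2 p ->
  Om p.1 p.2 (cross p.1 p.2) = Om p.1 (fibre0 p.1) (cross p.1 (fibre0 p.1)).
Proof.
move=> [[xx xv] vv]; have [[/= _ xe] ee] := fibre0_HS2 xx.
case: p => x v /= in xx xv vv xe ee *; set e := fibre0 x in xe ee *.
have hu : TS2 (x, e) by split.
have hv : TS2 (x, cross x e) by split => //=; rewrite dot_cross_l.
have E := frame_decomp xx xe ee v.
rewrite (dotC v x) xv scale0r add0r in E.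
set a := dot v e in E; set b := dot v _ in E.
have ab : a ^+ 2 + b ^+ 2 = 1.
  rewrite -vv E !dotlin ee (frame_tt xx xe ee) (dotC _ e) dot_cross_r; ring.
have E' : cross x v = (- b) *: e + a *: cross x e.
  have H : e = - cross x (cross x e).
    have -> : cross x (cross x e) = dot x e *: x - dot x x *: e.
      by apply: row3P; rewrite !(vec3E, mxE) !dotE; ring.
    by rewrite xe xx scale0r sub0r scale1r opprK.
  rewrite {1}E [in X in _ = X + _]H.
  by apply: row3P; rewrite !(vec3E, mxE); ring.
rewrite E' {1}E volume_form_bilinear//.
rewrite (_ : a * a - b * - b = 1) ?mul1r//.
by rewrite -ab; ring.
Qed.

(** The wedge identity evaluated on the vertical vector, (v, - x) and (t, 0): Omega kills vertical
    vectors, so a single product remains on the left. *)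
Lemma angle_mul_volume (p : V * V) : HS2 p ->
  al p (tvec p 0 0 (- 1)) * Om p.1 (fibre0 p.1) (cross p.1 (fibre0 p.1)) =
  kz_weight eps p.
Proof.
move=> hp; have [[xx xv] vv] := hp; have [hO ha hw _] := volume_angleP.
have T a1 a2 a3 := tangent_tvec a1 a2 a3 hp.
rewrite -(volume_form_frame hp).
have := hw p _ _ _ hp (T 0 0 (- 1)) (T 1 0 0) (T 0 1 0).
have tv : TS2 (p.1, p.2) by split.
have tt : TS2 (p.1, cross p.1 p.2) by split => //=; rewrite dot_cross_l.
rewrite /wedge12 !volume_form_bilinear// !(hilbert_frame heps hF hp) !(extd_frame heps hF hp).
have S0 := kz_S_gt0 heps hp; have c0 := kz_c_gt0 heps hp.
set o := Om _ _ _ => H.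
transitivity (al p (tvec p 0 0 (-1)) * ((1 * 1 - 0 * 0) * o) -
       al p (tvec p 1 0 0) * ((0 * 1 - 0 * 0) * o) +
       al p (tvec p 0 1 0) * ((0 * 0 - 0 * 1) * o)); first by ring.
rewrite H /kz_weight.
by field; rewrite !gt_eqF.
Qed.

(** By [angle_mul_volume] alpha is the weight divided by Omega, which is constant on the fibre; the
    condition that alpha integrate to 2 pi then determines Omega. *)
Lemma volume_formE (p : V * V) : HS2 p ->
  Om p.1 p.2 (cross p.1 p.2) = (w p.1 ^+ 3)^-1.
Proof.
move=> hp; rewrite volume_form_frame//; case: p hp => x v hp /=.
have xx : S2 x := hp.1.1.
have [_ _ _ /(_ x xx)] := volume_angleP.
set o := Om _ _ _.
have w0 := kz_w_gt0 heps xx.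
have o0 : o != 0.
  have := angle_mul_volume hp; rewrite -/o /=; apply: contra_eqN => /eqP ->.
  by rewrite mulr0 eq_sym gt_eqF// kz_weight_gt0.
have -> : fibre_integral al x = circle_int (fun t => o^-1 * kz_weight eps (fibre x t)).
  apply: eq_Rintegral => t _; rewrite derive1_fibre//.
  have := angle_mul_volume (fibre_HS2 xx t); rewrite /= -/o => <-.
  by rewrite mulrCA mulVf ?mulr1.
rewrite circle_intZ.
  rewrite (fibre_int_weight heps xx) /vol_S1 => H.
  have p0 : 2 * (pi : R) != 0 by rewrite gt_eqF// mulr_gt0// pi_gt0.
  have H1 : o^-1 * (w x ^+ 3)^-1 = 1.
    by apply: (mulfI p0); rewrite mulr1 -[RHS]H; ring.
  by rewrite -[RHS]mul1r -(mulfV o0) -mulrA H1 mulr1.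
exact: continuous_fibre_weight.
Qed.

Lemma angle_formE (p : V * V) : HS2 p ->
  al p (tvec p 0 0 (- 1)) = w p.1 ^+ 3 * kz_weight eps p.
Proof.
move=> hp; rewrite -(angle_mul_volume hp) -volume_form_frame// volume_formE//.
by rewrite mulrC -mulrA mulVf ?mulr1// expf_neq0// gt_eqF// kz_w_gt0//; exact: hp.1.1.
Qed.

Lemma finsler_volumeE : finsler_volume F = 4 * pi / (1 - eps ^+ 2).
Proof.
have e1 := eps_sqr_lt1 heps.
have e2 : 1 - eps ^+ 2 != 0 by rewrite gt_eqF// subr_gt0.
pose W (phi : R) := 1 - eps ^+ 2 * sin phi ^+ 2.
have W0 phi : 0 < W phi.
  by have := sin2cos2 phi; have := sqr_ge0 (cos phi); have := sqr_ge0 eps; rewrite /W; nra.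
have dW (phi : R) : is_derive phi 1 W (- (2 * eps ^+ 2 * sin phi * cos phi)).
  apply: (is_derive_cast (is_deriveBe (is_derive_cste (1:R) phi 1)
   (is_deriveMe (is_derive_cste (eps ^+ 2) phi 1) (is_derive_sqr (is_derive_sin phi))))) => //.
  by ring.
pose s phi := Num.sqrt (W phi).
have s0 phi : 0 < s phi by rewrite sqrtr_gt0.
have sE phi : s phi ^+ 2 = 1 - eps ^+ 2 * sin phi ^+ 2 by rewrite sqr_sqrtr// ltW.
have ds (phi : R) : is_derive phi 1 s (- (eps ^+ 2 * sin phi * cos phi / s phi)).
  apply: (is_derive_eq (is_derive_sqrte (dW phi) (W0 phi))).
  by rewrite -/(s phi); field; rewrite gt_eqF.
have dsV (phi : R) := is_deriveVe (ds phi) (lt0r_neq0 (s0 phi)).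
have csV : continuous (fun phi => (s phi)^-1).
  by move=> phi; exact: is_derive_continuous (dsV phi).
have csin : continuous (@sin R).
  by move=> phi; exact: is_derive_continuous (is_derive_sin phi).
pose g phi := 2 * pi * (sin phi * ((s phi)^-1 * ((s phi)^-1 * (s phi)^-1))).
have cg : continuous g.
  exact: (continuousZe (continuousMe csin (continuousMe csV (continuousMe csV csV)))).
rewrite /finsler_volume /S2_integral.
transitivity (\int[mu]_(phi in `[0, pi]) g phi)%R.
  apply: eq_Rintegral => phi _.
  rewrite (_ : g phi = circle_int (fun=> sin phi * ((s phi)^-1 * ((s phi)^-1 * (s phi)^-1)))).
    apply: eq_Rintegral => theta _.
    have [xp pp] := polar_tangent phi theta.
    have xx := polar_S2 phi theta.
    have hp : HS2 (polar phi theta, polar_phi phi theta) by split.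
    have t2 : TS2 (polar phi theta, cross (polar phi theta) (polar_phi phi theta)).
      by split => //=; rewrite dot_cross_l.
    have := volume_form_bilinear 1 0 0 (sin phi) hp.1 t2.
    rewrite scale1r !scale0r addr0 add0r -polar_theta_cross => ->.
    rewrite (volume_formE hp) /=.
    have -> : w (polar phi theta) = s phi.
      rewrite /kz_w /kz_k killing_polar polar_theta_cross !dotlin.
      by rewrite (frame_tt xx xp pp) /s /W mulr1 -expr2.
    by rewrite -exprVn; ring.
  by rewrite circle_cst.
(* The derivative of - cos phi / s is sin phi (s^2 - eps^2 cos^2 phi) / s^3 = (1 - eps^2) sin phi /
   s^3. *)
pose G phi := (2 * pi / (1 - eps ^+ 2)) * (- (cos phi * (s phi)^-1)).
have dG (phi : R) : 0 <= phi <= pi -> is_derive phi 1 G (g phi).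
  move=> _.
  apply: (is_derive_cast (is_deriveMe (is_derive_cste (2 * pi / (1 - eps ^+ 2)) phi 1)
    (is_deriveNe (is_deriveMe (is_derive_cos phi) (dsV phi))))) => //.
  have S0 : s phi != 0 by rewrite gt_eqF.
  have c2 : cos phi ^+ 2 = 1 - sin phi ^+ 2 by rewrite cos2sin2.
  rewrite /g.
  transitivity (2 * pi / (1 - eps ^+ 2) * (sin phi * (s phi ^+ 2 - eps ^+ 2 * cos phi ^+ 2) / s phi ^+ 3)).
    by field; rewrite S0 e2.
  by rewrite c2 sE; field; rewrite S0 e2.
rewrite (Rintegral_FTC (pi_gt0 R) cg dG) /G.
have -> : s pi = 1 by rewrite /s /W sinpi expr0n mulr0 subr0 sqrtr1.
have -> : s 0 = 1 by rewrite /s /W sin0 expr0n mulr0 subr0 sqrtr1.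
by rewrite cospi cos0; field.
Qed.

End Laplacian.

(** * The Laplacian as an explicit differential operator *)

Section LaplacianFormula.
Variable R : realType.
Local Notation V := 'rV[R]_3.
Local Notation mu := (@lebesgue_measure R).
Local Notation circle_int g := (\int[mu]_(t in `[0, 2 * pi]) g t)%R.
Variables (eps : R) (F : V * V -> R).
Hypotheses (heps : 0 <= eps < 1) (hF : katok_ziller eps F).
Local Notation S := (kz_S eps).
Local Notation k := (kz_k eps).
Local Notation w := (kz_w eps).
Local Notation m := (@kz_m R).
Local Notation n := (@kz_n R).
Local Notation c := (kz_c eps).

Variables (f : V -> R) (x : V).
Let g := f \o @unitv R.
Hypotheses (g2 : twice_differentiable g) (xx : S2 x).
Let z := x 0 2.
Let kap := cross x (killing x).
Let SV t := (S (fibre x t))^-1.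
Let Q t := dot (hess g x (fibre x t).2) (fibre x t).2.
Let T t := dot (grad g x) (cross x (fibre x t).2).

Let cSV : continuous SV := continuous_fibre_SV xx heps.
Let cm : continuous (fun t => m (fibre x t)) := @continuous_fibre_dot _ x (killing x).

Lemma hess_sym_expand (u v : V) (a b : R) :
  dot (hess g x (a *: u + b *: v)) (a *: u + b *: v) =
  a ^+ 2 * dot (hess g x u) u + a * b * (dot (hess g x u) v + dot (hess g x v) u)
  + b ^+ 2 * dot (hess g x v) v.
Proof. by rewrite hessD !hessZ !dotlin; ring. Qed.

Let cQ : continuous Q.
Proof.
pose G i := grad ('D_(delta_mx 0 i) g) x.
have -> : Q = fun t => dot (G 0) (fibre x t).2 * dot (vec3 1 0 0) (fibre x t).2
    + dot (G 1) (fibre x t).2 * dot (vec3 0 1 0) (fibre x t).2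
    + dot (G 2) (fibre x t).2 * dot (vec3 0 0 1) (fibre x t).2.
  apply/funext => t; rewrite /Q [LHS]dotE.
  have H i : hess g x (fibre x t).2 0 i = dot (G i) (fibre x t).2 by rewrite mxE.
  have e0 (v : V) : dot (vec3 1 0 0) v = v 0 0 by rewrite dotE !vec3E; ring.
  have e1 (v : V) : dot (vec3 0 1 0) v = v 0 1 by rewrite dotE !vec3E; ring.
  have e2 (v : V) : dot (vec3 0 0 1) v = v 0 2 by rewrite dotE !vec3E; ring.
  by rewrite !H e0 e1 e2.
have d u := @continuous_fibre_dot _ x u.
exact: (continuousDe (continuousDe (continuousMe (d _) (d _)) (continuousMe (d _) (d _)))
  (continuousMe (d _) (d _))).
Qed.

Let cT : continuous T.
Proof.
have -> : T = fun t => dot (cross (grad g x) x) (fibre x t).2.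
  by apply/funext => t; rewrite -dot_cross_swap.
exact: continuous_fibre_dot.
Qed.

(** c^2 times the weight is S^-2 + eps m S^-3, so the Hessian is averaged against the even density
    S^-2. This form includes the poles, where [finsler_laplace_linear] needs it. *)
Lemma finsler_laplace_circle : finsler_laplace F f x =
  w x ^+ 3 / pi * circle_int (fun t => Q t * SV t ^+ 2)
  - 2 * eps ^+ 2 * z * dot (grad g x) kap.
Proof.
have p0 : (pi : R) != 0 by rewrite gt_eqF// pi_gt0.
have w0 := kz_w_gt0 heps xx.
have w1 : w x != 0 by rewrite gt_eqF.
have cSV2 : continuous (fun t => SV t ^+ 2) := continuousMe cSV cSV.
have cSV3 : continuous (fun t => SV t ^+ 3) := continuousMe cSV cSV2.
pose E t := Q t * SV t ^+ 2.
have cE : continuous E := continuousMe cQ cSV2.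
(* The odd part of the integrand: m and T change sign under v |-> - v, Q and S do not. *)
pose O t := eps * (m (fibre x t) * (Q t * SV t ^+ 3)) + 2 * eps * z * (T t * SV t ^+ 3)
  + eps ^+ 3 * z * dot (grad g x) kap / k x * (m (fibre x t) * SV t ^+ 3).
have cO : continuous O.
  exact: (continuousDe (continuousDe (continuousZe (continuousMe cm (continuousMe cQ cSV3)))
    (continuousZe (continuousMe cT cSV3))) (continuousZe (continuousMe cm cSV3))).
have oO t : O (t + pi) = - O t.
  have QE : Q (t + pi) = Q t.
    rewrite /Q fibre_antipode -[- _]scaleN1r hessZ !dotlin; ring.
  have TE : T (t + pi) = - T t.
    rewrite /T fibre_antipode; have -> : cross x (- (fibre x t).2) = - cross x (fibre x t).2.
      by apply: row3P; rewrite !(vec3E, mxE); ring.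
    by rewrite dotNr.
  rewrite /O QE TE kz_m_fibre_pi /SV kz_S_fibre_pi; ring.
(* From the v-independent term of [lie2_reeb], whose weight has even part k^-1 S^-2. *)
pose K := - (eps ^+ 2 * z * dot (grad g x) kap / k x).
have cEK : continuous (fun t => E t + K * SV t ^+ 2) := continuousDe cE (continuousZe cSV2).
rewrite /finsler_laplace.
have -> : fibre_integral (fun p Z => lie (reeb F) (lie (reeb F) (f \o fst)) p
    * finsler_angle_form F p Z) x =
    circle_int (fun t => w x ^+ 3 * ((E t + K * SV t ^+ 2) + O t)).
  apply: eq_Rintegral => t _; rewrite derive1_fibre//.
  have hp := fibre_HS2 xx t.
  rewrite (angle_formE heps hF hp) (lie2_reeb heps hF g2 hp).
  have S0 := kz_S_gt0 heps hp; have c0 := kz_c_gt0 heps hp.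
  have kE := kz_c_mul heps hp; have k0 := kz_k_gt0 heps xx.
  rewrite -[(fibre x t).1]/x in kE *; rewrite -/z -/kap -/(T t) -/(Q t).
  rewrite /O /K /E /SV /kz_weight -kE in k0 *.
  have d0 : S (fibre x t) - eps * m (fibre x t) != 0.
    by move: k0; apply: contraTneq => ->; rewrite mulr0 ltxx.
  have cE' : c (fibre x t) = S (fibre x t) + eps * m (fibre x t) by [].
  rewrite cE' in c0 *.
  by field; rewrite d0 !gt_eqF.
rewrite circle_intZ; last exact: continuousDe cEK cO.
rewrite (circle_intD cEK cO) (circle_odd cO oO) addr0.
rewrite (circle_intD cE (continuousZe cSV2)) circle_intZ// (fibre_int_SV heps xx).
rewrite /K -(kz_w_sqr heps xx) /vol_S1.
move: (pi : R) p0 => P p0.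
by field; rewrite p0 w1.
Qed.

Hypothesis kx : killing x != 0.

(** Expand v = (M K - N (x /\ K)) / |K|^2 in the orthogonal basis (K, x /\ K). The mixed Hessian
    terms multiply the integral of M N / D, which is zero. *)
Lemma finsler_laplace_offpole : finsler_laplace F f x =
  2 * w x ^+ 2 / (dot (killing x) (killing x) * (1 + w x))
    * (w x * dot (hess g x (killing x)) (killing x) + dot (hess g x kap) kap)
  - 2 * eps ^+ 2 * z * dot (grad g x) kap.
Proof.
rewrite finsler_laplace_circle; congr (_ - _).
have he := fibre0_HS2 xx; have [[/= _ xe] ee] := he.
have w0 := kz_w_gt0 heps xx; have wE := kz_w_circ xx heps.
have rE := fibre_killing_sqr xx.
set A := dot _ _ in wE rE; set B := dot _ (cross _ _) in wE rE.
have r0 : dot (killing x) (killing x) != 0 by rewrite dot_eq0.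
set r := dot (killing x) (killing x) in rE r0 *.
pose D t := 1 - eps ^+ 2 * circ_n A B t ^+ 2.
pose M := circ_m A B; pose N := circ_n A B.
have cM : continuous M := @continuous_circ_m _ A B.
have cN : continuous N := @continuous_circ_n _ A B.
have cDq (h : R -> R) : continuous h -> continuous (fun t => h t / D t).
  exact: (continuous_circ_quot w0 wE).
pose q11 := dot (hess g x (killing x)) (killing x).
pose q22 := dot (hess g x kap) kap.
pose q12 := dot (hess g x (killing x)) kap + dot (hess g x kap) (killing x).
have -> : circle_int (fun t => Q t * SV t ^+ 2) = circle_int (fun t =>
    q11 / r ^+ 2 * (M t ^+ 2 / D t) + - q12 / r ^+ 2 * (M t * N t / D t)
    + q22 / r ^+ 2 * (N t ^+ 2 / D t)).
  apply: eq_Rintegral => t _; rewrite /SV (fibre_SVE heps xx) -/A -/B -/(D t).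
  have hp := fibre_HS2 xx t; have [[xx' xv] vv] := hp.
  have vE : (fibre x t).2 = (M t / r) *: killing x + (- N t / r) *: kap.
    rewrite /kap (frame_cross_killing xx xv vv) -/(m (fibre x t)) -/(n (fibre x t)).
    rewrite {1}(frame_killingx xx xv vv) -/(m (fibre x t)) -/(n (fibre x t)).
    rewrite kz_m_fibre (kz_n_fibre xx) -/A -/B -/(M t) -/(N t).
    have h : M t ^+ 2 + N t ^+ 2 = r by rewrite circ_sqr.
    have h0 : M t ^+ 2 + N t ^+ 2 != 0 by rewrite h.
    by rewrite -h; apply: row3P; rewrite !mxE; field.
 rewrite /Q {1 2}vE hess_sym_expand -/q11 -/q22 -/q12.
  have D0 : D t != 0 := lt0r_neq0 (circ_D_gt0 w0 wE t).
  by move: (D t) D0 => d d0; field; rewrite d0 r0.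
have cMM := cDq _ (continuousMe cM cM).
have cMN := cDq _ (continuousMe cM cN).
have cNN := cDq _ (continuousMe cN cN).
rewrite (circle_intD (continuousDe (continuousZe cMM) (continuousZe cMN)) (continuousZe cNN)).
rewrite (circle_intD (continuousZe cMM) (continuousZe cMN)) !circle_intZ//.
rewrite (circle_int_mm w0 wE) (circle_int_mn w0 wE) (circle_int_nn w0 wE) rE.
have p0 : (pi : R) != 0 by rewrite gt_eqF// pi_gt0.
rewrite -/q11 -/q22.
move: (pi : R) p0 => P p0.
have w1 : w x != 0 by rewrite gt_eqF.
have w2 : 1 + w x != 0 by rewrite gt_eqF// addr_gt0.
by field; rewrite p0 r0 w1 w2.
Qed.

End LaplacianFormula.

(** * The linear eigenfunctions *)

Section Smooth.
Variable R : realType.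
Local Notation V := 'rV[R]_3.

Lemma near_eq_differentiable (f g : V -> R) (x : V) :
  (\forall y \near x, f y = g y) -> differentiable f x -> differentiable g x.
Proof.
move=> fg df; have [cd E] := (diff_locallyP x f).1 df.
have fgx : f x = g x := nbhs_singleton fg.
have N : \forall h \near (0 : V), f (h + x) = g (h + x).
  by have := fg; rewrite (near_shift 0) subr0.
have E' : g \o shift x = cst (g x) + 'd f x +o_ (0:V) id.
  apply/eqaddoP => e e0; have H := (eqaddoP _ _ _ _).1 E e e0.
  near=> h; have h1 : f (h + x) = g (h + x) by near: h.
  have : `|(f \o shift x - (cst (f x) + 'd f x)) h| <= e * `|h| by near: h; exact: H.
  by rewrite !fctE /= h1 fgx.
apply/diff_locallyP; rewrite (diff_unique cd E'); split => //.
Unshelve. all: by end_near. Qed.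

Lemma open_neq0 (x : V) : x != 0 -> \forall y \near x, y != 0.
Proof.
rewrite -normr_gt0 => x0; near=> y; rewrite -normr_gt0; near: y.
exact: (cvgr_gt _ (@norm_continuous _ V x) _ x0).
Unshelve. all: by end_near. Qed.

(* A class of functions containing x |-> <l, x / |x| > and closed under
   directional derivatives, so that all of its members are smooth off 0. *)
Inductive sphere_expr :=
  | SCoord of 'I_3 | SCst of R | SInv
  | SAdd of sphere_expr & sphere_expr | SMul of sphere_expr & sphere_expr.

Fixpoint seval (e : sphere_expr) (x : V) : R :=
  match e with
  | SCoord i => x 0 i
  | SCst a => a
  | SInv => (enorm x)^-1
  | SAdd e1 e2 => seval e1 x + seval e2 x
  | SMul e1 e2 => seval e1 x * seval e2 x
  end.

Definition sdot (v : V) : sphere_expr :=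
  SAdd (SAdd (SMul (SCst (v 0 0)) (SCoord 0)) (SMul (SCst (v 0 1)) (SCoord 1)))
       (SMul (SCst (v 0 2)) (SCoord 2)).

Lemma seval_sdot v x : seval (sdot v) x = dot v x.
Proof. by rewrite dotE. Qed.

Fixpoint sder (v : V) (e : sphere_expr) : sphere_expr :=
  match e with
  | SCoord i => SCst (v 0 i)
  | SCst _ => SCst 0
  | SInv => SMul (SMul (SCst (-1)) (sdot v)) (SMul SInv (SMul SInv SInv))
  | SAdd e1 e2 => SAdd (sder v e1) (sder v e2)
  | SMul e1 e2 => SAdd (SMul (sder v e1) e2) (SMul e1 (sder v e2))
  end.

Lemma differentiable_seval e x : x != 0 -> differentiable (seval e) x.
Proof.
move=> x0; elim: e => [i|a||e1 h1 e2 h2|e1 h1 e2 h2] /=.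
- exact: differentiable_coord.
- exact: differentiable_cst.
- have dd : differentiable (fun x : V => dot x x) x.
    have -> : (fun x : V => dot x x) = (fun x : V => x 0 0 * x 0 0 + x 0 1 * x 0 1 + x 0 2 * x 0 2).
      by apply/funext => y; rewrite dotE.
    have c i : differentiable (fun x : V => x 0 i) x by exact: differentiable_coord.
    exact: (differentiableD (differentiableD (differentiableM (c 0) (c 0))
      (differentiableM (c 1) (c 1))) (differentiableM (c 2) (c 2))).
  have ds : differentiable (@Num.sqrt R) (dot x x).
    by have [/derivable1_diffP] : is_derive (dot x x) 1 (@Num.sqrt R) _ :=
      is_derive1_sqrt (etrans (dot_gt0 x) x0).
  have de : differentiable (@enorm R) x := differentiable_comp dd ds.
  by apply: (differentiableV de); rewrite gt_eqF// enorm_gt0.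
- exact: differentiableD h1 h2.
- exact: differentiableM h1 h2.
Qed.

Lemma derive_seval v e x : x != 0 -> 'D_v (seval e) x = seval (sder v e) x.
Proof.
move=> x0; apply: derive_val; apply/is_derive_line.
have E0 : 0 *: v + x = x by rewrite scale0r add0r.
have hl := is_derive_affine x v 0.
elim: e => [i|a||e1 h1 e2 h2|e1 h1 e2 h2].
- exact: (is_derive_curveP _ _ _).1 hl i.
- exact: is_derive_cste.
- have hx : 0 *: v + x != 0 by rewrite E0.
  apply: (is_derive_cast (is_derive_enormV hx hl)) => [//|].
  rewrite E0 -[RHS]/(-1 * seval (sdot v) x * ((enorm x)^-1 * ((enorm x)^-1 * (enorm x)^-1))).
  by rewrite seval_sdot (dotC v) -exprVn; ring.
- exact: is_deriveDe h1 h2.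
- apply: (is_derive_cast (is_deriveMe h1 h2)) => [//|].
  by rewrite E0.
Qed.

(** The induction runs over all functions that agree with an expression off 0, since [derive_seval]
    identifies directional derivatives only there. *)
Lemma Ck_on_seval e n (h : V -> R) : (forall x, x != 0 -> h x = seval e x) ->
  Ck_on n [set x | x != 0] h.
Proof.
elim: n e h => [|n IH] e h hE.
  move=> x x0; apply: differentiable_continuous.
  apply: (near_eq_differentiable _ (differentiable_seval e x0)).
  by near=> y; rewrite hE//; near: y; exact: open_neq0.
split=> [x x0|v].
  apply: (near_eq_differentiable _ (differentiable_seval e x0)).
  by near=> y; rewrite hE//; near: y; exact: open_neq0.
(* [near_eq_derive] needs a nonzero direction. *)
have [->|v0] := eqVneq v 0.
  apply: (IH (SCst 0)) => x x0; exact: derive0.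
apply: (IH (sder v e)) => x x0; rewrite -derive_seval//.
apply: near_eq_derive => //.
by near=> y; rewrite hE//; near: y; exact: open_neq0.
Unshelve. all: by end_near. Qed.

Lemma smooth_linear (l : V) : smooth_S2 (dot l).
Proof.
move=> n; apply: (@Ck_on_seval (SMul SInv (sdot l))) => x x0.
by rewrite -[RHS]/((enorm x)^-1 * seval (sdot l) x) seval_sdot /= /unitv dotZr.
Qed.

End Smooth.

Section LinearFunctions.
Variable R : realType.
Local Notation V := 'rV[R]_3.
Variables (l x : V).
Hypothesis xx : S2 x.
Let g := dot l \o @unitv R.
Let g2 : twice_differentiable g := smooth_S2_twice (smooth_linear l).

Lemma grad_linear v : dot x v = 0 -> dot (grad g x) v = dot l v.
Proof.
move=> xv; have x0 := unitv_neq0 xx.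
rewrite -derive_grad; last exact: g2.1.
apply: derive_val; apply/is_derive_line.
have E0 : 0 *: v + x = x by rewrite scale0r add0r.
have hl := is_derive_affine x v 0; have hx : 0 *: v + x != 0 by rewrite E0.
apply: (is_derive_cast (is_derive_dot (is_derive_cste l (0:R) (1:R)) (is_derive_unitv hx hl))) => [//|].
by rewrite E0 xv mul0r scale0r subr0 enorm1// invr1 scale1r dot0l add0r.
Qed.

(** To second order in h, x + h v normalised is x + h v - (h^2 / 2) |v|^2 x. *)
Lemma hess_linear v : dot x v = 0 -> dot (hess g x v) v = - dot v v * dot l x.
Proof.
move=> xv; have x0 := unitv_neq0 xx.
rewrite -derive2E//; apply: derive_val; apply/is_derive_line.
have E0 : 0 *: v + x = x by rewrite scale0r add0r.
have hl := is_derive_affine x v 0; have hx : 0 *: v + x != 0 by rewrite E0.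
pose D y := dot l v * (enorm y)^-1 -
  (dot y v * ((enorm y)^-1 * ((enorm y)^-1 * (enorm y)^-1))) * dot l y.
have gD y : y != 0 -> 'D_v g y = D y.
  move=> y0; apply: derive_val; apply/is_derive_line.
  have F0 : 0 *: v + y = y by rewrite scale0r add0r.
  have hly := is_derive_affine y v 0; have hy : 0 *: v + y != 0 by rewrite F0.
  apply: (is_derive_cast (is_derive_dot (is_derive_cste l (0:R) (1:R)) (is_derive_unitv hy hly))) => [//|].
  by rewrite F0 /D !dotlin -exprVn; ring.
have N : \forall h \near (0:R), D (h *: v + x) = 'D_v g (h *: v + x).
  near=> h; rewrite gD//; near: h; exact: (near_neq0 hl hx).
apply: (near_eq_is_derive N).
have he := is_derive_enormV hx hl.
have cs (W : normedModType R) (r : W) := is_derive_cste r (0:R) (1:R).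
have hv := is_derive_dot hl (cs _ v).
have hL := is_derive_dot (cs _ l) hl.
apply: (is_derive_cast (is_deriveBe (is_deriveMe (cs _ (dot l v)) he)
  (is_deriveMe (is_deriveMe hv (is_deriveMe he (is_deriveMe he he))) hL))) => [//|].
by rewrite E0 xv enorm1// invr1 !dotlin; ring.
Unshelve. all: by end_near. Qed.

End LinearFunctions.

Section SecondDerivativeTest.
Variable R : realType.

(** If d < 0 then u1 is negative just to the right of 0, and by the mean value theorem u drops below
    u 0. *)
Lemma second_derivative_test (u u1 : R -> R) (d : R) :
  (\forall h \near (0:R), is_derive (h : R) 1 u (u1 h)) ->
  is_derive (0:R) 1 u1 d ->
  (\forall h \near (0:R), u 0 <= u h) -> u1 0 = 0 /\ 0 <= d.
Proof.
move=> du du1 umin.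
have [r /= r0 hr] : exists2 r : R, 0 < r & forall h : R, `|h| < r ->
    is_derive h 1 u (u1 h) /\ u 0 <= u h.
  have [r /= r0 hr] : \forall h \near (0:R), is_derive (h : R) 1 u (u1 h) /\ u 0 <= u h.
    by near=> h; split; near: h.
  by exists r => // h hh; apply: hr; rewrite /= sub0r normrN.
have u10 : u1 0 = 0.
  have [_ <-] : is_derive (0:R) 1 u (u1 0) by have [] := hr 0; rewrite ?normr0.
  have [] // := @derive1_at_min R u (- r) r 0 _ _ _ _.
  - lra.
  - move=> t; rewrite in_itv/= -ltr_norml => ht.
    by have [[]] := hr t ht.
  - by rewrite in_itv/=; apply/andP; split; lra.
  - by move=> t; rewrite in_itv/= -ltr_norml => ht; have [] := hr t ht.
split => //; rewrite leNgt; apply/negP => d0.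
have [du1' dE] := du1.
have c1 : h^-1 * u1 h @[h --> (0:R)^'] --> d.
  have -> : (fun h => h^-1 * u1 h) =
      (fun h : R => h^-1 *: ((u1 \o shift (0:R)) (h *: (1:R)) - u1 0)).
    by apply/funext => h; rewrite /= addr0 u10 subr0 [_%:A]mulr1.
  by rewrite -dE; exact: du1'.
have [s /= s0 hs] : \forall h \near (0:R)^', h^-1 * u1 h < 0 by exact: (cvgr_lt _ c1).
pose h := Num.min r s / 2.
have h0 : 0 < h by rewrite divr_gt0// lt_min r0 s0.
have hlt : h < r /\ h < s.
  have := lt_min 0 r s; rewrite /h; have : Num.min r s <= r by rewrite ge_min lexx.
  have : Num.min r s <= s by rewrite ge_min lexx orbT.
  by rewrite r0 s0 => *; split; lra.
have dh t : t \in `]0, h[%R -> is_derive t 1 u (u1 t).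
  rewrite in_itv/= => /andP[t0 th]; have tr : `|t| < r by rewrite gtr0_norm//; lra.
  by have [] := hr t tr.
have ch : {within `[0, h], continuous u}.
  apply: derivable_within_continuous => t; rewrite in_itv/= => /andP[t0 th].
  have tr : `|t| < r by rewrite ger0_norm//; lra.
  by have [[]] := hr t tr.
have [c] := MVT h0 dh ch.
rewrite in_itv/= subr0 => /andP[t0 th] cE.
have uh : 0 <= u h - u 0.
  have hr' : `|h| < r by rewrite gtr0_norm//; lra.
  by rewrite subr_ge0; have [] := hr h hr'.
have hc : c^-1 * u1 c < 0.
  apply: hs; last by rewrite gt_eqF.
  by rewrite /= sub0r normrN gtr0_norm//; lra.
have : u1 c < 0 by move: hc; rewrite pmulr_rlt0// invr_gt0.
by rewrite cE in uh => uc; have := mulr_ge0 (ltW h0) uh; nra.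
Unshelve. all: by end_near. Qed.

End SecondDerivativeTest.

Section EigenFunction.
Variable R : realType.
Local Notation V := 'rV[R]_3.
Variables (eps : R) (F : V * V -> R).
Hypotheses (heps : 0 <= eps < 1) (hF : katok_ziller eps F).
Local Notation w := (kz_w eps).

Lemma cross_killingE (x : V) : dot x x = 1 -> cross x (killing x) = vec3 0 0 1 - x 0 2 *: x.
Proof.
rewrite dotE => xx; apply: row3P; rewrite !(vec3E, mxE); [ring|ring|].
by rewrite -xx; ring.
Qed.

(** The Hessian takes the value - <l, x> in every unit direction, so the circle average contributes
    - 2 w^2 <l, x>. As l is horizontal, the first-order term adds 2 eps^2 x_2^2 <l, x>, and the
    dependence on latitude cancels. *)
Lemma finsler_laplace_linear (l x : V) : l 0 2 = 0 -> S2 x ->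
  finsler_laplace F (dot l) x = - (2 - 2 * eps ^+ 2) * dot l x.
Proof.
move=> l2 xx; have w0 := kz_w_gt0 heps xx.
rewrite (finsler_laplace_circle heps hF (smooth_S2_twice (smooth_linear l)) xx).
rewrite grad_linear//; last exact: dot_cross_l.
have p0 : (pi : R) != 0 by rewrite gt_eqF// pi_gt0.
rewrite (_ : Rintegral _ _ _ = - dot l x * (2 * pi / w x)).
  rewrite cross_killingE// !dotlin (_ : dot l (vec3 0 0 1) = 0); last first.
    by rewrite dotE !vec3E l2; ring.
  have wE : w x ^+ 2 = 1 - eps ^+ 2 * (1 - x 0 2 ^+ 2).
    by rewrite (kz_w_sqr heps xx) /kz_k dot_killing_sqr.
  move: (pi : R) p0 => P p0.
  transitivity (- 2 * w x ^+ 2 * dot l x + 2 * eps ^+ 2 * x 0 2 ^+ 2 * dot l x).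
    by field; rewrite p0 gt_eqF.
  by rewrite wE; ring.
rewrite -(fibre_int_SV heps xx) -circle_intZ; last first.
  by have c := continuous_fibre_SV xx heps; exact: (continuousMe c c).
apply: eq_Rintegral => t _; have [[_ xv] vv] := fibre_HS2 xx t.
by rewrite (hess_linear l xx xv) vv mulN1r.
Qed.

Lemma laplace_eigenvalue_linear : laplace_eigenvalue F (2 - 2 * eps ^+ 2).
Proof.
exists (dot (vec3 1 0 0)); split; first exact: smooth_linear.
  exists (vec3 1 0 0); first by rewrite /S2/= dotE !vec3E; ring.
  by rewrite (_ : dot _ _ = 1) ?oner_neq0// dotE !vec3E; ring.
by move=> x xx; rewrite finsler_laplace_linear ?vec3E// mulNr opprK.
Qed.

End EigenFunction.

(** * Eigenfunctions below the first eigenvalue *)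

Section Reflection.
Variable R : realType.
Local Notation V := 'rV[R]_3.
Variable n : V.
Hypotheses (n2 : n 0 2 = 0) (nn : dot n n = 1).

Definition refl (x : V) : V := x - (2 * dot n x) *: n.

Lemma dot_refl x y : dot (refl x) (refl y) = dot x y.
Proof. by rewrite /refl !dotlin nn (dotC x n); ring. Qed.

Lemma dotn_refl x : dot n (refl x) = - dot n x.
Proof. by rewrite /refl !dotlin nn; ring. Qed.

Lemma refl_invol x : refl (refl x) = x.
Proof. by rewrite {1}/refl dotn_refl /refl; apply: row3P; rewrite !mxE; ring. Qed.

Lemma refl_neq0 x : x != 0 -> refl x != 0.
Proof. by rewrite -!dot_gt0 dot_refl. Qed.

Lemma unitv_refl x : unitv (refl x) = refl (unitv x).
Proof.
rewrite /unitv /enorm dot_refl; set a := _^-1.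
by rewrite /refl !dotlin; apply: row3P; rewrite !mxE; ring.
Qed.

Lemma refl_2 x : refl x 0 2 = x 0 2.
Proof. by rewrite !mxE n2; ring. Qed.

Lemma S2_refl x : S2 x -> S2 (refl x).
Proof. by rewrite /S2/= dot_refl. Qed.

Let nn2 : n 0 0 ^+ 2 + n 0 1 ^+ 2 = 1.
Proof. by rewrite -nn dotE n2; ring. Qed.

(** A reflection reverses the sense of rotation. The sign disappears in [laplace_refl], where K
    enters quadratically. *)
Lemma killing_refl x : killing (refl x) = - refl (killing x).
Proof.
apply: row3P; rewrite /refl !(vec3E, mxE) !dotE !vec3E n2.
- apply/eqP; rewrite -subr_eq0 [X in X == 0](_ : _ = 2 * x 0 1 * (n 0 0 ^+ 2 + n 0 1 ^+ 2 - 1)).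
    by rewrite nn2 subrr mulr0.
  by ring.
- apply/eqP; rewrite -subr_eq0 [X in X == 0](_ : _ = 2 * x 0 0 * (1 - (n 0 0 ^+ 2 + n 0 1 ^+ 2))).
    by rewrite nn2 subrr mulr0.
  by ring.
- by ring.
Qed.

Lemma cross_killing_refl x : dot x x = 1 ->
  cross (refl x) (killing (refl x)) = refl (cross x (killing x)).
Proof.
move=> xx; rewrite !cross_killingE ?dot_refl// refl_2.
rewrite /refl !dotlin (_ : dot n (vec3 0 0 1) = 0); last by rewrite dotE !vec3E n2; ring.
by apply: row3P; rewrite !mxE; ring.
Qed.

Lemma is_derive_refl (y : R -> V) (t : R) (y' : V) :
  is_derive t 1 y y' -> is_derive t 1 (fun h => refl (y h)) (refl y').
Proof.
move=> hy; have cs (W : normedModType R) (r : W) := is_derive_cste r t (1:R).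
apply: (is_derive_cast (is_deriveBe hy (is_derive_scalee
  (is_deriveMe (cs _ (2:R)) (is_derive_dot (cs _ n) hy)) (cs _ n)))) => [//|].
by rewrite /refl dot0l; apply: row3P; rewrite !mxE; ring.
Qed.

End Reflection.

Section Comparison.
Local Opaque refl.
Variable R : realType.
Local Notation V := 'rV[R]_3.
Variable n : V.
Hypotheses (n2 : n 0 2 = 0) (nn : dot n n = 1).
Local Notation refl := (refl n).

(* d > 0 makes it positive on the boundary <n, x> = 0 of the hemisphere; for K
   large, - d K <n, x>^2 makes it a strict supersolution. *)
Definition barrier (d K : R) (x : V) : R := dot n x + d * (1 - K * dot n x ^+ 2).

Variables (f : V -> R).
Let g := f \o @unitv R.
Hypothesis g2 : twice_differentiable g.
Variables (d K M : R) (p : V).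
Hypotheses (pp : S2 p) (np : 0 < dot n p).
Hypothesis contact : M * barrier d K p - (f p - f (refl p)) = 0.
Hypothesis above : forall x, S2 x -> 0 <= dot n x ->
  0 <= M * barrier d K x - (f x - f (refl x)).

(* First and second order conditions at p for the nonnegative function
   M * barrier - (f - f \o refl) on the hemisphere, which vanishes at p. *)
Lemma contact_direction (v : V) : dot p v = 0 ->
  M * (dot n v * (1 - 2 * d * K * dot n p)) - dot (grad g p) v
    + dot (grad g (refl p)) (refl v) = 0 /\
  0 <= M * (- dot v v * dot n p * (1 - 2 * d * K * dot n p) - 2 * d * K * dot n v ^+ 2)
    - dot (hess g p v) v + dot (hess g (refl p) (refl v)) (refl v).
Proof.
move=> pv; have E0 : 0 *: v + p = p by rewrite scale0r add0r.
pose l (h : R) := h *: v + p.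
have l0 : l 0 = p by exact: E0.
pose yy := dot n \o @unitv R.
have yy2 : twice_differentiable yy := smooth_S2_twice (smooth_linear n).
have hl (h : R) : is_derive h 1 l v by exact: is_derive_affine.
have hr (h : R) : is_derive h 1 (fun h => refl (l h)) (refl v) by exact: is_derive_refl.
have lp : l 0 != 0 by rewrite l0 unitv_neq0.
have rp : refl (l 0) != 0 by rewrite refl_neq0.
have N1 := near_neq0 (hl 0) lp.
have hn := is_derive_dot (is_derive_cste n (0:R) (1:R)) (hl 0).
(* Positivity of <n, p> keeps the normalised line inside the hemisphere for small h, so [above]
   applies along it. *)
have N2 : \forall h \near (0:R), 0 < dot n (l h).
  have := is_derive_continuous hn => c.
  by apply: (cvgr_gt _ c); rewrite l0.
pose Y h := yy (l h); pose Y1 h := 'D_v yy (l h).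
have dY (h : R) : l h != 0 -> is_derive h 1 Y (Y1 h).
  move=> lh; rewrite /Y1 derive_grad; last exact: yy2.1.
  exact: (is_derive_grad (yy2.1 _ lh) (hl h)).
have [q1 q1E] : exists q, q = dot (hess yy p v) v := ex_intro _ _ erefl.
have [q2 q2E] : exists q, q = dot (hess g p v) v := ex_intro _ _ erefl.
have [q3 q3E] : exists q, q = dot (hess g (refl p) (refl v)) (refl v) := ex_intro _ _ erefl.
have dY1 : is_derive (0:R) 1 Y1 q1.
  apply: (is_derive_eq (is_derive_directional yy2 lp (hl 0) (is_derive_cste v _ _))).
  rewrite l0 dot0r addr0; exact (esym q1E).
have dg1 : is_derive (0:R) 1 (fun h => 'D_v g (l h)) q2.
  apply: (is_derive_eq (is_derive_directional g2 lp (hl 0) (is_derive_cste v _ _))).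
  rewrite l0 dot0r addr0; exact (esym q2E).
have dg2 : is_derive (0:R) 1 (fun h => 'D_(refl v) g (refl (l h))) q3.
  apply: (is_derive_eq (is_derive_directional g2 rp (hr 0) (is_derive_cste (refl v) _ _))).
  rewrite l0 dot0r addr0; exact (esym q3E).
pose u h := M * (Y h + d * (1 - K * Y h ^+ 2)) - (g (l h) - g (refl (l h))).
pose u1 h := M * (Y1 h * (1 - 2 * d * K * Y h))
  - ('D_v g (l h) - 'D_(refl v) g (refl (l h))).
have Yp : Y 0 = dot n p by rewrite /Y /yy l0 /= unitv1.
have Y1p : Y1 0 = dot n v.
  by rewrite /Y1 l0 derive_grad ?(grad_linear n pp pv)//; exact: yy2.1 (unitv_neq0 pp).
have cs (r : R) (h : R) := is_derive_cste r h (1:R).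
have du : \forall h \near (0:R), is_derive (h:R) 1 u (u1 h).
  near=> h; have lh : l h != 0 by near: h; exact: N1.
  have rh : refl (l h) != 0 by rewrite refl_neq0.
  have d1 := is_derive_grad (g2.1 _ lh) (hl h).
  have d2 := is_derive_grad (g2.1 _ rh) (hr h).
  rewrite -derive_grad in d1; last exact: g2.1.
  rewrite -derive_grad in d2; last exact: g2.1.
  have D : is_derive h 1 u _ := is_deriveBe (is_deriveMe (cs M h) (is_deriveDe (dY h lh)
    (is_deriveMe (cs d h) (is_deriveBe (cs 1 h) (is_deriveMe (cs K h)
      (is_derive_sqr (dY h lh))))))) (is_deriveBe d1 d2).
  apply: (is_derive_eq D); rewrite /u1.
  move: ('D_v g (l h)) ('D_(refl v) g (refl (l h))) (Y h) (Y1 h) => D1 D2 y y1.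
  by ring.
have du1 : is_derive (0:R) 1 u1
    (M * (q1 * (1 - 2 * d * K * dot n p) - 2 * d * K * dot n v ^+ 2) - (q2 - q3)).
  have D : is_derive (0:R) 1 u1 _ := is_deriveBe (is_deriveMe (cs M 0) (is_deriveMe dY1
    (is_deriveBe (cs 1 0) (is_deriveMe (cs (2 * d * K) 0) (dY 0 lp))))) (is_deriveBe dg1 dg2).
  by apply: (is_derive_eq D); rewrite Yp Y1p; ring.
have umin : \forall h \near (0:R), u 0 <= u h.
  near=> h; have -> : u 0 = 0.
    rewrite /u Yp l0 -[RHS]contact /barrier /g /=.
    by rewrite !unitv_refl// !unitv1.
  have lh : l h != 0 by near: h; exact: N1.
  have nh : 0 < dot n (l h) by near: h; exact: N2.
  have := above (dot_unitv lh); rewrite /u /Y /yy /g /= unitv_refl//; apply.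
  by rewrite dotZr mulr_ge0 ?ltW// invr_gt0 enorm_gt0.
have [h1 h2] := second_derivative_test du du1 umin.
split.
  rewrite -[RHS]h1 /u1 Yp Y1p l0 -!derive_grad.
  - by rewrite opprB addrA addrAC.
  - by apply: g2.1; rewrite refl_neq0// unitv_neq0.
  - exact: g2.1 (unitv_neq0 pp).
rewrite (hess_linear n pp pv) in q1E.
by subst q1 q2 q3; move: h2; rewrite opprB addrA addrAC.
Unshelve. all: by end_near. Qed.

End Comparison.

Section Hemisphere.
Variable R : realType.
Local Notation V := 'rV[R]_3.
Variable n : V.

Lemma continuous_dotl : continuous (dot n).
Proof.
move=> x; have E : dot n = (fun y : V => n 0 0 * y 0 0 + n 0 1 * y 0 1 + n 0 2 * y 0 2).
  by apply/funext => y; rewrite dotE.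
rewrite E; have c i := @coord_continuous R 1 3 0 i x.
exact: (cvgD (cvgD (cvgM (@cvg_cst _ _ _ _ _) (c 0)) (cvgM (@cvg_cst _ _ _ _ _) (c 1)))
  (cvgM (@cvg_cst _ _ _ _ _) (c 2))).
Qed.

Lemma continuous_dot_self : continuous (fun x : V => dot x x).
Proof.
move=> x; have E : (fun x : V => dot x x) =
    (fun y : V => y 0 0 * y 0 0 + y 0 1 * y 0 1 + y 0 2 * y 0 2).
  by apply/funext => y; rewrite dotE.
rewrite E; have c i := @coord_continuous R 1 3 0 i x.
exact: (cvgD (cvgD (cvgM (c 0) (c 0)) (cvgM (c 1) (c 1))) (cvgM (c 2) (c 2))).
Qed.

Lemma continuous_refl : continuous (refl n).
Proof.
move=> x; exact: (cvgB cvg_id (cvgZr_tmp (cvgM (@cvg_cst _ _ _ _ _) (@continuous_dotl x)))).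
Qed.

Definition hemisphere : set V := [set x | S2 x /\ 0 <= dot n x].

Lemma compact_hemisphere : compact hemisphere.
Proof.
apply: (@subclosed_compact _ _ [set v : V | forall i, `[(-1)%R, 1%R]%classic (v ord0 i)]).
- have -> : hemisphere = (fun x : V => dot x x) @^-1` [set r | r = 1]
      `&` dot n @^-1` [set r | 0 <= r] by apply/seteqP; split.
  apply: closedI.
    apply: preimage_closed; last exact: closed_eq.
    by move=> x _; exact: continuous_dot_self.
  apply: preimage_closed; last exact: closed_ge.
  by move=> x _; exact: continuous_dotl.
- apply: (@rV_compact R 3 (fun=> `[(-1)%R, 1%R]%classic)) => _.
  exact: segment_compact.
- move=> x [xx _] i; rewrite /= in_itv/= -ler_norml.
  rewrite -(@expr_le1 _ 2)// real_normK ?num_real//.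
  rewrite -[leRHS]xx /dot (bigD1 i)//= -expr2 lerDl sumr_ge0// => j _.
  by rewrite -expr2 sqr_ge0.
Qed.

End Hemisphere.

Section MaximumPrinciple.
Variable R : realType.
Local Notation V := 'rV[R]_3.
Variables (eps : R) (F : V * V -> R).
Hypotheses (heps : 0 <= eps < 1) (hF : katok_ziller eps F).
Local Notation w := (kz_w eps).
Variable n : V.
Hypotheses (n2 : n 0 2 = 0) (nn : dot n n = 1).
Local Notation refl := (refl n).

Lemma dot_le1 (x : V) : dot x x = 1 -> dot n x ^+ 2 <= 1.
Proof.
by move=> xx; have := dot_ge0 (cross n x); rewrite dot_cross_sqr xx nn mulr1 subr_ge0.
Qed.

(** K and x /\ K are orthogonal of equal length, so this is Pythagoras for the tangential part of n,
    of squared length 1 - <n, x>^2. *)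
Lemma horizontal_gradient (x : V) : dot x x = 1 ->
  dot n (killing x) ^+ 2 + dot n (cross x (killing x)) ^+ 2 =
  dot (killing x) (killing x) * (1 - dot n x ^+ 2).
Proof.
move=> xx; rewrite cross_killingE// !dotlin (_ : dot n (vec3 0 0 1) = 0); last first.
  by rewrite dotE !vec3E n2; ring.
have h : dot n x ^+ 2 + dot n (killing x) ^+ 2 = dot (killing x) (killing x).
  transitivity (dot n n * (x 0 0 ^+ 2 + x 0 1 ^+ 2)).
    by rewrite !dotE !vec3E n2; ring.
  by rewrite nn mul1r dot_killing_coord.
have := dot_killing_sqr xx; rewrite -h => h2.
have -> : dot n (killing x) ^+ 2 = 1 - x 0 2 ^+ 2 - dot n x ^+ 2 by rewrite -h2; ring.
by ring.
Qed.

Lemma kz_w_le1 x : S2 x -> w x <= 1.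
Proof.
move=> xx; have w0 := ltW (kz_w_gt0 heps xx).
rewrite -(@expr_le1 _ 2)// (kz_w_sqr heps xx) /kz_k.
by rewrite lerBlDr lerDl mulr_ge0 ?sqr_ge0 ?dot_ge0.
Qed.

Lemma kz_w_sqr_ge x : S2 x -> 1 - eps ^+ 2 <= w x ^+ 2.
Proof.
move=> xx; rewrite (kz_w_sqr heps xx) /kz_k (dot_killing_sqr xx).
by rewrite mulrBr mulr1 opprB addrA addrAC lerDl mulr_ge0 ?sqr_ge0.
Qed.

Lemma kz_w_refl x : w (refl x) = w x.
Proof. by rewrite /kz_w /kz_k killing_refl// dotNl dotNr opprK dot_refl. Qed.

(** Ellipticity: the right-hand side is the principal symbol at the gradient of <n, x>. It bounds
    from below the gain from the quadratic term of the barrier. The estimate uses w <= 1 and w^2 >=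
    1 - eps^2. *)
Lemma horizontal_energy_ge x : S2 x -> killing x != 0 ->
  (1 - eps ^+ 2) ^+ 2 * (1 - dot n x ^+ 2) <=
  2 * w x ^+ 2 / (dot (killing x) (killing x) * (1 + w x)) *
   (w x * dot n (killing x) ^+ 2 + dot n (cross x (killing x)) ^+ 2).
Proof.
move=> xx kx; have r0 : 0 < dot (killing x) (killing x) by rewrite dot_gt0.
have w0 := kz_w_gt0 heps xx; have w1 := kz_w_le1 xx; have w2 := kz_w_sqr_ge xx.
have H := horizontal_gradient xx; have Y := dot_le1 xx.
have e1 := eps_sqr_lt1 heps.
move: r0 w0 w1 w2 H Y; set r := dot (killing x) _; set W := w x.
set a := dot n (killing x); set b := dot n (cross _ _); set y := dot n x.
move=> r0 w0 w1 w2 H Y.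
have B : W * (r * (1 - y ^+ 2)) <= W * a ^+ 2 + b ^+ 2.
  by rewrite -H; have := sqr_ge0 b; nra.
apply: (@le_trans _ _ (2 * W ^+ 2 / (r * (1 + W)) * (W * (r * (1 - y ^+ 2))))).
  have -> : 2 * W ^+ 2 / (r * (1 + W)) * (W * (r * (1 - y ^+ 2))) =
      (2 / (1 + W)) * W ^+ 3 * (1 - y ^+ 2).
    by field; rewrite !gt_eqF// addr_gt0.
  apply: ler_wpM2r; first by rewrite subr_ge0.
  have h1 : 1 <= 2 / (1 + W) by rewrite ler_pdivlMr ?addr_gt0// mul1r; lra.
  have h2 : W ^+ 4 <= W ^+ 3 by rewrite exprSr ler_piMr// exprn_ge0// ltW.
  have h3 : (1 - eps ^+ 2) ^+ 2 <= W ^+ 4.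
    have -> : W ^+ 4 = (W ^+ 2) ^+ 2 by rewrite -exprM.
    by rewrite lerXn2r// nnegrE ?sqr_ge0// subr_ge0 ltW.
  apply: (le_trans h3); apply: (le_trans h2).
  by rewrite ler_peMl// exprn_ge0// ltW.
apply: ler_wpM2l => //.
by rewrite divr_ge0 ?mulr_ge0 ?exprn_ge0 ?ltW// addr_gt0.
Qed.

(** The arithmetic core, with y = <n, p>. Inserting the bound on T leaves 0 <= - (mu - la) y + d C
    y^2 - d, where C is the factor of d in the bound d C <= mu - la; since y^2 <= y, this forces d
    <= 0. *)
Lemma contact_absurd (mu la d K y T : R) :
  0 <= y -> y ^+ 2 <= 1 -> 0 < d -> 0 < K ->
  (1 - eps ^+ 2) ^+ 2 * (1 - y ^+ 2) <= T ->
  1 <= 2 * K * (1 - eps ^+ 2) ^+ 2 - la ->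
  0 <= K * (2 * (1 - eps ^+ 2) ^+ 2 + 2 * mu - la) ->
  d * (K * (2 * (1 - eps ^+ 2) ^+ 2 + 2 * mu - la)) <= mu - la ->
  0 <= - (1 - 2 * d * K * y) * mu * y - 2 * d * K * T + la * (y + d * (1 - K * y ^+ 2)) ->
  False.
Proof.
set c0 := (1 - eps ^+ 2) ^+ 2; set C := K * _ => y0 y1 d0 K0 TE hK C0 dC h.
have hT : 2 * d * K * (c0 * (1 - y ^+ 2)) <= 2 * d * K * T by rewrite ler_pM2l// !mulr_gt0.
have yy : y ^+ 2 <= y.
  have : y <= 1 by rewrite -(@expr_le1 _ 2).
  by move=> hy; rewrite expr2 ler_piMr.
have h1 : - (mu - la) * y + d * (C * y ^+ 2 - (2 * K * c0 - la)) >= 0.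
  rewrite (le_trans h)// /C.
  rewrite -subr_ge0 (_ : _ - _ = 2 * d * K * T - 2 * d * K * (c0 * (1 - y ^+ 2))) ?subr_ge0//.
  by ring.
have h2 : d * (2 * K * c0 - la) >= d by rewrite ler_peMr// ltW.
have h3 : d * C * y ^+ 2 <= (mu - la) * y.
  apply: (@le_trans _ _ (d * C * y)).
    by rewrite ler_wpM2l// mulr_ge0// ltW.
  by rewrite ler_wpM2r.
have : d <= 0 by move: h1 h2 h3; rewrite mulrBr mulrA; lra.
by rewrite leNgt d0.
Qed.

(** The second-order conditions along K and x /\ K are added with the nonnegative coefficients of
    the Laplacian, and the first-order condition along x /\ K handles the drift; the eigenvalue
    equations at p and its mirror image then remove all derivatives of f. *)
Lemma contact_sum (M A1 A2 A3 qK rK qk rk Dk Dr co W z e la fp fr : R) :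
  0 <= M * A1 - qK + rK -> 0 <= M * A2 - qk + rk -> M * A3 - Dk + Dr = 0 ->
  0 <= co -> 0 <= W ->
  - (co * (W * qK + qk) - 2 * e * z * Dk) = la * fp ->
  - (co * (W * rK + rk) - 2 * e * z * Dr) = la * fr ->
  0 <= M * (co * (W * A1 + A2) - 2 * e * z * A3) + la * (fp - fr).
Proof.
move=> h1 h2 h3 co0 W0 ep er; rewrite [la * _]mulrBr -ep -er.
have -> : Dk = M * A3 + Dr by move: h3; lra.
rewrite (_ : _ + _ = co * (W * (M * A1 - qK + rK) + (M * A2 - qk + rk))); last by ring.
by rewrite mulr_ge0// addr_ge0// mulr_ge0.
Qed.

(** Written in the reflected frame of x, so that the derivatives at the mirror point match those in
    [contact_direction]. *)
Lemma laplace_refl (f : V -> R) (x : V) : twice_differentiable (f \o @unitv R) ->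
  S2 x -> killing x != 0 ->
  finsler_laplace F f (refl x) =
  2 * w x ^+ 2 / (dot (killing x) (killing x) * (1 + w x))
    * (w x * dot (hess (f \o @unitv R) (refl x) (refl (killing x))) (refl (killing x))
       + dot (hess (f \o @unitv R) (refl x) (refl (cross x (killing x))))
          (refl (cross x (killing x))))
  - 2 * eps ^+ 2 * x 0 2 * dot (grad (f \o @unitv R) (refl x)) (refl (cross x (killing x))).
Proof.
move=> g2 xx kx; have kx' : killing (refl x) != 0.
  by rewrite killing_refl// oppr_eq0 refl_neq0.
rewrite (finsler_laplace_offpole heps hF g2 (S2_refl nn xx) kx').
rewrite kz_w_refl refl_2// cross_killing_refl// killing_refl//.
rewrite -[- refl _]scaleN1r hessZ !dotZl !dotZr !mulN1r !opprK dot_refl//.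
Qed.

Variables (f : V -> R) (la : R).
Hypothesis fs : smooth_S2 f.
Hypothesis fl : forall x, S2 x -> - finsler_laplace F f x = la * f x.
Hypothesis la_lt : la < 2 - 2 * eps ^+ 2.

Lemma eigenfunction_le_reflection x : S2 x -> 0 <= dot n x -> f x <= f (refl x).
Proof.
move=> xx nx; rewrite leNgt; apply/negP => fx.
have e1 := eps_sqr_lt1 heps.
pose mu := 2 - 2 * eps ^+ 2; have lamu : la < mu := la_lt.
pose c0 := (1 - eps ^+ 2) ^+ 2.
have c0gt : 0 < c0 by rewrite exprn_gt0// subr_gt0.
(* Chosen so that 2 K c0 = |la| + 1, which exceeds la by at least 1 whatever its sign. *)
pose K := (`|la| + 1) / (2 * c0).
have la1 : 0 < `|la| + 1 by have := normr_ge0 la; lra.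
have K0 : 0 < K by apply: divr_gt0 => //; exact: mulr_gt0.
have hK : 1 <= 2 * K * c0 - la.
  rewrite (_ : 2 * K * c0 = `|la| + 1); last by rewrite /K; field; rewrite gt_eqF.
  by have := ler_norm la; lra.
pose C := K * (2 * c0 + 2 * mu - la).
have mu0 : 0 < mu by rewrite /mu; lra.
have C0 : 0 < C by rewrite mulr_gt0//; lra.
(* Small enough for both d C <= mu - la, used in [contact_absurd], and d K <= 1, which keeps the
   barrier positive. *)
pose d := (mu - la) / (C + K * (mu - la)).
have ml : 0 < mu - la by rewrite subr_gt0.
have den : 0 < C + K * (mu - la) by rewrite addr_gt0// mulr_gt0.
have d0 : 0 < d by rewrite divr_gt0.
have dC : d * C <= mu - la.
  rewrite /d mulrAC ler_pdivrMr//; apply: ler_wpM2l; first exact: ltW.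
  by rewrite lerDl mulr_ge0// ltW.
have dK : d * K <= 1.
  by rewrite /d mulrAC ler_pdivrMr// mul1r mulrC lerDr ltW.
have psi0 y : S2 y -> 0 <= dot n y -> 0 < barrier n d K y.
  move=> yy ny; have y1 := dot_le1 yy; rewrite /barrier.
  have y2 : dot n y ^+ 2 <= dot n y.
    have : dot n y <= 1 by rewrite -(@expr_le1 _ 2).
    by move=> hy; rewrite expr2 ler_piMr.
  have : d * K * dot n y ^+ 2 <= dot n y ^+ 2 by rewrite ler_piMl// sqr_ge0.
  by lra.
pose g := f \o @unitv R.
have g2 : twice_differentiable g := smooth_S2_twice fs.
pose G y := (g y - g (refl y)) / barrier n d K y.
have cG : {within hemisphere n, continuous G}.
  apply: continuous_in_subspaceT => y; rewrite inE => -[yy ny].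
  have y0 := unitv_neq0 yy.
  have c1 : {for y, continuous g} by apply: differentiable_continuous; exact: g2.1.
  have c2 : {for y, continuous (g \o refl)}.
    apply: continuous_comp; first exact: continuous_refl.
    by apply: differentiable_continuous; apply: g2.1; exact: refl_neq0.
  have cn := @continuous_dotl _ n y.
  have b0 : barrier n d K y != 0 by rewrite gt_eqF// psi0.
  have cb : {for y, continuous (barrier n d K)}.
    exact: (cvgD cn (cvgM (@cvg_cst _ _ _ _ _) (cvgB (@cvg_cst _ _ _ _ _)
      (cvgM (@cvg_cst _ _ _ _ _) (cvgM cn cn))))).
  exact: (cvgM (cvgB c1 c2) (cvgV b0 cb)).
have [|p + pmax] := compact_EVT_max _ (@compact_hemisphere _ n) cG.
  by exists x.
rewrite inE => -[pp np].
pose M := G p.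
have gf y : S2 y -> g y = f y by move=> yy; rewrite /g /= unitv1.
have Gf y : S2 y -> G y = (f y - f (refl y)) / barrier n d K y.
  by move=> yy; rewrite /G !gf//; exact: S2_refl.
have M0 : 0 < M.
  apply: (@lt_le_trans _ _ (G x)); last by apply: pmax; rewrite inE.
  by rewrite Gf// divr_gt0 ?subr_gt0// psi0.
(* On the boundary p is its own mirror image, so the quotient vanishes there and its positive
   maximum lies inside. *)
have np0 : 0 < dot n p.
  rewrite lt_def np andbT; apply: contraTneq M0 => n0.
  have rp : refl p = p by rewrite /refl n0 mulr0 scale0r subr0.
  by rewrite /M Gf// rp subrr mul0r ltxx.
have contact : M * barrier n d K p - (f p - f (refl p)) = 0.
  by rewrite /M Gf// divfK ?subrr// gt_eqF// psi0.
have above y : S2 y -> 0 <= dot n y -> 0 <= M * barrier n d K y - (f y - f (refl y)).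
  move=> yy ny; rewrite subr_ge0 -ler_pdivrMr ?psi0// -Gf//.
  by apply: pmax; rewrite inE.
(* At a pole <n, p> = 0 because n is horizontal, so the contact point is not a pole and
   [finsler_laplace_offpole] applies. *)
have kp : killing p != 0.
  apply: contraTneq np0 => k0.
  have p1 : p 0 0 = 0 by have := congr1 (fun u : V => u 0 1) k0; rewrite vec3E mxE.
  have p2 : p 0 1 = 0.
    by have /eqP := congr1 (fun u : V => u 0 0) k0; rewrite vec3E mxE oppr_eq0 => /eqP.
  by rewrite dotE n2 p1 p2 !(mulr0, mul0r, addr0) ltxx.
have CD := contact_direction nn g2 pp np0 contact above.
have [_ cK] := CD (killing p) (dot_killing p).
have [eD ck] := CD (cross p (killing p)) (dot_cross_l _ _).
have w0 := kz_w_gt0 heps pp.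
have r0 : 0 < dot (killing p) (killing p) by rewrite dot_gt0.
have co : 0 <= 2 * w p ^+ 2 / (dot (killing p) (killing p) * (1 + w p)).
  by rewrite divr_ge0 ?mulr_ge0 ?exprn_ge0// ltW// addr_gt0.
have fp := fl pp; rewrite (finsler_laplace_offpole heps hF g2 pp kp) in fp.
have fr := fl (S2_refl nn pp); rewrite (laplace_refl g2 pp kp) in fr.
have := contact_sum cK ck eD co (ltW w0) fp fr.
have fM : f p - f (refl p) = M * barrier n d K p by apply/eqP; rewrite eq_sym -subr_eq0 contact.
rewrite fM.
have kk : dot (cross p (killing p)) (cross p (killing p)) = dot (killing p) (killing p).
  by rewrite dot_cross_sqr dot_killing pp; ring.
rewrite kk.
have nk : dot n (cross p (killing p)) = - p 0 2 * dot n p.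
  rewrite cross_killingE// !dotlin (_ : dot n (vec3 0 0 1) = 0) ?sub0r ?mulNr//.
  by rewrite dotE !vec3E n2; ring.
have T := horizontal_energy_ge pp kp.
have wE : w p ^+ 2 = 1 - eps ^+ 2 * dot (killing p) (killing p) by rewrite kz_w_sqr.
have zE : p 0 2 ^+ 2 = 1 - dot (killing p) (killing p) by rewrite dot_killing_sqr//; ring.
have H : forall X, X = M * (- (1 - 2 * d * K * dot n p) * mu * dot n p
     - 2 * d * K * (2 * w p ^+ 2 / (dot (killing p) (killing p) * (1 + w p)) *
   (w p * dot n (killing p) ^+ 2 + dot n (cross p (killing p)) ^+ 2))
     + la * barrier n d K p) -> 0 <= X -> False.
  move=> X ->; rewrite pmulr_rge0//.
  exact: (contact_absurd (ltW np0) (dot_le1 pp) d0 K0 T hK (ltW C0) dC).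
apply: H; rewrite /mu nk.
move: (dot n (killing p)) (dot n p) (p 0 2) (dot (killing p) (killing p)) (w p)
  (barrier n d K p) wE zE r0 w0 => a y z r W b wE zE r0 w0.
have W1 : 0 < 1 + W by rewrite addr_gt0.
(* After substituting w^2 and z^2 in terms of |K|^2, - 2 w^2 + 2 eps^2 z^2 becomes - mu. *)
transitivity (M * ((1 - 2 * d * K * y) * (- 2 * W ^+ 2 * y + 2 * eps ^+ 2 * z ^+ 2 * y)
   - 2 * d * K * (2 * W ^+ 2 / (r * (1 + W)) * (W * a ^+ 2 + (- z * y) ^+ 2)) + la * b)).
  by field; rewrite !gt_eqF.
by rewrite zE wE; congr (M * (_ - _ + _)); ring.
Qed.

End MaximumPrinciple.

(** * Eigenfunctions depending only on the latitude *)

Section Radial.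
Variable R : realType.
Local Notation V := 'rV[R]_3.
Variables (eps : R) (F : V * V -> R).
Hypotheses (heps : 0 <= eps < 1) (hF : katok_ziller eps F).
Local Notation w := (kz_w eps).
Variables (f : V -> R) (la : R).
Hypothesis fs : smooth_S2 f.
Hypothesis fl : forall x, S2 x -> - finsler_laplace F f x = la * f x.
Hypothesis la_lt : la < 2 - 2 * eps ^+ 2.
Hypothesis la0 : la != 0.

Lemma eigenfunction_reflection (n x : V) : n 0 2 = 0 -> dot n n = 1 -> S2 x ->
  f (refl n x) = f x.
Proof.
have reflNn (l y : V) : refl (- l) y = refl l y.
  by rewrite /refl !dotlin; apply: row3P; rewrite !mxE; ring.
suff H (l : V) : l 0 2 = 0 -> dot l l = 1 -> S2 x -> 0 <= dot l x -> f (refl l x) = f x.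
  move=> n2 nn xx; have [|nx] := leP 0 (dot n x); first exact: H.
  rewrite -reflNn; apply: H => //; first by rewrite mxE n2 oppr0.
    by rewrite !dotlin opprK.
  by rewrite !dotlin oppr_ge0 ltW.
move=> l2 ll xx lx; apply/eqP; rewrite eq_le; apply/andP; split.
  (* The reverse inequality is the same lemma at the mirror point, for the opposite normal. *)
  have h := @eigenfunction_le_reflection _ _ _ heps hF (- l) _ _ f la fs fl la_lt (refl l x).
  rewrite reflNn refl_invol// in h; apply: h.
  - by rewrite mxE l2 oppr0.
  - by rewrite !dotlin opprK.
  - exact: S2_refl.
  - by rewrite dotNl dotn_refl// opprK.
exact: (eigenfunction_le_reflection heps hF l2 ll fs fl la_lt).
Qed.

Let a (phi : R) := f (polar phi 0).

Lemma radial_polar (phi theta : R) : f (polar phi theta) = a phi.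
Proof.
(* Normal to the meridian plane of longitude theta / 2, so the reflection exchanges longitudes 0 and
   theta. *)
pose n : V := vec3 (- sin (theta / 2)) (cos (theta / 2)) 0.
have nn : dot n n = 1.
  by rewrite dotE !vec3E -[RHS](cos2Dsin2 (theta / 2)); ring.
have tE : theta = theta / 2 + theta / 2 by field.
have c2 : cos theta = 1 - 2 * sin (theta / 2) ^+ 2.
  by rewrite {1}tE cosD -expr2 cos2sin2; ring.
have s2 : sin theta = 2 * sin (theta / 2) * cos (theta / 2).
  by rewrite {1}tE sinD; ring.
rewrite /a -(eigenfunction_reflection _ nn (polar_S2 phi 0)) ?vec3E//; congr f.
apply: row3P; rewrite /refl !(vec3E, mxE) !dotE !vec3E cos0 sin0 ?c2 ?s2; ring.
Qed.

(** Beyond the pole the meridian of longitude 0 continues as that of longitude pi. Hence [a] is even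
    at both poles and its derivative vanishes there. *)
Lemma radial_even phi : a (- phi) = a phi.
Proof.
rewrite -[RHS](radial_polar phi pi) /a; congr f.
by apply: row3P; rewrite !vec3E ?sinN ?cosN ?sin0 ?cos0 ?sinpi ?cospi; ring.
Qed.

Lemma radial_even_pi phi : a (pi - phi) = a (pi + phi).
Proof.
rewrite -[RHS](radial_polar (pi + phi) pi) /a; congr f.
rewrite ![pi + _]addrC.
by apply: row3P; rewrite !vec3E ?sinDpi ?sinDpi ?cosDpi ?cosDpi ?sinN ?cosN ?sin0 ?cos0 ?sinpi ?cospi; ring.
Qed.

Let g := f \o @unitv R.
Let g2 : twice_differentiable g := smooth_S2_twice fs.
Let dpolar phi : V := vec3 (cos phi) 0 (- sin phi).
Let a1 phi := 'D_(dpolar phi) g (polar phi 0).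
Let a2 phi := dot (hess g (polar phi 0) (dpolar phi)) (dpolar phi).

Let polar0E phi : polar phi 0 = vec3 (sin phi) 0 (cos phi) :> V.
Proof. by rewrite /polar cos0 sin0 mulr1 mulr0. Qed.

Let is_derive_polar (phi : R) : is_derive phi 1 (fun p => polar p 0) (dpolar phi).
Proof.
rewrite (funext polar0E).
exact: (is_derive_vec3 (is_derive_sin phi) (is_derive_cste (0:R) phi 1) (is_derive_cos phi)).
Qed.

Let is_derive_dpolar (phi : R) : is_derive phi 1 dpolar (- polar phi 0).
Proof.
apply: (is_derive_eq (is_derive_vec3 (is_derive_cos phi) (is_derive_cste (0:R) phi 1)
  (is_deriveNe (is_derive_sin phi)))).
by rewrite polar0E; apply: row3P; rewrite !(vec3E, mxE); ring.
Qed.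

Let polar_neq0 phi : polar phi 0 != 0 :> V.
Proof. exact: unitv_neq0 (polar_S2 phi 0). Qed.

Let aE phi : a phi = g (polar phi 0).
Proof. by rewrite /g /= unitv1//; exact: polar_S2. Qed.

Lemma is_derive_radial (phi : R) : is_derive phi 1 a (a1 phi).
Proof.
rewrite /a1 derive_grad; last exact: g2.1 (polar_neq0 phi).
exact: (is_derive_cast (@is_derive_grad _ g (fun p => polar p 0) _ _
  (g2.1 _ (polar_neq0 phi)) (is_derive_polar phi))
  (fun h => esym (aE h)) erefl).
Qed.

Let grad_polar phi : dot (grad g (polar phi 0)) (polar phi 0) = 0.
Proof. by rewrite -derive_grad; [exact: derive_radial|exact: g2.1]. Qed.

Lemma is_derive_radial1 (phi : R) : is_derive phi 1 a1 (a2 phi).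
Proof.
apply: (is_derive_eq (@is_derive_directional _ g g2 (fun p => polar p 0) _ _ _ _ (polar_neq0 phi)
  (is_derive_polar phi) (is_derive_dpolar phi))).
by rewrite dotNr grad_polar oppr0 addr0.
Qed.

(** g is constant on the parallel through the point, so its second derivative along it is 0: the
    Hessian term cancels the gradient against the acceleration, which is - sin^2 phi times the
    position minus sin phi cos phi times the meridian direction. *)
Lemma radial_hess_killing (phi : R) :
  dot (hess g (polar phi 0) (killing (polar phi 0))) (killing (polar phi 0)) =
  sin phi * cos phi * a1 phi.
Proof.
pose y (h : R) : V := polar phi h.
pose y1 (h : R) : V := vec3 (- (sin phi * sin h)) (sin phi * cos h) 0.
have dy (h : R) : is_derive h 1 y (y1 h).
  apply: (is_derive_eq (is_derive_vec3
    (is_deriveMe (is_derive_cste (sin phi) h 1) (is_derive_cos h))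
    (is_deriveMe (is_derive_cste (sin phi) h 1) (is_derive_sin h)) (is_derive_cste (cos phi) h 1))).
  by apply: row3P; rewrite !vec3E; ring.
have dy1 : is_derive (0:R) 1 y1 (vec3 (- sin phi) 0 0).
  have cs (r : R) := is_derive_cste r (0:R) (1:R).
  have D : is_derive (0:R) 1 y1 _ := is_derive_vec3
    (is_deriveNe (is_deriveMe (cs (sin phi)) (is_derive_sin (0:R))))
    (is_deriveMe (cs (sin phi)) (is_derive_cos (0:R))) (cs 0).
  apply: (is_derive_eq D).
  by apply: row3P; rewrite !vec3E ?sin0 ?cos0; ring.
have z h : 'D_(y1 h) g (y h) = 0.
  have yh : y h != 0 by exact: unitv_neq0 (polar_S2 phi h).
  rewrite derive_grad; last exact: g2.1.
  have [_ <-] := @is_derive_grad _ g y _ _ (g2.1 _ yh) (dy h).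
  have -> : (fun h => g (y h)) = cst (a phi).
    by apply/funext => s; rewrite /g /= unitv1 ?radial_polar//; exact: polar_S2.
  exact: derive_cst.
have [_ D] := @is_derive_directional _ g g2 y y1 _ _ _ (polar_neq0 phi) (dy 0) dy1.
have : 'D_1 (fun h : R => 'D_(y1 h) g (y h)) (0:R) = 0.
  rewrite (funext z); exact: derive_cst.
rewrite D; have -> : y1 0 = killing (polar phi 0).
  by rewrite polar0E; apply: row3P; rewrite !vec3E ?sin0 ?cos0; ring.
have -> : vec3 (- sin phi) 0 0 = (- sin phi ^+ 2) *: polar phi 0 + (- (sin phi * cos phi)) *: dpolar phi :> V.
  rewrite polar0E; apply: row3P; rewrite !(vec3E, mxE); [|ring|ring].
  by rewrite -[LHS]mulr1 -(cos2Dsin2 phi); ring.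
rewrite [dot (grad _ _) _]dotDr !dotZr grad_polar /a1 derive_grad; last exact: g2.1.
by rewrite mulr0 add0r mulNr => /eqP; rewrite subr_eq0 => /eqP.
Qed.

Lemma radial_ode (phi : R) : 0 < phi < pi ->
  la * a phi = - (2 * w (polar phi 0) ^+ 2 / (1 + w (polar phi 0)) *
    (w (polar phi 0) * cos phi * a1 phi / sin phi + a2 phi)
    + 2 * eps ^+ 2 * cos phi * sin phi * a1 phi).
Proof.
move=> hphi; have s0 : sin phi != 0 by rewrite gt_eqF// sin_gt0_pi.
have xx := polar_S2 phi 0; set x : V := polar phi 0 in xx *.
have kE : killing x = sin phi *: vec3 0 1 0.
  by rewrite /x polar0E; apply: row3P; rewrite !(vec3E, mxE); ring.
have kk : dot (killing x) (killing x) = sin phi ^+ 2.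
  by rewrite kE !dotlin dotE !vec3E; ring.
have kx : killing x != 0 by rewrite -dot_eq0 kk expf_neq0.
have capE : cross x (killing x) = - sin phi *: dpolar phi.
  by rewrite cross_killing_polar polar_phiE; congr (_ *: _); rewrite cos0 sin0 mulr1 mulr0.
rewrite -(fl xx) (finsler_laplace_offpole heps hF g2 xx kx) kk capE hessZ !dotlin.
rewrite radial_hess_killing -derive_grad; last exact: g2.1 (polar_neq0 phi).
rewrite -/(a1 phi) -/(a2 phi) (_ : x 0 2 = cos phi) ?vec3E//.
have w0 : 0 < w x := kz_w_gt0 heps xx.
have w1 : 1 + w x != 0 by rewrite gt_eqF// addr_gt0.
move: (a2 phi) (a1 phi) (w x) w1 => v u W W1.
by field; rewrite s0 W1.
Qed.

Let W (phi : R) := Num.sqrt (1 - eps ^+ 2 * sin phi ^+ 2).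

Let W_polar phi : w (polar phi 0) = W phi.
Proof.
rewrite /kz_w /kz_k polar0E /W; congr (Num.sqrt (_ - _ * _)).
by rewrite dotE !vec3E; ring.
Qed.

Let W_gt0 phi : 0 < W phi.
Proof. by rewrite -W_polar kz_w_gt0//; exact: polar_S2. Qed.

Let W_sqr phi : W phi ^+ 2 = 1 - eps ^+ 2 * sin phi ^+ 2.
Proof. by apply: sqr_sqrtr; rewrite ltW// -sqrtr_gt0; exact: W_gt0. Qed.

Let is_derive_W (phi : R) : is_derive phi 1 W (- (eps ^+ 2 * sin phi * cos phi / W phi)).
Proof.
have W0 : 0 < 1 - eps ^+ 2 * sin phi ^+ 2 by rewrite -sqrtr_gt0; exact: W_gt0.
apply: (is_derive_eq (is_derive_sqrte (is_deriveBe (is_derive_cste (1:R) phi 1)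
  (is_deriveMe (is_derive_cste (eps ^+ 2) phi 1) (is_derive_sqr (is_derive_sin phi)))) W0)).
by rewrite -/(W phi); field; rewrite gt_eqF.
Qed.

(* In the round case with la = 2 and a = cos, both E and the two squares in its
   derivative vanish identically. *)
Let E (phi : R) :=
  - (a1 phi * (la * (sin phi * a phi) + 2 * (cos phi * a1 phi))) * (W phi * (1 + W phi))^-1.

(** E is derivable at the poles too. Between them the equation eliminates la * a, and the derivative
    becomes a sum of two squares with nonnegative coefficients, since la < 2. *)
Lemma is_derive_radial_energy (phi : R) : exists d, is_derive phi 1 E d /\
  (0 < phi < pi -> d = (2 - la) * sin phi * a1 phi ^+ 2 / (W phi * (1 + W phi))
    + 2 * W phi * (cos phi * a1 phi - sin phi * a2 phi) ^+ 2
      / (sin phi * (1 + W phi) ^+ 2)).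
Proof.
have W0 : W phi != 0 by rewrite gt_eqF.
have W1 : 1 + W phi != 0 by rewrite gt_eqF// addr_gt0.
have WW : W phi * (1 + W phi) != 0 by rewrite mulf_neq0.
have cs (r : R) := is_derive_cste r phi (1 : R).
have da := is_derive_radial phi; have da1 := is_derive_radial1 phi.
have D : is_derive phi 1 E _ := is_deriveMe (is_deriveNe (is_deriveMe da1 (is_deriveDe
  (is_deriveMe (cs la) (is_deriveMe (is_derive_sin phi) da))
  (is_deriveMe (cs 2) (is_deriveMe (is_derive_cos phi) da1)))))
  (is_deriveVe (is_deriveMe (is_derive_W phi) (is_deriveDe (cs 1) (is_derive_W phi))) WW).
eexists; split; first exact: D.
move=> hphi; have s0 : sin phi != 0 by rewrite gt_eqF// sin_gt0_pi.
have O := radial_ode hphi; rewrite W_polar in O.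
(* Eliminating eps in favour of W leaves a rational identity. *)
have eE : eps ^+ 2 = (1 - W phi ^+ 2) / sin phi ^+ 2 by rewrite W_sqr; field.
move: (a phi) (a1 phi) (a2 phi) (W phi) (sin phi) (cos phi) O eE s0 W0 W1 WW => b u v X s c O eE s0 W0 W1 WW.
rewrite eE in O *.
have -> : la * (s * b) = s * (la * b) by ring.
have -> : la * (c * b + s * u) = c * (la * b) + la * s * u by ring.
rewrite O.
by field; rewrite s0 W0 W1.
Qed.

Lemma radial_derive_end : a1 0 = 0 /\ a1 pi = 0.
Proof.
have even (b : R -> R) (b0 : R) : b =1 (fun h => b (- h)) -> is_derive (0:R) 1 b b0 -> b0 = 0.
  move=> bN db; have dN : is_derive (0:R) 1 (fun h : R => - h) (- 1).
    exact: is_deriveNe (is_derive_id _ _).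
  have db' : is_derive (- (0:R)) 1 b b0 by rewrite oppr0.
  have [_ e1] := @is_derive1_comp _ b (fun h => - h) _ _ _ db' dN.
  have [_ e2] := db; move: e1; rewrite /comp -(funext bN) e2 => e1.
  by lra.
split.
  by apply: (even a); [move=> h; rewrite radial_even|exact: is_derive_radial].
apply: (even (fun h => a (pi + h))); first by move=> h; rewrite radial_even_pi.
have d1 : is_derive (0:R) 1 (fun h : R => pi + h) 1.
  by apply: (is_derive_eq (is_deriveDe (is_derive_cste (pi:R) _ _) (is_derive_id _ _))); rewrite add0r.
have d2 : is_derive (pi + 0 : R) 1 a (a1 pi) by rewrite addr0; exact: is_derive_radial.
by apply: (is_derive_eq (@is_derive1_comp _ a (fun h => pi + h) _ _ _ d2 d1)); rewrite mulr1.
Qed.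

(** E is nondecreasing with equal end values, hence constant, so both squares in its derivative
    vanish; the first is a1^2 with a positive coefficient. *)
Lemma radial_derive_zero (phi : R) : 0 <= phi <= pi -> a1 phi = 0.
Proof.
have [z0 zp] := radial_derive_end; have p0 := pi_gt0 R.
have E0 : E 0 = 0 by rewrite /E z0 mul0r oppr0 mul0r.
have Ep : E pi = 0 by rewrite /E zp mul0r oppr0 mul0r.
have dE t : derivable E t 1 by have [d [[]]] := is_derive_radial_energy t.
have la2 : 0 < 2 - la by move: la_lt (sqr_ge0 eps) => h1 h2; lra.
have nonneg t : t \in `]0, pi[%R -> 0 <= derive1 E t.
  rewrite in_itv/= derive1E => ht; have [d [[_ ->] ->]] := is_derive_radial_energy t => //.
  have s0 := sin_gt0_pi ht; have W0 := W_gt0 t.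
  have W1 : 0 < 1 + W t by rewrite addr_gt0.
  apply: addr_ge0; apply: divr_ge0.
  - exact: mulr_ge0 (mulr_ge0 (ltW la2) (ltW s0)) (sqr_ge0 _).
  - exact: mulr_ge0 (ltW W0) (ltW W1).
  - exact: mulr_ge0 (mulr_ge0 (ler0n _ 2) (ltW W0)) (sqr_ge0 _).
  - exact: mulr_ge0 (ltW s0) (sqr_ge0 _).
have cE : {within `[0, pi], continuous E}.
  by apply: derivable_within_continuous => t _; exact: dE.
have mono := @ger0_derive1_ndecr R E 0 pi (fun t _ => dE t) nonneg cE.
have Ez t : 0 <= t <= pi -> E t = 0.
  move=> /andP[t0 tp]; apply/eqP; rewrite eq_le -{1}Ep -E0.
  by rewrite !mono.
move=> /andP[]; rewrite !le_eqVlt => /orP[/eqP <-//|h0] /orP[/eqP ->//|hp].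
have hphi : 0 < phi < pi by rewrite h0 hp.
have [d [[_ dE0] dd]] := is_derive_radial_energy phi.
have d0 : d = 0.
  rewrite -dE0 -[RHS](derive_cst (0:R) phi (1:R)); apply: near_eq_derive => //.
  have : phi \in `]0, pi[%R by rewrite in_itv/= hphi.
  move=> /near_in_itvoo; apply: filterS => t; rewrite in_itv/= => /andP[t0 tp].
  by rewrite /cst Ez// !ltW.
have s0 := sin_gt0_pi hphi; have W0 := W_gt0 phi.
have W1 : 0 < 1 + W phi by rewrite addr_gt0.
rewrite d0 in dd; have {}dd := dd hphi.
have t1 : 0 <= 2 * W phi * (cos phi * a1 phi - sin phi * a2 phi) ^+ 2
      / (sin phi * (1 + W phi) ^+ 2).
  exact: divr_ge0 (mulr_ge0 (mulr_ge0 (ler0n _ 2) (ltW W0)) (sqr_ge0 _))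
    (mulr_ge0 (ltW s0) (sqr_ge0 _)).
have t2 : 0 < (2 - la) * sin phi / (W phi * (1 + W phi)) by rewrite divr_gt0 ?mulr_gt0.
have t3 : (2 - la) * sin phi / (W phi * (1 + W phi)) * a1 phi ^+ 2 <= 0.
  by rewrite mulrAC; lra.
apply/eqP; rewrite -sqrf_eq0 eq_le sqr_ge0 andbT.
by move: t3; rewrite pmulr_rle0.
Qed.

(** Once [a] has zero derivative, the equation at the equator reads la * a = 0, and la is nonzero;
    constancy along the meridian carries the zero to every latitude. *)
Lemma eigenfunction_zero (x : V) : S2 x -> f x = 0.
Proof.
have p0 := pi_gt0 R; pose h : R := pi / 2.
have hh : 0 < h < pi by apply/andP; split; rewrite /h; lra.
have ah : a h = 0.
  have z : a1 h = 0 by apply: radial_derive_zero; rewrite !ltW//; case/andP: hh.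
  have z2 : a2 h = 0.
    have [_ <-] := is_derive_radial1 h.
    rewrite -[RHS](derive_cst (0:R) h (1:R)); apply: near_eq_derive => //.
      have : h \in `]0, pi[%R by rewrite in_itv/= hh.
    move=> /near_in_itvoo; apply: filterS => t; rewrite in_itv/= => /andP[t0 tp].
    by rewrite /cst radial_derive_zero// !ltW.
  have := radial_ode hh; rewrite z z2 !(mulr0, mul0r, addr0, oppr0) => /eqP.
  by rewrite mulf_eq0 (negbTE la0) => /eqP.
have az t : 0 <= t <= pi -> a t = 0.
  move=> /andP[t0 tp]; have ca (r s : R) : {within `[r, s], continuous a}.
    by apply: derivable_within_continuous => y _; have [] := is_derive_radial y.
  have da (r s y : R) : y \in `]r, s[%R -> is_derive y 1 a (a1 y).
    by move=> _; exact: is_derive_radial.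
  have [ht|ht] := leP t h.
    have [c] := MVT_segment ht (da t h) (ca t h).
    rewrite in_itv/= => /andP[c1 c2]; rewrite radial_derive_zero ?mul0r ?ah.
      by move/eqP; rewrite subr_eq0 => /eqP.
    by case/andP: hh => h1 h2; apply/andP; split; lra.
  have [c] := MVT_segment (ltW ht) (da h t) (ca h t).
  rewrite in_itv/= => /andP[c1 c2]; rewrite radial_derive_zero ?mul0r ?ah.
    by move/eqP; rewrite subr_eq0 => /eqP.
  by case/andP: hh => h1 h2; apply/andP; split; lra.
by move=> /polar_surj[phi [theta [hphi _ ->]]]; rewrite radial_polar az.
Qed.

End Radial.

Theorem theorem3 (R : realType) (eps : R) (F : 'rV[R]_3 * 'rV[R]_3 -> R)
    (heps : 0 <= eps < 1) (hF : katok_ziller eps F) :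
  smallest_nonzero_eigenvalue F (2 - 2 * eps ^+ 2) /\
  2 - 2 * eps ^+ 2 = 8 * pi / finsler_volume F.
Proof.
have e1 := eps_sqr_lt1 heps.
split; last first.
  have p0 : (pi : R) != 0 by rewrite gt_eqF// pi_gt0.
  have e2 : 1 - eps ^+ 2 != 0 by rewrite gt_eqF// subr_gt0.
  rewrite (finsler_volumeE heps hF); move: (pi : R) p0 => P p0.
  by field; rewrite p0 e2.
split; first exact: laplace_eigenvalue_linear.
  by rewrite gt_eqF//; lra.
move=> la [f [fs [x xx fx] fl]] la0; rewrite leNgt; apply/negP => la_lt.
by move/eqP: fx; apply; exact: (eigenfunction_zero heps hF fs fl la_lt la0 xx).
Qed.
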